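(* The second-order S-SAV-CN scheme described in the context is uniquely solvable and unconditionally energy stable (i.e. for any time step $\Delta t>0$), in the following sense: (1) (Unique solvability) for every $n\ge1$, given $(\phi^{n-1},\psi^{n-1},u^{n-1})$ and $(\phi^n,\psi^n,u^n)$, the S-SAV-CN equations have a unique solution $(\phi^{n+1},\psi^{n+1},u^{n+1})$; (2) (Unconditional energy stability) for every $n\ge1$ the discrete energy dissipation law $$E_{CN}^{n+1}(\phi^{n+1},u^{n+1})\le E_{CN}^{n}(\phi^n,u^n)-\Delta t\,\frac{\beta}{M}\left\|\frac{\psi^{n+1}+\psi^n}{2}\right\|_{-1}^2$$ holds, where the discrete energy is $$E_{CN}^{n}(\phi^n,u^n)=\frac12\|(\Delta+1)\phi^n\|^2+\frac S2\|\phi^n-\phi^{n-1}\|^2+(u^n)^2+\frac{\alpha}{2M}\|\psi^n\|_{-1}^2 .$$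
   Context: Let $\Omega$ be a domain in $\mathbb{R}^d$, $d\in\{1,2,3\}$, with periodic boundary conditions (e.g. a periodic box $[0,L]^d$). $(\cdot,\cdot)$ and $\|\cdot\|$ are the $L^2(\Omega)$ inner product and norm. $L^2_0(\Omega)=\{v\in L^2(\Omega):(v,1)=0\}$, and $H^2_{per}(\Omega)$ is the space of periodic $H^2$ functions. For $v\in L_0^2(\Omega)$, $-\Delta^{-1}v$ denotes the unique $\varphi\in H^2_{per}(\Omega)\cap L^2_0(\Omega)$ with $-\Delta\varphi=v$, and $\|v\|_{-1}=\|\nabla\varphi\|=\sqrt{(-\Delta^{-1}v,v)}$; this norm is applied to the functions $\psi^n$, which have zero mean by the mass conservation property of the scheme. Parameters: mobility constant $M>0$; $\alpha,\beta$ non-negative; $\epsilon\in(0,1)$; vacancy penalization parameter $h_{vac}\gg1$ (the value $h_{vac}=0$ corresponds to no vacancy potential); stabilization parameter $S>0$; fixed time step $\Delta t>0$. Nonlinearities: $F(\phi)=\frac14\phi^4-\frac{\epsilon}{2}\phi^2$, $F_{vac}(\phi)=\frac{h_{vac}}{3}(|\phi|^3-\phi^3)$, $f(\phi)=F'(\phi)=\phi^3-\epsilon\phi$, $f_{vac}(\phi)=F_{vac}'(\phi)=h_{vac}(|\phi|-\phi)\phi$. $b$ is a constant ensuring that the radicand $\int_\Omega (F(\phi)+F_{vac}(\phi))\,dx+b$ is strictly positive, and $$H(\phi)=\frac{f(\phi)+f_{vac}(\phi)}{\sqrt{\int_\Omega (F(\phi)+F_{vac}(\phi))\,dx+b}}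 .$$ Notation for a sequence $(g^n)$: $g^{n+1/2}=\frac{g^{n+1}+g^n}{2}$, $g^{\dagger,n+1}=\frac32 g^n-\frac12 g^{n-1}$, $g^{\star,n+1}=2g^n-g^{n-1}$. Write $H^{\dagger,n+1}=H(\phi^{\dagger,n+1})$ and $H^0=H(\phi^0)$. S-SAV-CN equations ($n\ge1$), with unknown functions $\phi^{n+1},\psi^{n+1}$ and scalar $u^{n+1}$: $$\alpha\frac{\psi^{n+1}-\psi^n}{\Delta t}+\beta\psi^{n+1/2}=M\Delta\mu^{n+1/2},$$ $$\mu^{n+1/2}=(\Delta+1)^2\phi^{n+1/2}+H^{\dagger,n+1}u^{n+1/2}+S(\phi^{n+1}-\phi^{\star,n+1}),$$ $$\psi^{n+1/2}=\frac{\phi^{n+1}-\phi^n}{\Delta t},\qquad u^{n+1}-u^n=\frac12\int_\Omega H^{\dagger,n+1}(\phi^{n+1}-\phi^n)\,dx .$$ (Here $\mu^{n+1/2}$ is the function defined by the second equation.) Initial data: $\phi^0$ given, $\psi^0=0$, $u^0=\sqrt{\int_\Omega (F(\phi^0)+F_{vac}(\phi^0))\,dx+b}$, and $(\phi^1,\psi^1,u^1)$ is obtained from the first-order scheme $$\alpha\frac{\psi^1-\psi^0}{\Delta t}+\beta\psi^1=M\Delta\mu^1,\quad \mu^1=(\Delta+1)^2\phi^1+H^0u^1+S(\phi^1-\phi^0),$$ $$\psi^1=\frac{\phi^1-\phi^0}{\Delta t},\quad u^1-u^0=\frac12\int_\Omega H^0(\phi^1-\phi^0)\,dx .$$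
   Formalization: When α = β = 0 the equations only force μ to be constant, so mass conservation and uniqueness fail; in that single case the zero mean of the new ψ (also in the first step) is required as part of the scheme. *)

(* Defs.v *)
From HB Require Import structures.
From mathcomp Require Import all_boot all_order all_algebra.
From mathcomp Require Import all_classical all_reals all_analysis.
Set Implicit Arguments.
Unset Strict Implicit.
Unset Printing Implicit Defensive.
Import Order.TTheory GRing.Theory Num.Theory.
Import numFieldNormedType.Exports.
Local Open Scope classical_set_scope.
Local Open Scope ring_scope.

(* Row vectors carry the product sigma-algebra of the Borel sets of R. *)
Definition measure_rV_display : measure_display.
Proof. exact. Qed.

Section measurable_rV.
Context {R : realType} {n : nat}.

Let coords : 'I_n -> 'rV[R]_n -> measurableTypeR R := fun i x => x ord0 i.

Let rV_set0 : g_sigma_preimage coords set0.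
Proof. exact: sigma_algebra0. Qed.

Let rV_setC A : g_sigma_preimage coords A -> g_sigma_preimage coords (~` A).
Proof. exact: sigma_algebraC. Qed.

Let rV_bigcup (F : (set 'rV[R]_n)^nat) :
  (forall i, g_sigma_preimage coords (F i)) ->
  g_sigma_preimage coords (\bigcup_i F i).
Proof. exact: sigma_algebra_bigcup. Qed.

HB.instance Definition _ := @isMeasurable.Build measure_rV_display
  'rV[R]_n (g_sigma_preimage coords) rV_set0 rV_setC rV_bigcup.

End measurable_rV.

Lemma measurable_coord (R : realType) n (i : 'I_n) :
  measurable_fun [set: 'rV[R]_n] (fun x => x ord0 i : measurableTypeR R).
Proof.
move=> _ Y mY; rewrite setTI; apply: sub_sigma_algebra => /=.
rewrite -bigcup_seq/=; exists i => /=; first by rewrite mem_index_enum.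
by exists Y => //; rewrite setTI.
Qed.

Lemma measurable_fun_rV (R : realType) d (T : measurableType d) n
    (f : T -> 'rV[R]_n) :
  (forall i, measurable_fun [set: T]
     (fun t => f t ord0 i : measurableTypeR R)) ->
  measurable_fun [set: T] f.
Proof.
move=> mf.
have H : g_sigma_preimage (fun i t => f t ord0 i : measurableTypeR R)
    `<=` measurable.
  apply: smallest_sub; first exact: sigma_algebra_measurable.
  case: n f mf => [|n] f mf; first by rewrite big_ord0.
  rewrite -bigcup_mkord_ord; apply: bigcup_sub => i Ii.
  by move=> A [B mB <-]; exact: mf.
move=> _ A mA; apply: H.
have := @g_sigma_preimage_comp _ (measurableTypeR R) n 'rV[R]_n
  (fun i x => x ord0 i) T f.
by move=> ->; exists A.
Qed.

(* R^(n+1) is identified with R * R^n by splitting off the first coordinate. *)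
Definition rV_cons (R : realType) n (p : measurableTypeR R * 'rV[R]_n) : 'rV[R]_n.+1 :=
  \row_i oapp (fun j => p.2 ord0 j) p.1 (unlift ord0 i).

Definition rV_uncons (R : realType) n (x : 'rV[R]_n.+1) : measurableTypeR R * 'rV[R]_n :=
  (x ord0 ord0, \row_j x ord0 (lift ord0 j)).

Lemma measurable_rV_cons (R : realType) n :
  measurable_fun [set: _] (@rV_cons R n).
Proof.
apply: measurable_fun_rV => i.
rewrite (_ : (fun _ => _) = fun p : measurableTypeR R * 'rV[R]_n =>
  oapp (fun j => p.2 ord0 j) p.1 (unlift ord0 i)); last first.
  by apply/funext => p; rewrite mxE.
case: unliftP => [j|] _ /=; last exact: measurable_fst.
apply: (@measurableT_comp _ _ _ _ _ _ (fun x : 'rV[R]_n => x ord0 j : measurableTypeR R)) => //.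
exact: measurable_coord.
Qed.

Lemma measurable_rV_uncons (R : realType) n :
  measurable_fun [set: _] (@rV_uncons R n).
Proof.
apply/measurable_fun_pairP; split; first exact: measurable_coord.
apply: measurable_fun_rV => i.
rewrite (_ : (fun _ => _) =
    fun x : 'rV[R]_n.+1 => x ord0 (lift ord0 i) : measurableTypeR R).
  exact: measurable_coord.
by apply/funext => x /=; rewrite mxE.
Qed.

Lemma rV_consK (R : realType) n : cancel (@rV_cons R n) (@rV_uncons R n).
Proof.
move=> [t x]; congr pair; first by rewrite mxE unlift_none.
by apply/rowP => j; rewrite !mxE liftK.
Qed.

Section lebesgue_rV_step.
Context (R : realType) (n : nat).
Variable m : {sigma_finite_measure set 'rV[R]_n -> \bar R}.

Definition cons_measure : set 'rV[R]_n.+1 -> \bar R :=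
  pushforward (@lebesgue_measure R \x m)%E (@rV_cons R n).

Let cons_measure0 : cons_measure set0 = 0%E.
Proof. by rewrite /cons_measure /pushforward preimage_set0 measure0. Qed.
Let cons_measure_ge0 A : (0 <= cons_measure A)%E.
Proof. by rewrite /cons_measure /pushforward; apply: measure_ge0. Qed.
Let cons_measure_sigma : semi_sigma_additive cons_measure.
Proof.
move=> F mF tF mUF; rewrite /cons_measure /pushforward preimage_bigcup.
apply: measure_semi_sigma_additive.
- by move=> i; rewrite -[X in measurable X]setTI; exact: measurable_rV_cons.
- apply/trivIsetP => /= i j _ _ ij; rewrite -preimage_setI.
  by move/trivIsetP : tF => /(_ _ _ _ _ ij) ->//; rewrite preimage_set0.
- rewrite -preimage_bigcup -[X in measurable X]setTI.
  exact: measurable_rV_cons.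
Qed.

HB.instance Definition _ := isMeasure.Build _ _ _ cons_measure
  cons_measure0 cons_measure_ge0 cons_measure_sigma.

Let cons_measure_sigma_finite : sigma_finite setT cons_measure.
Proof.
have /sigma_finiteP[F [TF ndF Foo]] := sigma_finiteT (@lebesgue_measure R).
have /sigma_finiteP[G [TG ndG Goo]] := sigma_finiteT m.
have mFG i : measurable (F i `*` G i).
  by have [? _] := Foo i; have [? _] := Goo i; exact: measurableX.
exists (fun i => @rV_uncons R n @^-1` (F i `*` G i)).
  rewrite -preimage_bigcup (_ : \bigcup_i _ = setT) ?preimage_setT//.
  rewrite -setXTT TF TG predeqE => -[x y]; split.
    by move=> [i _ []/= ? ?]; split; exists i.
  move=> [/= [i _ Fix] [k _ Gky]]; exists (maxn i k) => //; split.
  - by move: x Fix; exact/subsetPset/ndF/leq_maxl.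
  - by move: y Gky; exact/subsetPset/ndG/leq_maxr.
move=> i; split.
  by rewrite -[X in measurable X]setTI; exact: measurable_rV_uncons.
rewrite /cons_measure /pushforward (_ : _ @^-1` _ = F i `*` G i).
  have [? ?] := Foo i; have [? ?] := Goo i.
  by rewrite product_measure1E// lte_mul_pinfty// ge0_fin_numE.
by apply/seteqP; split => p; rewrite /preimage /mkset rV_consK.
Qed.

HB.instance Definition _ :=
  Measure_isSigmaFinite.Build _ _ _ cons_measure cons_measure_sigma_finite.

End lebesgue_rV_step.

Fixpoint lebesgue_rV (R : realType) (n : nat) :
    {sigma_finite_measure set 'rV[R]_n -> \bar R} :=
  match n with
  | 0 => [the {sigma_finite_measure set _ -> \bar R} of \d_(0 : 'rV[R]_0)]
  | n'.+1 => cons_measure (lebesgue_rV R n')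
  end.

Section periodic_box.
Context (R : realType) (d : nat) (L : 'I_d -> R).
Implicit Types (f g v p : 'rV[R]_d -> R) (i j : 'I_d).

Definition box : set 'rV[R]_d := [set x | forall i, 0 <= x ord0 i <= L i].

Lemma measurable_box : measurable box.
Proof.
rewrite (_ : box = \bigcap_(i in [set: 'I_d])
    ((fun x : 'rV[R]_d => x ord0 i) @^-1` `[0, L i]%classic)); last first.
  by apply/seteqP; split => x /= xL i; have := xL i; rewrite /= in_itv/=; exact.
apply: fin_bigcap_measurable => [|i _]; first exact: finite_finset.
by rewrite -[X in measurable X]setTI; exact: (measurable_coord i).
Qed.

(* The flat torus is modelled by (R^d, Lebesgue measure restricted to the box):
   the values of an L^2 function outside the box are irrelevant, and
   periodicity is carried by the test functions in [weak_partial]. *)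
Definition box_measure : set 'rV[R]_d -> \bar R :=
  mrestr (lebesgue_rV R d) measurable_box.

HB.instance Definition _ := Measure.on box_measure.

Definition L2 f : Prop := f \in Lfun box_measure 2%:E.

Definition inner f g : R := \int[box_measure]_x (f x * g x).

Definition norm2 f : R := Num.sqrt (inner f f).

Definition zero_mean f : Prop := inner f (cst 1) = 0.

Definition partial i f : 'rV[R]_d -> R := fun x => 'D_(delta_mx ord0 i) f x.

Definition smooth f : Prop := forall s : seq 'I_d,
  continuous (foldr partial f s) /\
  forall i x, derivable (foldr partial f s) x (delta_mx ord0 i).

Definition periodic f : Prop :=
  forall i x, f (x + L i *: delta_mx ord0 i) = f x.

Definition weak_partial i f g : Prop := L2 g /\
  forall eta, smooth eta -> periodic eta ->
    inner f (partial i eta) = - inner g eta.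

Definition H2per f : Prop := L2 f /\
  forall i, exists2 g, weak_partial i f g & forall j, exists h, weak_partial j g h.

(* Meaningful (and then unique up to a null set) only if the weak derivative
   exists; the value is the zero function otherwise. *)
Definition wpartial i f : 'rV[R]_d -> R := xget (cst 0) (weak_partial i f).

Definition laplacian f : 'rV[R]_d -> R :=
  fun x => \sum_i wpartial i (wpartial i f) x.

Definition laplacian1 f : 'rV[R]_d -> R := fun x => laplacian f x + f x.

Definition inv_neg_laplacian v : 'rV[R]_d -> R :=
  xget (cst 0) [set p | [/\ H2per p, zero_mean p &
    (fun x => - laplacian p x) = v %[ae box_measure]]].

Definition norm_m1 v : R :=
  Num.sqrt (\sum_i norm2 (wpartial i (inv_neg_laplacian v)) ^+ 2).

End periodic_box.

Record sav_state (R : realType) (d : nat) := SavState {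
  phi : 'rV[R]_d -> R ;
  psi : 'rV[R]_d -> R ;
  sav : R }.

Section scheme.
Context (R : realType) (d : nat) (L : 'I_d -> R).
Context (M alpha beta eps hvac S dt b : R).
Implicit Types (v : 'rV[R]_d -> R) (s : sav_state R d).

Definition pot_F (r : R) : R := r ^+ 4 / 4 - eps / 2 * r ^+ 2.
Definition pot_Fvac (r : R) : R := hvac / 3 * (`|r| ^+ 3 - r ^+ 3).
Definition pot_f (r : R) : R := r ^+ 3 - eps * r.
Definition pot_fvac (r : R) : R := hvac * (`|r| - r) * r.

Definition radicand v : R :=
  \int[box_measure L]_x (pot_F (v x) + pot_Fvac (v x)) + b.

Definition sav_H v : 'rV[R]_d -> R :=
  fun x => (pot_f (v x) + pot_fvac (v x)) / Num.sqrt (radicand v).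

Definition admissible s : Prop :=
  [/\ H2per L (phi s), L2 L (psi s) & zero_mean L (psi s)].

Definition state_ae_eq s s' : Prop :=
  [/\ phi s = phi s' %[ae box_measure L],
      psi s = psi s' %[ae box_measure L] & sav s = sav s'].

(* If [alpha] or [beta] is nonzero, the zero mean of the new [psi] is a
   consequence of the first equation. If both vanish, that equation only says
   that the chemical potential is constant, and the conservation of mass has
   to be prescribed for the scheme to determine its solution. *)
Definition mass_condition s : Prop :=
  alpha = 0 -> beta = 0 -> zero_mean L (psi s).

(* The equations hold almost everywhere; the first line contains the regularity
   that makes each Laplacian in them an L^2 function. *)
Definition first_step s0 s1 : Prop :=
  let H0 := sav_H (phi s0) in
  let w := laplacian1 L (phi s1) in
  let mu := fun x => laplacian1 L w x + H0 x * sav s1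
                     + S * (phi s1 x - phi s0 x) in
  [/\ H2per L (phi s1), L2 L (psi s1), H2per L w & H2per L mu] /\
  [/\ mass_condition s1,
      (fun x => alpha * ((psi s1 x - psi s0 x) / dt) + beta * psi s1 x)
        = (fun x => M * laplacian L mu x) %[ae box_measure L],
      psi s1 = (fun x => (phi s1 x - phi s0 x) / dt) %[ae box_measure L] &
      sav s1 - sav s0 = 2^-1 * inner L H0 (fun x => phi s1 x - phi s0 x)].

Definition cn_step s0 s1 s2 : Prop :=
  let phi_half := fun x => (phi s2 x + phi s1 x) / 2 in
  let psi_half := fun x => (psi s2 x + psi s1 x) / 2 in
  let u_half := (sav s2 + sav s1) / 2 in
  let phi_dagger := fun x => 3 / 2 * phi s1 x - 2^-1 * phi s0 x in
  let phi_star := fun x => 2 * phi s1 x - phi s0 x in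
  let Hd := sav_H phi_dagger in
  let w := laplacian1 L phi_half in
  let mu := fun x => laplacian1 L w x + Hd x * u_half
                     + S * (phi s2 x - phi_star x) in
  [/\ H2per L (phi s2), L2 L (psi s2), H2per L w & H2per L mu] /\
  [/\ mass_condition s2,
      (fun x => alpha * ((psi s2 x - psi s1 x) / dt) + beta * psi_half x)
        = (fun x => M * laplacian L mu x) %[ae box_measure L],
      psi_half = (fun x => (phi s2 x - phi s1 x) / dt) %[ae box_measure L] &
      sav s2 - sav s1 = 2^-1 * inner L Hd (fun x => phi s2 x - phi s1 x)].

Definition scn_solution (s : nat -> sav_state R d) : Prop :=
  [/\ H2per L (phi (s 0)) /\ psi (s 0) = cst 0,
      sav (s 0) = Num.sqrt (radicand (phi (s 0))),
      first_step (s 0) (s 1) &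
      forall n, (1 <= n)%N -> cn_step (s n.-1) (s n) (s n.+1)].

Definition energy s_prev s : R :=
  2^-1 * norm2 L (laplacian1 L (phi s)) ^+ 2
  + S / 2 * norm2 L (fun x => phi s x - phi s_prev x) ^+ 2
  + sav s ^+ 2
  + alpha / (2 * M) * norm_m1 L (psi s) ^+ 2.

End scheme.

(* Main.v *)
(** On the torus the scheme is diagonal in Fourier space, up to a rank-one term.
    We use the real orthogonal basis [e_k = cos (theta_k) + sin (theta_k)], with
    [theta_k x = sum_i (2 pi / L_i) k_i x_i] and [k] in [Z^d], for which
    [d_i e_k = kappa_i e_(-k)]. Weak derivatives, Laplacians and [H^2] are then
    multipliers on square-summable sequences, and the equations say that the
    coefficients of [p = phi^(n+1/2)] are
    [p_k = (g_k - u H_k) / D_k] for [k <> 0], with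
    [D_k = (1 - |kappa|^2)^2 + 2 S + 2 A / (M |kappa|^2) > 0] and
    [A = 2 alpha / dt^2 + beta / dt], while [p_0] is fixed by mass conservation.
    Inserting this in the equation for the scalar [u = u^(n+1/2)] gives a linear
    equation with coefficient [1 + (H, D^-1 H) / 2 >= 1], hence a unique solution.
    That [H] is square integrable is where [d <= 3] enters, through the embedding
    of [H^2] in [L^oo]. The energy law is obtained by testing the first
    equation with [(-Delta)^-1 psi^(n+1/2)] and the second with
    [phi^(n+1) - phi^n]. *)

Require Import Defs.
From HB Require Import structures.
From mathcomp Require Import finmap.
From mathcomp Require Import all_boot all_order all_algebra.
From mathcomp Require Import all_classical all_reals all_analysis.
From mathcomp Require Import measurable_realfun ring lra.
Import Order.TTheory GRing.Theory Num.Theory.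
Import numFieldNormedType.Exports.
Local Open Scope classical_set_scope.
Local Open Scope ring_scope.
Set Implicit Arguments.
Unset Strict Implicit.
Unset Printing Implicit Defensive.

(** * Square-integrable functions and orthogonal systems *)

(** The basis is real with one function per frequency, so a real function has a real sequence of
    coefficients; the price is that differentiation exchanges [k] and [- k], and Parseval is needed
    along this involution. Completeness of the basis is reduced to indicators of half-spaces: a
    function orthogonal to the basis stays so after multiplication by a trigonometric polynomial,
    and suitable polynomials tend boundedly to such indicators. Division by [D_k] gains four
    derivatives, so [p] and [(Delta + 1) p] lie in [H^2] although [H] is only known to be square
    integrable. The chemical potential contains [H] itself, so its regularity cannot be obtained
    term by term; it is read off the first equation, where [M |kappa|^2 mu_k] is a square-summable
    sequence. For the embedding, [(1 + |kappa|^2)^(-2)] is bounded by a product of weights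
    [(|k_i| + 1)^(-4/3)], one per coordinate. The exponent is [4/d] for [d = 3]; it still exceeds
    [1], so the sum over [Z^d] factors into convergent sums. *)

Section inner_product.
Context {disp : measure_display} {T : measurableType disp} {R : realType}.
Variable mu : {finite_measure set T -> \bar R}.
Implicit Types f g h : T -> R.

Local Notation L2 f := (f \in Lfun mu 2%:E).
Local Notation ip f g := (Rintegral mu setT (fun x => f x * g x)).

Lemma L2_measurable f : L2 f -> measurable_fun setT f.
Proof. by case/andP => /[!inE]. Qed.

Lemma L2P f : measurable_fun setT f ->
  mu.-integrable setT (EFin \o (fun x => f x ^+ 2)) -> L2 f.
Proof.
move=> mf /integrableP[_ foo]; rewrite inE; apply/andP; split; first by rewrite inE.
rewrite inE /= /finite_norm unlock /Lnorm poweR_lty//.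
under eq_integral do rewrite /= powR_mulrn// -normrX.
exact: foo.
Qed.

Lemma L2_integrable f : L2 f -> mu.-integrable setT (EFin \o f).
Proof.
by move=> /Lfun_subset12 lf; apply/Lfun1_integrable/lf; exact: fin_num_measure.
Qed.

Lemma L2_integrableM f g : L2 f -> L2 g ->
  mu.-integrable setT (EFin \o (fun x => f x * g x)).
Proof. by move=> lf lg; apply/Lfun1_integrable/Lfun2_mul_Lfun1. Qed.

Lemma L2D f g : L2 f -> L2 g -> L2 (fun x => f x + g x).
Proof. exact: (@Lfun_addr_closed _ _ _ mu _ (lee1n 2)).2. Qed.

Lemma L2Z a f : L2 f -> L2 (fun x => a * f x).
Proof.
move=> lf; rewrite (_ : (fun x => _) = a \o* f); last by apply/funext => x; rewrite /= mulrC.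
by apply: Lfun_scale => //; rewrite ler1n.
Qed.

Lemma L2N f : L2 f -> L2 (fun x => - f x).
Proof.
move=> lf; have := L2Z (-1) lf.
by rewrite (_ : (fun x => -1 * f x) = (fun x => - f x))//; apply/funext => x; rewrite mulN1r.
Qed.

Lemma L2B f g : L2 f -> L2 g -> L2 (fun x => f x - g x).
Proof. by move=> lf lg; apply: L2D => //; exact: L2N. Qed.

Lemma L2_cst c : L2 (fun=> c : R).
Proof. exact: Lfun_cst. Qed.

Lemma L2_sum (I : Type) (r : seq I) (F : I -> T -> R) :
  (forall i, L2 (F i)) -> L2 (fun x => \sum_(i <- r) F i x).
Proof.
move=> lF; elim: r => [|i r IH].
  by under eq_fun do rewrite big_nil; exact: L2_cst.
by under eq_fun do rewrite big_cons; exact: L2D.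
Qed.

Lemma L2_bounded f C : measurable_fun setT f -> {ae mu, forall x, `|f x| <= C} ->
  L2 f.
Proof.
move=> mf fC; apply: L2P => //.
apply/integrableP; split.
  by apply/measurable_EFinP; exact: measurable_funX.
apply: (@le_lt_trans _ _ (\int[mu]_x (C ^+ 2)%:E)%E).
  apply: ae_ge0_le_integral => //.
  - by apply: measurableT_comp => //; apply/measurable_EFinP; exact: measurable_funX.
  - by move=> x _; rewrite lee_fin sqr_ge0.
  - apply: filterS fC => x fC _ /=; rewrite lee_fin ger0_norm ?sqr_ge0//.
    rewrite -real_normK ?num_real// lerXn2r// nnegrE//.
    exact: le_trans (normr_ge0 _) fC.
rewrite integral_cst//= lte_mul_pinfty// ?lee_fin ?sqr_ge0//.
by rewrite ltey_eq fin_num_measure.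
Qed.

Lemma ip_sym f g : ip f g = ip g f.
Proof. by apply: eq_Rintegral => x _; rewrite mulrC. Qed.

Lemma ipDl f g h : L2 f -> L2 g -> L2 h ->
  ip (fun x => f x + g x) h = ip f h + ip g h.
Proof.
move=> lf lg lh; rewrite -RintegralD//; try exact: L2_integrableM.
by apply: eq_Rintegral => x _; rewrite mulrDl.
Qed.

Lemma ipZl a f g : L2 f -> L2 g -> ip (fun x => a * f x) g = a * ip f g.
Proof.
move=> lf lg; rewrite -RintegralZl//; last exact: L2_integrableM.
by apply: eq_Rintegral => x _; rewrite mulrA.
Qed.

Lemma ipZr a f g : L2 f -> L2 g -> ip f (fun x => a * g x) = a * ip f g.
Proof. by move=> lf lg; rewrite ip_sym ipZl// ip_sym. Qed.

Lemma ipNl f g : L2 f -> L2 g -> ip (fun x => - f x) g = - ip f g.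
Proof.
move=> lf lg; rewrite -mulN1r -ipZl//.
by apply: eq_Rintegral => x _; rewrite mulN1r.
Qed.

Lemma ipDr f g h : L2 f -> L2 g -> L2 h ->
  ip f (fun x => g x + h x) = ip f g + ip f h.
Proof. by move=> lf lg lh; rewrite ip_sym ipDl// !(ip_sym f). Qed.

Lemma ipBl f g h : L2 f -> L2 g -> L2 h ->
  ip (fun x => f x - g x) h = ip f h - ip g h.
Proof. by move=> lf lg lh; rewrite ipDl ?ipNl//; exact: L2N. Qed.

Lemma ipBr f g h : L2 f -> L2 g -> L2 h ->
  ip f (fun x => g x - h x) = ip f g - ip f h.
Proof. by move=> lf lg lh; rewrite ip_sym ipBl// !(ip_sym f). Qed.

Lemma ip_suml (I : Type) (r : seq I) (F : I -> T -> R) g :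
  (forall i, L2 (F i)) -> L2 g ->
  ip (fun x => \sum_(i <- r) F i x) g = \sum_(i <- r) ip (F i) g.
Proof.
move=> lF lg; elim: r => [|i r IH].
  rewrite big_nil -[RHS](mul0r (ip g g)) -ipZl//.
  by apply: eq_Rintegral => x _; rewrite big_nil !mul0r.
rewrite big_cons -IH -ipDl//; last exact: L2_sum.
by apply: eq_Rintegral => x _; rewrite big_cons.
Qed.

Lemma ip_sumr (I : Type) (r : seq I) (F : I -> T -> R) g :
  (forall i, L2 (F i)) -> L2 g ->
  ip g (fun x => \sum_(i <- r) F i x) = \sum_(i <- r) ip g (F i).
Proof.
by move=> lF lg; rewrite ip_sym ip_suml//; apply: eq_bigr => i _; exact: ip_sym.
Qed.

Lemma ip_ge0 f : 0 <= ip f f.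
Proof. by apply: Rintegral_ge0 => x _; rewrite -expr2 sqr_ge0. Qed.

Lemma ip_ae f f' g : L2 f -> L2 f' -> L2 g -> f = f' %[ae mu] -> ip f g = ip f' g.
Proof.
move=> lf lf' lg ff'; congr fine; apply: ae_eq_integral => //.
- exact: measurable_int (L2_integrableM lf lg).
- exact: measurable_int (L2_integrableM lf' lg).
- by apply: filterS ff' => x /(_ I) + _ => ->.
Qed.

Lemma EFin_ip f g : L2 f -> L2 g -> (ip f g)%:E = (\int[mu]_x (f x * g x)%:E)%E.
Proof.
by move=> lf lg; rewrite fineK//; apply: integrable_fin_num => //; exact: L2_integrableM.
Qed.

Lemma ip_eq0 f : L2 f -> ip f f = 0 -> f = (fun=> 0) %[ae mu].
Proof.
move=> lf f0; have {}f0 : (\int[mu]_x (f x * f x)%:E)%E = 0%E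
  by rewrite -EFin_ip// f0.
have [+ _] := ae_eq_integral_abs mu measurableT (measurable_int _ (L2_integrableM lf lf)).
rewrite /=.
under eq_integral do rewrite ger0_norm ?sqr_ge0//.
move=> /(_ f0); apply: filterS => x /(_ I) [] /eqP.
by rewrite mulf_eq0 orbb => /eqP.
Qed.

Lemma cauchy_schwarz f g : L2 f -> L2 g -> ip f g ^+ 2 <= ip f f * ip g g.
Proof.
move=> lf lg.
have P (t : R) : 0 <= ip f f - 2 * t * ip f g + t ^+ 2 * ip g g.
  have ltg := L2Z t lg.
  have := ip_ge0 (fun x => f x - t * g x).
  rewrite ipBl ?ipBr ?ipZl ?ipZr//; try exact: L2B.
  by rewrite (ip_sym g f); congr (_ <= _); ring.
have := ip_ge0 g; rewrite le_eqVlt => /predU1P[g0|g0].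
  rewrite -g0 mulr0; have [->|fg0] := eqVneq (ip f g) 0; first by rewrite expr0n.
  (* When [g] has norm zero, the quadratic in [t] is affine and takes the value [-1] at this
     point. *)
  have := P ((ip f f + 1) / (2 * ip f g)); rewrite -g0 mulr0 addr0.
  by rewrite [2 * _ * _](_ : _ = ip f f + 1); [lra|field].
(* The minimiser of the quadratic. *)
have := P (ip f g / ip g g).
rewrite (_ : _ + _ = ip f f - ip f g ^+ 2 / ip g g); last by field; rewrite gt_eqF.
by rewrite subr_ge0 ler_pdivrMr.
Qed.

(** Bounds [a] and [b] stand in for the norms, which keeps square roots out of later estimates. *)
Lemma ler_ipM f g (a b : R) : L2 f -> L2 g -> 0 <= a -> 0 <= b ->
  ip f f <= a ^+ 2 -> ip g g <= b ^+ 2 -> `|ip f g| <= a * b.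
Proof.
move=> lf lg a0 b0 fa gb; rewrite -(ler_pXn2r (ltn0Sn 1)) ?nnegrE ?mulr_ge0//.
rewrite real_normK ?num_real// exprMn (le_trans (cauchy_schwarz lf lg))//.
by rewrite ler_pM ?ip_ge0.
Qed.

Lemma ler_ipD f g (a b : R) : L2 f -> L2 g -> 0 <= a -> 0 <= b ->
  ip f f <= a ^+ 2 -> ip g g <= b ^+ 2 ->
  ip (fun x => f x + g x) (fun x => f x + g x) <= (a + b) ^+ 2.
Proof.
move=> lf lg a0 b0 fa gb; rewrite ipDl ?ipDr//; last exact: L2D.
rewrite (ip_sym g f).
have := ler_ipM lf lg a0 b0 fa gb; rewrite ler_norml => /andP[_ fg].
rewrite sqrrD; lra.
Qed.

End inner_product.

(** * Convergence of series in [L^2] *)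

Section completeness.
Context {disp : measure_display} {T : measurableType disp} {R : realType}.
Variable mu : {finite_measure set T -> \bar R}.

Local Notation L2 f := (f \in Lfun mu 2%:E).
Local Notation ip f g := (Rintegral mu setT (fun x => f x * g x)).

Lemma limn_einf_le (u : (\bar R)^nat) (c : \bar R) :
  (forall n, (u n <= c)%E) -> (limn_einf u <= c)%E.
Proof.
move=> uc; rewrite limn_einf_lim; apply: lime_le; first exact: is_cvg_einfs.
apply: nearW => n; apply: le_trans (uc n); apply: ereal_inf_lbound.
by exists n => /=.
Qed.

Lemma half_geometric_le2 m n : \sum_(m <= j < n) (2^-1 : R) ^+ j <= 2 * 2^-1 ^+ m.
Proof.
have [mn|nm] := leqP m n; last by rewrite big_geq ?(ltnW nm)// mulr_ge0.
rewrite (_ : \sum_(m <= j < n) _ = 2 * (2^-1 ^+ m - 2^-1 ^+ n)); last first.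
  elim: n mn => [|n IH]; first by rewrite leqn0 => /eqP ->; rewrite big_geq// subrr mulr0.
  rewrite leq_eqVlt => /predU1P[->|]; first by rewrite big_geq// subrr mulr0.
  by rewrite ltnS => mn; rewrite big_nat_recr//= IH// exprS; lra.
by rewrite ler_pM2l// gerBl exprn_ge0.
Qed.

Variable g : nat -> T -> R.
Hypothesis Lg : forall j, L2 (g j).
Hypothesis gb : forall j, ip (g j) (g j) <= (2^-1 ^+ j) ^+ 2.

Lemma L2_series_tail m n :
  ip (fun x => \sum_(m <= j < n) g j x) (fun x => \sum_(m <= j < n) g j x)
  <= (\sum_(m <= j < n) 2^-1 ^+ j) ^+ 2.
Proof.
have [mn|nm] := leqP m n; last first.
  rewrite big_geq ?(ltnW nm)// expr0n /= /Rintegral integral0_eq// => x _.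
  by rewrite big_geq ?(ltnW nm)// mulr0.
elim: n mn => [|n IH].
  rewrite leqn0 => /eqP ->.
  rewrite big_geq// expr0n /= /Rintegral integral0_eq// => x _.
  by rewrite big_geq// mulr0.
rewrite leq_eqVlt => /predU1P[->|].
  rewrite big_geq// expr0n /= /Rintegral integral0_eq// => x _.
  by rewrite big_geq// mulr0.
rewrite ltnS => mn.
rewrite [leLHS](_ : _ = ip (fun x => \sum_(m <= j < n) g j x + g n x)
    (fun x => \sum_(m <= j < n) g j x + g n x)); last first.
  by apply: eq_Rintegral => x _; rewrite !big_nat_recr.
rewrite big_nat_recr//; apply: ler_ipD => //; last exact: IH.
- exact: L2_sum.
- by apply: sumr_ge0 => i _; exact: exprn_ge0.
Qed.

(** Absolute convergence gives the sum a pointwise meaning: [G] is integrable, because each term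
    contributes at most its [L^2] norm times the norm of the constant [1]. *)
Let G x : \bar R := (\sum_(0 <= j <oo) (`|g j x|)%:E)%E.

Let mg j : measurable_fun setT (fun x => (`|g j x|)%:E).
Proof.
apply/measurable_EFinP; apply: measurableT_comp => //.
exact: (L2_measurable (Lg j)).
Qed.

Let mG : measurable_fun setT G.
Proof. exact: ge0_emeasurable_sum. Qed.

Let G_lty : {ae mu, forall x, (G x < +oo)%E}.
Proof.
suff : mu.-integrable setT G.
  by move/(integrable_ae measurableT); apply: filterS => x /(_ I); rewrite ltey_eq => ->.
apply/integrableP; split; first exact: mG.
under eq_integral.
  move=> x _; rewrite gee0_abs; last by apply: nneseries_ge0 => n _ _; rewrite lee_fin.
  over.
rewrite integral_nneseries//.
pose C := Num.sqrt (fine (mu setT)).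
have Cp : 0 <= C by exact: sqrtr_ge0.
have onele : ip (fun=> 1) (fun=> 1) <= C ^+ 2.
  rewrite sqr_sqrtr ?fine_ge0// (@eq_Rintegral _ _ _ _ _ (cst 1)); last by move=> x _; rewrite mulr1.
  by rewrite Rintegral_cst// mul1r.
apply: (@le_lt_trans _ _ (2 * C)%:E); last exact: ltry.
apply: lime_le; first by apply: is_cvg_nneseries => n _ _; exact: integral_ge0.
apply: nearW => n.
have Ln j : L2 (fun x => `|g j x|).
  apply: L2P; first by apply: measurableT_comp => //; exact: L2_measurable (Lg j).
  rewrite (_ : _ \o _ = EFin \o (fun x => g j x * g j x)); first exact: L2_integrableM.
  by apply/funext => x /=; rewrite real_normK ?num_real// expr2.
rewrite (_ : (\sum_(0 <= k < n) _)%E = (\sum_(0 <= k < n) ip (fun x => `|g k x|) (fun=> 1))%:E); last first.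
  rewrite -sumEFin; apply: eq_bigr => k _; rewrite (EFin_ip (Ln k) (L2_cst _ 1)).
  by apply: eq_integral => x _; rewrite mulr1.
rewrite lee_fin (@le_trans _ _ (\sum_(0 <= k < n) (2^-1 ^+ k * C)))//.
  apply: ler_sum => k _; apply: le_trans (ler_norm _) _.
  apply: ler_ipM => //; first exact: L2_cst.
  rewrite (le_trans _ (gb k))// le_eqVlt; apply/orP; left; apply/eqP.
  by apply: eq_Rintegral => x _; rewrite -normrM ger0_norm// -expr2 sqr_ge0.
rewrite -mulr_suml ler_wpM2r//.
by rewrite (le_trans (half_geometric_le2 0 n))// expr0 mulr1.
Qed.

Let D := [set x | (G x < +oo)%E].

Let mD : measurable D.
Proof.
rewrite (_ : D = setT `&` [set x | (G x < cst +oo%E x)%E]); last by rewrite setTI.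
exact: emeasurable_fun_lt.
Qed.

(** Cutting off on the null set outside [D] makes the partial sums converge at every point, so that
    their limit is measurable. *)
Let g' j := g j \_ D.

Let g'_ae n : {ae mu, forall x, \sum_(0 <= j < n) g' j x = \sum_(0 <= j < n) g j x}.
Proof.
apply: filterS G_lty => x Dx; apply: eq_bigr => j _.
by rewrite /g' patchE mem_set.
Qed.

Let g'_cvg x : cvgn (fun n => \sum_(0 <= j < n) g' j x).
Proof.
suff : cvgn [normed series (fun j => g' j x)].
  by move/normed_cvg; rewrite seriesEnat.
rewrite /normed_series_of /= seriesEnat.
have [Dx|Dx] := pselect (D x).
  apply: nondecreasing_is_cvgn.
    by apply/nondecreasing_seqP => n; rewrite /= big_nat_recr//= lerDl.
  exists (fine (G x)) => _ [n _ <-].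
  have Gx : G x \is a fin_num.
    by rewrite ge0_fin_numE//; apply: nneseries_ge0 => j _ _; rewrite lee_fin.
  rewrite -lee_fin fineK// -sumEFin.
  apply: le_trans (nneseries_lim_ge (u_ := fun j => (`|g j x|)%:E) (P := xpredT) (m := 0) n _).
    by rewrite le_eqVlt; apply/orP; left; apply/eqP/eq_bigr => j _; rewrite /g' patchE mem_set.
  by move=> j _ _; rewrite lee_fin.
rewrite (_ : (fun _ => _) = cst 0); first exact: is_cvg_cst.
apply/funext => n /=; apply: big1 => j _.
by rewrite /g' patchE memNset// normr0.
Qed.

Let Lg' j : L2 (g' j).
Proof.
have mg' : measurable_fun setT (g' j).
  exact/(measurable_restrictT (g j) mD)/measurable_funTS/(L2_measurable (Lg j)).
apply: L2P => //.
apply: (le_integrable measurableT _ _ (L2_integrableM (Lg j) (Lg j))).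
  by apply/measurable_EFinP; exact: measurable_funX.
move=> x _; rewrite /= lee_fin /g' patchE; case: ifPn => _.
  by rewrite -expr2.
by rewrite expr0n/= normr0.
Qed.

(** The sum is the pointwise limit of the truncated partial sums. Fatou's lemma carries the bound on
    the blocks from [n] to [m + n] to the limit in [m]; the case [n = 0] shows that this limit is
    square integrable. *)
Lemma L2_series : exists2 f, L2 f & forall n,
  ip (fun x => f x - \sum_(0 <= j < n) g j x) (fun x => f x - \sum_(0 <= j < n) g j x)
  <= (2 * 2^-1 ^+ n) ^+ 2.
Proof.
pose f x := limn (fun n => \sum_(0 <= j < n) g' j x).
pose S n x := \sum_(0 <= j < n) g' j x.
have LS n : L2 (S n) by exact: L2_sum.
have Sf x : (S ^~ x) n @[n --> \oo] --> f x by exact: g'_cvg.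
have mf : measurable_fun setT f.
  by apply: (measurable_fun_cvg (h := S)) => // m; exact: L2_measurable.
have Fatou n : (\int[mu]_x ((f x - S n x) ^+ 2)%:E <= ((2 * 2^-1 ^+ n) ^+ 2)%:E)%E.
  pose h m x := (((S (m + n)%N x - S n x) ^+ 2)%:E : \bar R).
  have mh m : measurable_fun setT (h m).
    apply/measurable_EFinP/measurable_funX/measurable_funB; exact: L2_measurable.
  have h0 m x : setT x -> (0 <= h m x)%E by rewrite lee_fin sqr_ge0.
  have := fatou mu measurableT mh h0.
  rewrite (eq_integral (fun x => ((f x - S n x) ^+ 2)%:E)); last first.
    move=> x _; apply: (cvg_limn_einf_sup _).1.
    apply: cvg_EFin; first by exact: nearW.
    rewrite (_ : fine \o _ = fun m => (S (m + n)%N x - S n x) ^+ 2)//.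
    apply: (@cvg_comp _ _ _ _ (fun y => y ^+ 2) _ (nbhs (f x - S n x))); last exact: exprn_continuous.
    apply: cvgB; last exact: cvg_cst.
    by have := Sf x; rewrite -(cvg_shiftn n).
  move/le_trans; apply; apply: limn_einf_le => m.
  have LB := L2B (LS (m + n)%N) (LS n).
  rewrite (_ : (\int[mu]_x h m x)%E = (ip (fun x => S (m + n)%N x - S n x) (fun x => S (m + n)%N x - S n x))%:E); last first.
    by rewrite EFin_ip//.
  have LT : L2 (fun x => \sum_(n <= j < m + n) g j x) by exact: L2_sum.
  have E : (fun x => S (m + n)%N x - S n x) = (fun x => \sum_(n <= j < m + n) g j x) %[ae mu].
    have e1 := g'_ae (m + n); have e2 := g'_ae n.
    apply: filterS2 e1 e2 => x e1 e2 _.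
    by rewrite /S e1 e2 (big_cat_nat (n := n))//= ?leq_addl// addrAC subrr add0r.
  (* [ip_ae] replaces the left factor only, hence the symmetry between its two uses. *)
  rewrite (ip_ae LB LT LB E) ip_sym (ip_ae LB LT LT E) lee_fin.
  apply: le_trans (L2_series_tail n (m + n)) _.
  rewrite lerXn2r// ?nnegrE ?mulr_ge0 ?exprn_ge0 ?sumr_ge0//.
  exact: half_geometric_le2.
have Lf : L2 f.
  apply: L2P => //; apply/integrableP; split.
    by apply/measurable_EFinP; exact: measurable_funX.
  apply: le_lt_trans (ltry ((2 * 2^-1 ^+ 0) ^+ 2)).
  apply: le_trans (Fatou 0).
  apply: ge0_le_integral => //.
  - by apply: measurableT_comp => //; apply/measurable_EFinP; exact: measurable_funX.
  - apply/measurable_EFinP/measurable_funX/measurable_funB; first exact: mf.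
    exact: L2_measurable (LS 0).
  - by move=> x _; rewrite /= ger0_norm ?sqr_ge0// /S big_geq// subr0.
exists f => // n.
have LB := L2B Lf (LS n).
have LT : L2 (fun x => f x - \sum_(0 <= j < n) g j x) by apply: L2B => //; exact: L2_sum.
have E : (fun x => f x - S n x) = (fun x => f x - \sum_(0 <= j < n) g j x) %[ae mu].
  by apply: filterS (g'_ae n) => x E _; rewrite /S E.
rewrite -(ip_ae LB LT LT E) ip_sym -(ip_ae LB LT LB E) -lee_fin EFin_ip//.
exact: Fatou.
Qed.

End completeness.

Lemma big_fsetD_sub (R : zmodType) (I : choiceType) (s t : {fset I}) (F : I -> R) :
  (s `<=` t)%fset ->
  \sum_(k <- t) F k = \sum_(k <- s) F k + \sum_(k <- (t `\` s)%fset) F k.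
Proof.
move=> st; rewrite (big_fsetID _ (fun x => x \in s)) /=; congr (_ + _).
  apply: eq_fbigl => x; rewrite !inE /=; apply: andb_idl; exact: (fsubsetP st).
by apply: eq_fbigl => x; rewrite !inE /= andbC.
Qed.

Lemma geometric_eq0 (R : realType) (K a : R) :
  (forall n, `|a| <= K * 2^-1 ^+ n) -> a = 0.
Proof.
move=> aK; apply/eqP; rewrite -normr_le0.
have : K * 2^-1 ^+ n @[n --> \oo] --> K * 0.
  apply: cvgMl_tmp; apply: cvg_expr; rewrite ger0_norm// invf_lt1//; lra.
rewrite mulr0 => cK; rewrite -(cvg_lim _ cK)//.
by apply: limr_ge; [apply/cvg_ex; eexists; exact: cK|exact: nearW].
Qed.

(** * Fourier coefficients for an orthogonal system *)

Section orthogonal_system.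
Context {disp : measure_display} {T : measurableType disp} {R : realType}.
Variable mu : {finite_measure set T -> \bar R}.
Context {I : choiceType}.
Variables (e : I -> T -> R) (V : R).

Local Notation L2 f := (f \in Lfun mu 2%:E).
Local Notation ip f g := (Rintegral mu setT (fun x => f x * g x)).

Hypothesis V0 : 0 < V.
Hypothesis Le : forall k, L2 (e k).
Hypothesis ortho : forall k l, ip (e k) (e l) = V * (k == l)%:R.

Definition partial_sum (c : I -> R) (s : {fset I}) (x : T) : R :=
  \sum_(k <- s) c k * e k x.

Definition square_summable (c : I -> R) : Prop :=
  exists C, forall s : {fset I}, \sum_(k <- s) c k ^+ 2 <= C.

Lemma L2_partial_sum c s : L2 (partial_sum c s).
Proof. by apply: L2_sum => k; exact: L2Z. Qed.

Lemma ip_partial_suml c s g : L2 g ->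
  ip (partial_sum c s) g = \sum_(k <- s) c k * ip g (e k).
Proof.
move=> Lg; rewrite (ip_suml s (F := fun k x => c k * e k x))//.
  by apply: eq_bigr => k _; rewrite ipZl// ip_sym.
by move=> k; exact: L2Z.
Qed.

Lemma ip_partial_sum_basis c s l :
  ip (partial_sum c s) (e l) = if l \in s then V * c l else 0.
Proof.
rewrite ip_partial_suml//; case: ifPn => ls.
  rewrite (big_fsetD1 l)//= ortho eqxx mulr1 mulrC big1_fset ?addr0// => k.
  by rewrite !inE => /andP[kl _] _; rewrite ortho eq_sym (negbTE kl) !mulr0.
rewrite big1_fset// => k ks _; rewrite ortho.
by case: eqP => [lk|_]; [move: ls; rewrite lk ks|rewrite !mulr0].
Qed.

Lemma ip_partial_sum c s :
  ip (partial_sum c s) (partial_sum c s) = V * \sum_(k <- s) c k ^+ 2.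
Proof.
rewrite ip_partial_suml ?L2_partial_sum// mulr_sumr.
rewrite big_seq [RHS]big_seq; apply: eq_bigr => k ks.
by rewrite ip_partial_sum_basis ks; ring.
Qed.

(** Pythagoras: the residual is orthogonal to the partial sum. The weight [V^-1] appears because
    coefficients are inner products with functions of squared norm [V]. *)
Lemma ip_residual f s : L2 f ->
  let r x := f x - partial_sum (fun k => V^-1 * ip f (e k)) s x in
  ip r r = ip f f - V^-1 * \sum_(k <- s) ip f (e k) ^+ 2.
Proof.
move=> Lf; pose c k := V^-1 * ip f (e k); have Ls := L2_partial_sum c s.
have E : ip (partial_sum c s) f = V * \sum_(k <- s) c k ^+ 2.
  rewrite ip_partial_suml// mulr_sumr.
  by apply: eq_bigr => k _; rewrite /c; field; rewrite gt_eqF.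
rewrite /= -/c ipBl ?ipBr//; last exact: L2B.
rewrite ip_partial_sum (ip_sym mu f (partial_sum c s)) E subrr subr0.
congr (_ - _); rewrite !mulr_sumr.
by apply: eq_bigr => k _; rewrite /c; field; rewrite gt_eqF.
Qed.

Lemma bessel f (s : {fset I}) : L2 f -> \sum_(k <- s) ip f (e k) ^+ 2 <= V * ip f f.
Proof.
move=> Lf; have := ip_residual s Lf.
set r := fun x => _ => /= rE; have := ip_ge0 mu r; rewrite rE subr_ge0.
by rewrite ler_pdivrMl.
Qed.

Lemma square_summable_coef f : L2 f -> square_summable (fun k => ip f (e k)).
Proof. by move=> Lf; exists (V * ip f f) => s; exact: bessel. Qed.

Lemma square_summable_le (c c' : I -> R) :
  (forall k, `|c k| <= `|c' k|) -> square_summable c' -> square_summable c.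
Proof.
move=> cc' [C Cc]; exists C => s; rewrite (le_trans _ (Cc s))//.
apply: ler_sum => k _; rewrite -(real_normK (num_real (c k))).
by rewrite -(real_normK (num_real (c' k))) lerXn2r// nnegrE.
Qed.

Lemma square_summableZ (a : R) c :
  square_summable c -> square_summable (fun k => a * c k).
Proof.
move=> [C Cc]; exists (a ^+ 2 * C) => s.
under eq_bigr do rewrite exprMn.
by rewrite -mulr_sumr ler_wpM2l// sqr_ge0.
Qed.

Lemma square_summableD c c' : square_summable c -> square_summable c' ->
  square_summable (fun k => c k + c' k).
Proof.
move=> [C Cc] [C' Cc']; exists (2 * C + 2 * C') => s.
apply: (@le_trans _ _ (\sum_(k <- s) (2 * c k ^+ 2 + 2 * c' k ^+ 2))).
  by apply: ler_sum => k _; have := sqr_ge0 (c k - c' k); rewrite sqrrB sqrrD; lra.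
by rewrite big_split/= -!mulr_sumr lerD// ler_pM2l.
Qed.

(* The finite sets [t n] almost exhaust the sum of squares, which makes the
   argument independent of any enumeration of the index type. *)
Lemma riesz_fischer c : square_summable c ->
  exists (f : T -> R) (t : nat -> {fset I}), [/\ L2 f,
    forall k, ip f (e k) = V * c k &
    forall n, let r x := f x - partial_sum c (t n) x in
      ip r r <= (2 * 2^-1 ^+ n) ^+ 2].
Proof.
move=> [C Cc].
pose E := [set a | exists s : {fset I}, a = \sum_(k <- s) c k ^+ 2].
have supE : has_sup E.
  by split; [exists 0, fset0; rewrite big_seq_fset0|exists C => _ [s ->]].
(* With this margin the blocks [g n] below have squared norm at most [(2^-n)^2], as [L2_series]
   requires; the division by [V] compensates [ip_partial_sum]. *)
pose eps n : R := (2^-1 ^+ n) ^+ 2 / V.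
have eps0 n : 0 < eps n by rewrite divr_gt0// !exprn_gt0.
have /choice[s sP] n : exists s : {fset I}, sup E - eps n < \sum_(k <- s) c k ^+ 2.
  by have [_ [s ->] ?] := sup_adherent (eps0 n) supE; exists s.
pose fix t n : {fset I} := if n is m.+1 then (t m `|` s n)%fset else s 0%N.
have tS n : (t n `<=` t n.+1)%fset by exact: fsubsetUl.
have st n : (s n `<=` t n)%fset by case: n => [|n]//=; exact: fsubsetUr.
have tail n (u : {fset I}) : (t n `<=` u)%fset ->
    \sum_(k <- (u `\` t n)%fset) c k ^+ 2 <= eps n.
  move=> tu; have : \sum_(k <- u) c k ^+ 2 <= sup E.
    by apply: sup_upper_bound => //; exists u.
  rewrite (big_fsetD_sub _ tu) (big_fsetD_sub _ (st n)).
  have : 0 <= \sum_(k <- (t n `\` s n)%fset) c k ^+ 2.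
    by apply: sumr_ge0 => k _; exact: sqr_ge0.
  by have := sP n; lra.
pose g n x := partial_sum c (t n.+1) x - partial_sum c (t n) x.
have Lg n : L2 (g n) by apply: L2B; exact: L2_partial_sum.
have gE n x : g n x = partial_sum c (t n.+1 `\` t n)%fset x.
  by rewrite /g /partial_sum (big_fsetD_sub _ (tS n)) addrAC subrr add0r.
have gb n : ip (g n) (g n) <= (2^-1 ^+ n) ^+ 2.
  have -> : g n = partial_sum c (t n.+1 `\` t n)%fset by apply/funext => x; exact: gE.
  by rewrite ip_partial_sum mulrC -ler_pdivlMr// tail.
have [F LF Fb] := L2_series Lg gb.
pose f x := F x + partial_sum c (t 0) x.
have Lf : L2 f by apply: L2D => //; exact: L2_partial_sum.
have fb n : let r x := f x - partial_sum c (t n) x in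
    ip r r <= (2 * 2^-1 ^+ n) ^+ 2.
  rewrite /= (le_trans _ (Fb n))// le_eqVlt; apply/orP; left; apply/eqP.
  apply: eq_Rintegral => x _.
  suff -> : \sum_(0 <= j < n) g j x = partial_sum c (t n) x - partial_sum c (t 0) x.
    by rewrite /f; ring.
  by rewrite /g telescope_sumr.
exists f, t; split=> // k.
apply/eqP; rewrite -subr_eq0; apply/eqP.
have V_ge0 := ltW V0.
(* [3 = 2 + 1]: the distance from [f] to its partial sum gives [2], and a coefficient possibly
   missing from [t n] gives [1]. *)
apply: (@geometric_eq0 _ (3 * Num.sqrt V)) => n.
have Lt := L2_partial_sum c (t n).
have e1 : `|ip f (e k) - ip (partial_sum c (t n)) (e k)| <= 2 * 2^-1 ^+ n * Num.sqrt V.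
  rewrite -ipBl//; apply: (ler_ipM (L2B Lf Lt) (Le k) _ _ (fb n)).
  - by rewrite mulr_ge0// exprn_ge0.
  - exact: sqrtr_ge0.
  - by rewrite ortho eqxx mulr1 sqr_sqrtr.
have e2 : `|ip (partial_sum c (t n)) (e k) - V * c k| <= 2^-1 ^+ n * Num.sqrt V.
  rewrite ip_partial_sum_basis; case: ifPn => kt.
    by rewrite subrr normr0 mulr_ge0 ?sqrtr_ge0// exprn_ge0.
  (* A frequency outside [t n] is itself a tail, so its squared coefficient is at most [eps n]. *)
  have := tail n (k |` t n)%fset (fsubsetU1 _ _).
  rewrite (_ : (_ `\` _)%fset = [fset k]%fset); last first.
    apply/fsetP => i; rewrite !inE; have [->|] := eqVneq i k; first by rewrite kt.
    by rewrite andNb.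
  rewrite big_seq_fset1 /eps ler_pdivlMr// sub0r normrN => ck.
  rewrite -(ler_pXn2r (ltn0Sn 1)) ?nnegrE ?mulr_ge0 ?sqrtr_ge0 ?exprn_ge0//.
  by rewrite real_normK ?num_real// !exprMn sqr_sqrtr// expr2 -mulrA mulrC ler_wpM2r// mulrC.
rewrite (_ : _ - _ = ip f (e k) - ip (partial_sum c (t n)) (e k) +
  (ip (partial_sum c (t n)) (e k) - V * c k)); last by ring.
apply: le_trans (ler_normD _ _) _; apply: le_trans (lerD e1 e2) _.
by rewrite le_eqVlt; apply/orP; left; apply/eqP; ring.
Qed.

Lemma riesz_fischer_coef c : square_summable c ->
  exists2 f, L2 f & forall k, ip f (e k) = c k.
Proof.
move=> /(square_summableZ V^-1)/riesz_fischer[f [_ [Lf fc _]]]; exists f => // k.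
by rewrite fc mulVKf// gt_eqF.
Qed.

Hypothesis complete : forall f, L2 f -> (forall k, ip f (e k) = 0) ->
  f = (fun=> 0) %[ae mu].

Lemma coef_inj f g : L2 f -> L2 g -> (forall k, ip f (e k) = ip g (e k)) ->
  f = g %[ae mu].
Proof.
move=> Lf Lg fg; have LB := L2B Lf Lg.
have /(complete LB) : forall k, ip (fun x => f x - g x) (e k) = 0.
  by move=> k; rewrite ipBl// fg subrr.
by apply: filterS => x /[apply]/eqP; rewrite subr_eq0 => /eqP.
Qed.

(** By completeness, the function that [riesz_fischer] builds from the coefficients of [f] is [f],
    and enlarging the index set only decreases the residual. Allowing all larger sets lets several
    approximations be compared on one set. *)
Lemma partial_sum_approx f (eta : R) : L2 f -> 0 < eta ->
  exists s0 : {fset I}, forall s, (s0 `<=` s)%fset ->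
    let r x := f x - partial_sum (fun k => V^-1 * ip f (e k)) s x in
    ip r r <= eta ^+ 2.
Proof.
move=> Lf eta0; pose c k := V^-1 * ip f (e k).
have : square_summable c by apply: square_summableZ; exact: square_summable_coef.
move=> /riesz_fischer[F [t [LF Fc Ft]]].
have fF : F = f %[ae mu].
  by apply: coef_inj => // k; rewrite Fc /c mulVKf// gt_eqF.
have : 2 * 2^-1 ^+ n @[n --> \oo] --> 2 * (0 : R).
  by apply: cvgMl_tmp; apply: cvg_expr; rewrite ger0_norm// invf_lt1//; lra.
rewrite mulr0 => /cvgrPdist_lt/(_ eta eta0)[n _ /(_ n (leqnn n))] /=.
rewrite sub0r normrN ger0_norm ?mulr_ge0 ?exprn_ge0// => neta.
exists (t n) => s ts; rewrite ip_residual//.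
apply: (@le_trans _ _ (ip f f - V^-1 * \sum_(k <- t n) ip f (e k) ^+ 2)).
  rewrite lerB// ler_wpM2l// ?invr_ge0 ?(ltW V0)// (big_fsetD_sub _ ts) lerDl.
  by apply: sumr_ge0 => k _; exact: sqr_ge0.
rewrite -ip_residual//.
have Ls := L2_partial_sum c (t n).
have LB := L2B Lf Ls; have LB' := L2B LF Ls.
have EB : (fun x => F x - partial_sum c (t n) x) =
    (fun x => f x - partial_sum c (t n) x) %[ae mu].
  by apply: filterS fF => x /[apply] ->.
have := Ft n => /=; rewrite (ip_ae LB' LB LB' EB) ip_sym (ip_ae LB' LB LB EB).
by move/le_trans; apply; rewrite lerXn2r// ?nnegrE ?mulr_ge0 ?exprn_ge0// ltW.
Qed.

Lemma parseval_approx f g (eta : R) : L2 f -> L2 g -> 0 < eta ->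
  exists s0 : {fset I}, forall s, (s0 `<=` s)%fset ->
    `|ip f g - V^-1 * \sum_(k <- s) ip f (e k) * ip g (e k)| <= eta.
Proof.
move=> Lf Lg eta0.
pose b := Num.sqrt (ip g g) + 1.
have b0 : 0 < b by rewrite ltr_wpDl// sqrtr_ge0.
have [s0 s0P] := partial_sum_approx Lf (divr_gt0 eta0 b0).
exists s0 => s /s0P /= res; pose c k := V^-1 * ip f (e k).
have Ls := L2_partial_sum c s.
rewrite (_ : V^-1 * _ = ip (partial_sum c s) g); last first.
  by rewrite ip_partial_suml// mulr_sumr; apply: eq_bigr => k _; rewrite mulrA.
rewrite -ipBl//; apply: le_trans (ler_ipM (L2B Lf Ls) Lg _ (ltW b0) res _) _.
- by rewrite divr_ge0// ltW.
- rewrite -{1}(sqr_sqrtr (ip_ge0 mu g)) lerXn2r// ?nnegrE ?sqrtr_ge0 ?(ltW b0)//.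
  by rewrite lerDl.
- by rewrite divfK// gt_eqF.
Qed.

(** Finite sums of products approximate both inner products and agree over index sets matched by
    [sigma]. The relabelling serves [k] to [- k], which differentiation induces on the basis. *)
Lemma parseval_involutive (sigma : I -> I) f g f' g' : involutive sigma ->
  L2 f -> L2 g -> L2 f' -> L2 g' ->
  (forall k, ip f (e k) * ip g (e k) = ip f' (e (sigma k)) * ip g' (e (sigma k))) ->
  ip f g = ip f' g'.
Proof.
move=> sigmaK Lf Lg Lf' Lg' fg.
apply/eqP; rewrite -subr_eq0 -normr_le0; apply/ler_addgt0Pl => eta eta0; rewrite addr0.
have eta20 : 0 < eta / 2 by rewrite divr_gt0.
have [s0 s0P] := parseval_approx Lf Lg eta20.
have [s1 s1P] := parseval_approx Lf' Lg' eta20.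
(* Large enough for [f] and [g], and its image under [sigma] contains [s1]. *)
pose s := (s0 `|` sigma @` s1)%fset.
pose s' := (sigma @` s)%fset.
have ss' : (s1 `<=` s')%fset.
  apply/fsubsetP => k ks; apply/imfsetP; exists (sigma k); last by rewrite sigmaK.
  by rewrite /= inE; apply/orP; right; apply/imfsetP; exists k.
have E : \sum_(k <- s') ip f' (e k) * ip g' (e k) = \sum_(k <- s) ip f (e k) * ip g (e k).
  rewrite big_imfset/=; first by apply: eq_bigr => k _; rewrite fg.
  by move=> i j _ _; exact: (can_inj sigmaK).
have := s0P s (fsubsetUl _ _); have := s1P s' ss'; rewrite E.
rewrite !ler_norml => /andP[? ?] /andP[? ?]; apply/andP; split; lra.
Qed.

Lemma parseval_eq f g f' g' : L2 f -> L2 g -> L2 f' -> L2 g' ->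
  (forall k, ip f (e k) * ip g (e k) = ip f' (e k) * ip g' (e k)) ->
  ip f g = ip f' g'.
Proof. exact: (@parseval_involutive id). Qed.

End orthogonal_system.

(** * The box *)

Section row_vectors.
Context {R : realType}.

Lemma rV_unconsK n : cancel (@rV_uncons R n) (@rV_cons R n).
Proof.
move=> x; apply/rowP => j; rewrite mxE; case: unliftP => [i|] -> //=.
by rewrite mxE.
Qed.

Lemma cvg_rV n (S : Type) (F : set_system S) (FF : Filter F) (f : S -> 'rV[R]_n)
    (x : 'rV[R]_n) :
  (forall i, f s ord0 i @[s --> F] --> x ord0 i) -> f @ F --> x.
Proof.
move=> fx; apply/cvg_mx_entourageP => A entA.
apply: filter_forall => i0; apply: filter_forall => i.
rewrite ord1; have /cvg_app_entourageP/(_ A entA) := fx i.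
by apply: filterS => s /= ?; rewrite inE.
Qed.

Lemma continuous_rV n (S : topologicalType) (f : S -> 'rV[R]_n) :
  (forall i, continuous (fun s => f s ord0 i)) -> continuous f.
Proof. by move=> cf s; apply: cvg_rV => i; exact: cf. Qed.

Lemma continuous_rV_cons_l n (y : 'rV[R]_n) :
  continuous (fun t : R => rV_cons (t, y)).
Proof.
apply: continuous_rV => i; case: (unliftP ord0 i) => [j|] ->.
  rewrite (_ : (fun _ => _) = cst (y ord0 j)); first by move=> t; apply: cvg_cst.
  by apply/funext => t; rewrite mxE liftK.
rewrite (_ : (fun _ => _) = id); first by move=> t; apply: cvg_id.
by apply/funext => t; rewrite mxE unlift_none.
Qed.

Lemma continuous_rV_cons_r n (t : R) :
  continuous (fun y : 'rV[R]_n => rV_cons (t, y)).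
Proof.
apply: continuous_rV => i; case: (unliftP ord0 i) => [j|] ->.
  rewrite (_ : (fun _ => _) = fun y : 'rV[R]_n => y ord0 j); first exact: coord_continuous.
  by apply/funext => y; rewrite mxE liftK.
rewrite (_ : (fun _ => _) = cst t); first by apply: cst_continuous.
by apply/funext => y; rewrite mxE unlift_none.
Qed.

Lemma rV_cons_shift0 n (h t : R) (y : 'rV[R]_n) :
  rV_cons (h + t, y) = h *: delta_mx ord0 ord0 + rV_cons (t, y).
Proof.
apply/rowP => i; case: (unliftP ord0 i) => [j|] ->; rewrite !mxE ?liftK ?unlift_none /=.
  by rewrite mulr0 add0r.
by rewrite mulr1.
Qed.

Lemma rV_cons_shift n (h t : R) (y : 'rV[R]_n) j :
  rV_cons (t, h *: delta_mx ord0 j + y) =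
  h *: delta_mx ord0 (lift ord0 j) + rV_cons (t, y).
Proof.
apply/rowP => i; case: (unliftP ord0 i) => [k|] ->; rewrite !mxE ?liftK ?unlift_none /=.
  by rewrite !mxE (inj_eq lift_inj).
by rewrite mulr0 add0r.
Qed.

(* A continuous function is the pointwise limit of its values at the points of
   the grids [2^-m Z^n], and each of these approximations factors through the
   countable type ['rV[int]_n]. *)
Lemma continuous_measurable_rV n (f : 'rV[R]_n -> R) : continuous f ->
  measurable_fun setT f.
Proof.
move=> cf.
pose z m (x : 'rV[R]_n) : 'rV[int]_n := \row_i Num.floor (2 ^+ m * x ord0 i).
pose r m (k : 'rV[int]_n) : 'rV[R]_n := \row_i ((k ord0 i)%:~R / 2 ^+ m).
have mz m (k : 'rV[int]_n) : measurable [set x | z m x = k].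
  rewrite (_ : [set x | _] = \bigcap_(i in [set: 'I_n])
     ((fun x : 'rV[R]_n => x ord0 i) @^-1` ((fun t => 2 ^+ m * t) @^-1`
        `[(k ord0 i)%:~R, (k ord0 i)%:~R + 1[%classic))); last first.
    apply/seteqP; split => x /=.
      by move=> <- i _; rewrite /= in_itv/= mxE ge_floor /= -intrD1 lt_succ_floor.
    move=> xk; apply/rowP => i; rewrite mxE; apply/floor_def.
    by have := xk i I; rewrite /= in_itv/= intrD1.
  apply: fin_bigcap_measurable => [|i _]; first exact: finite_finset.
  rewrite -[X in measurable X]setTI; apply: (measurable_coord i) => //.
  by rewrite -[X in measurable X]setTI; exact: mulrl_measurable.
apply: (measurable_fun_cvg (h := fun m x => f (r m (z m x)))) => [m|x _].
  move=> _ B mB; rewrite setTI.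
  rewrite (_ : _ @^-1` _ = \bigcup_(k : 'rV[int]_n)
      if `[< B (f (r m k)) >] then [set x | z m x = k] else set0).
    apply: countable_bigcupT_measurable => [|k]; last by case: ifP.
    exact: countableP.
  apply/seteqP; split => x /=.
    by move=> Bx; exists (z m x) => //; case: ifPn => //; move=> /asboolPn.
  by move=> [k _]; case: ifPn => // /asboolP + /= zk; rewrite -zk.
apply: (cvg_comp (fun m => r m (z m x)) f); last exact: cf.
apply: cvg_rV => i.
apply/cvgrPdist_le => e e0.
have : 2^-1 ^+ m @[m --> \oo] --> (0 : R).
  by apply: cvg_expr; rewrite ger0_norm// invf_lt1//; lra.
move=> /cvgrPdist_lt/(_ e e0); apply: filterS => m /=.
rewrite sub0r normrN ger0_norm ?exprn_ge0// => /ltW; apply: le_trans.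
rewrite !mxE; have m0 : 0 < (2 : R) ^+ m by exact: exprn_gt0.
rewrite -[X in X - _](mulKf (lt0r_neq0 m0)) mulrC -mulrBl normrM exprVn.
rewrite [X in _ * X]ger0_norm ?invr_ge0 ?(ltW m0)// ger_pMl ?invr_gt0//.
have := floor_le (2 ^+ m * x ord0 i); have := lt_succ_floor (2 ^+ m * x ord0 i).
rewrite intrD1 ler_norml; lra.
Qed.

End row_vectors.

(** * Restricted measures and integration over the box *)

Section restricted_measure.
Context {disp : measure_display} {T : measurableType disp} {R : realType}.
Variables (mu : {measure set T -> \bar R}) (D : set T) (mD : measurable D).

Lemma mrestr_ae (P : T -> Prop) : (forall x, D x -> P x) ->
  {ae mrestr mu mD, forall x, P x}.
Proof.
move=> DP; exists (~` D); split; first exact: measurableC.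
  by rewrite /mrestr setICl measure0.
by move=> x /= nP Dx; apply: nP; exact: DP.
Qed.

Lemma integral_mrestr (f : T -> \bar R) : measurable_fun setT f ->
  (\int[mrestr mu mD]_x f x = \int[mu]_(x in D) f x)%E.
Proof.
move=> mf.
transitivity (\int[mrestr mu mD]_x (f \_ D) x)%E.
  apply: ae_eq_integral => //.
    exact/(measurable_restrictT f mD)/measurable_funTS.
  by apply: mrestr_ae => x Dx _; rewrite patchE mem_set.
rewrite -integral_mkcond; apply: eq_measure_integral => A mA AD.
by rewrite /= /mrestr setIidl.
Qed.

End restricted_measure.

Section itv_measure.
Context {R : realType}.
Variable l : R.

(** The factor of [box_measure] along one coordinate. *)
Definition itv_measure : set (measurableTypeR R) -> \bar R :=
  mrestr (@lebesgue_measure R) (measurable_itv `[0, l]).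

HB.instance Definition _ := Measure.on itv_measure.

Let itv_measure_fin : fin_num_fun itv_measure.
Proof.
move=> A mA; rewrite ge0_fin_numE//.
apply: (@le_lt_trans _ _ (@lebesgue_measure R `[0, l]%classic)).
  by apply: le_measure; rewrite ?inE//; exact: measurableI.
by rewrite lebesgue_measure_itv/=; case: ifP => _; rewrite -?EFinB ltry.
Qed.

HB.instance Definition _ :=
  @Measure_isFinite.Build _ _ _ itv_measure itv_measure_fin.

End itv_measure.

Section box.
Context {R : realType}.

Lemma box_cons n (L : 'I_n.+1 -> R) t (y : 'rV[R]_n) :
  box L (rV_cons (t, y)) <-> 0 <= t <= L ord0 /\ box (fun j => L (lift ord0 j)) y.
Proof.
split=> [b|[bt by_] i].
  split; first by have := b ord0; rewrite mxE unlift_none.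
  by move=> j; have := b (lift ord0 j); rewrite mxE liftK.
by case: (unliftP ord0 i) => [j|] ->; rewrite mxE ?liftK ?unlift_none //=; exact: by_.
Qed.

Lemma box_measure_uncons n (L : 'I_n.+1 -> R) A B : measurable A -> measurable B ->
  box_measure L (@rV_uncons R n @^-1` (A `*` B)) =
  (itv_measure (L ord0) A * box_measure (fun j => L (lift ord0 j)) B)%E.
Proof.
move=> mA mB; rewrite /box_measure /itv_measure /mrestr /= /cons_measure /pushforward.
rewrite -product_measure1E//; try exact: measurableI.
- congr (_ _); apply/seteqP; split=> -[t y]; rewrite /preimage /setI /mkset rV_consK /=.
    by move=> [[At By] /box_cons[bt by_]]; rewrite in_itv/=.
  move=> [[At bt] [By by_]]; split => //.
  by apply/box_cons; rewrite in_itv/= in bt.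
- by apply: measurableI => //; exact: measurable_box.
Qed.

Lemma box_measure_setT n (L : 'I_n.+1 -> R) :
  box_measure L setT = (itv_measure (L ord0) setT *
    box_measure (fun j => L (lift ord0 j)) setT)%E.
Proof. by rewrite -box_measure_uncons// setXTT preimage_setT. Qed.

Lemma box_measure_fin n (L : 'I_n -> R) : fin_num_fun (box_measure L).
Proof.
have fT : (box_measure L setT \is a fin_num)%E.
  elim: n L => [|n IH] L.
    by rewrite /box_measure /mrestr /= diracE.
  by rewrite box_measure_setT fin_numM// fin_num_measure.
move=> A mA; rewrite ge0_fin_numE//.
apply: (@le_lt_trans _ _ (box_measure L setT)); last by rewrite ltey_eq fT.
by apply: le_measure; rewrite ?inE.
Qed.

HB.instance Definition _ n (L : 'I_n -> R) :=
  @Measure_isFinite.Build _ _ _ (box_measure L) (box_measure_fin L).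

Lemma box_measure_gt0 n (L : 'I_n -> R) : (forall i, 0 < L i) ->
  (0 < box_measure L setT)%E.
Proof.
elim: n L => [|n IH] L L0.
  rewrite /box_measure /mrestr /= diracE setTI mem_set//=.
  by move=> [].
rewrite box_measure_setT mule_gt0//; last exact: IH.
rewrite /itv_measure /mrestr setTI lebesgue_measure_itv/= lte_fin L0.
by rewrite sube0 lte_fin.
Qed.

Lemma product_box_measure n (L : 'I_n.+1 -> R) (A : set (measurableTypeR R * 'rV[R]_n)) :
  measurable A ->
  (itv_measure (L ord0) \x box_measure (fun j => L (lift ord0 j)))%E A =
  box_measure L (@rV_uncons R n @^-1` A).
Proof.
move=> mA; unshelve epose proof (@product_measure_unique _ _ _ _ _ (itv_measure (L ord0))
  (box_measure (fun j => L (lift ord0 j)))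
  (pushforward (box_measure L) (@rV_uncons R n)) _ _ mA) as E.
- exact: measurable_rV_uncons.
- exact: box_measure_uncons.
- exact: E.
Qed.

Lemma box_measure_pushforward n (L : 'I_n.+1 -> R) A : measurable A ->
  box_measure L A =
  pushforward (itv_measure (L ord0) \x box_measure (fun j => L (lift ord0 j)))%E
    (@rV_cons R n) A.
Proof.
move=> mA; rewrite /pushforward product_box_measure.
  rewrite -comp_preimage (_ : _ \o _ = id) ?preimage_id//.
  by apply/funext => x /=; rewrite rV_unconsK.
by rewrite -[X in measurable X]setTI; exact: measurable_rV_cons.
Qed.

Lemma compact_box n (L : 'I_n -> R) : compact (box L).
Proof.
have := rV_compact (fun i => @segment_compact R 0 (L i)).
by congr compact; apply/seteqP; split => x /= xL i; have := xL i; rewrite /= in_itv.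
Qed.

Lemma continuous_bounded_box n (L : 'I_n -> R) (f : 'rV[R]_n -> R) : continuous f ->
  exists C, forall x, box L x -> `|f x| <= C.
Proof.
move=> cf.
have : compact (f @` box L).
  by apply: continuous_compact; [exact: continuous_subspaceT|exact: compact_box].
move=> /compact_bounded[C [_ Cf]]; exists (C + 1) => x bx.
by apply: (Cf (C + 1)); [rewrite ltrDl|exists x].
Qed.

Lemma L2_continuous n (L : 'I_n -> R) (f : 'rV[R]_n -> R) : continuous f -> L2 L f.
Proof.
move=> cf; have [C fC] := continuous_bounded_box L cf.
apply: (L2_bounded (C := C)); first exact: continuous_measurable_rV.
exact: mrestr_ae.
Qed.

(** Both orders are needed: when a derivative is integrated, the inner integral must be the one over
    the differentiated coordinate. *)
Lemma integral_continuous_rV_cons n (L : 'I_n.+1 -> R) (f : 'rV[R]_n.+1 -> R) :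
  continuous f ->
  (\int[box_measure L]_x (f x)%:E =
   \int[itv_measure (L ord0)]_t
     \int[box_measure (fun j => L (lift ord0 j))]_y (f (rV_cons (t, y)))%:E)%E /\
  (\int[box_measure L]_x (f x)%:E =
   \int[box_measure (fun j => L (lift ord0 j))]_y
     \int[itv_measure (L ord0)]_t (f (rV_cons (t, y)))%:E)%E.
Proof.
move=> cf; pose Lt (j : 'I_n) := L (lift ord0 j); rewrite -/Lt.
have mc := @measurable_rV_cons R n.
have mf : measurable_fun setT (EFin \o f).
  by apply/measurable_EFinP; apply: continuous_measurable_rV.
have mfc := measurableT_comp mf mc.
pose prd := (itv_measure (L ord0) \x box_measure Lt)%E.
have pf : prd.-integrable setT ((EFin \o f) \o @rV_cons R n).
  apply/integrableP; split => //.
  have := L2_integrable (L2_continuous L cf) => /integrableP[_].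
  rewrite (eq_measure_integral (pushforward prd (@rV_cons R n))); last first.
    by move=> A mA _; rewrite /= (box_measure_pushforward L mA).
  rewrite ge0_integral_pushforward//.
  exact: measurableT_comp.
rewrite (eq_measure_integral (pushforward prd (@rV_cons R n))); last first.
  by move=> A mA _; rewrite /= (box_measure_pushforward L mA).
rewrite integral_pushforward// preimage_setT.
by split; [rewrite -integral12_prod_meas1|rewrite -integral21_prod_meas1].
Qed.

(* Differentiating under a slice keeps the hypotheses, so the coordinate of the
   derivative can be moved to the front by induction on the dimension. *)
Lemma integral_partial_periodic n (L : 'I_n -> R) (i : 'I_n) (f g : 'rV[R]_n -> R) :
  (forall j, 0 < L j) -> continuous g ->
  (forall x, is_derive x (delta_mx ord0 i) f (g x)) ->
  (forall x, f (x + L i *: delta_mx ord0 i) = f x) ->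
  (\int[box_measure L]_x (g x)%:E = 0)%E.
Proof.
elim: n L i f g => [|n IH] L i f g L0 cg fg pf; first by case: i {fg pf}.
have [I1 I2] := integral_continuous_rV_cons L cg.
case: (unliftP ord0 i) => [j|] ij; subst i; last first.
  (* Leading coordinate: the inner integral vanishes by the fundamental theorem of calculus and
     periodicity. *)
  rewrite I2 integral0_eq// => y _.
  have cgy : continuous (fun t : R => g (rV_cons (t, y))).
    by move=> t; apply: continuous_comp; [exact: continuous_rV_cons_l|exact: cg].
  rewrite integral_mrestr; last first.
    by apply/measurable_EFinP; exact: continuous_measurable_fun.
  have Fd (t : R) : is_derive t 1 (fun t : R => f (rV_cons (t, y))) (g (rV_cons (t, y))).
    have E (h : R) : h^-1 *: (f (rV_cons (h *: 1 + t, y)) - f (rV_cons (t, y))) =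
        h^-1 *: (f (h *: delta_mx ord0 ord0 + rV_cons (t, y)) - f (rV_cons (t, y))).
      by rewrite -rV_cons_shift0 [h *: 1]mulr1.
    have [df vf] := fg (rV_cons (t, y)); split.
      by move: df; rewrite /derivable /=; under [in X in _ -> X]eq_fun do rewrite E.
    by rewrite -vf /derive /=; under [in LHS]eq_fun do rewrite E.
  rewrite (continuous_FTC2 (F := fun t : R => f (rV_cons (t, y))))//.
  - rewrite -EFinB; congr EFin; rewrite -[X in f (rV_cons (X, _)) - _]addr0.
    by rewrite rV_cons_shift0 [_ *: _ + _]addrC pf subrr.
  - exact: continuous_subspaceT.
  - have cF : continuous (fun t : R => f (rV_cons (t, y))).
      by move=> t; apply: differentiable_continuous; apply/derivable1_diffP; case: (Fd t).
    split; first by move=> t _; case: (Fd t).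
      by apply: cvg_at_right_filter; exact: cF.
    by apply: cvg_at_left_filter; exact: cF.
  - by move=> t _; rewrite derive1E; case: (Fd t).
rewrite I1 integral0_eq// => t _.
apply: (IH (fun j => L (lift ord0 j)) j (fun y => f (rV_cons (t, y)))) => //.
- by move=> y; apply: continuous_comp; [exact: continuous_rV_cons_r|exact: cg].
- move=> y.
  have E (h : R) : h^-1 *: (f (rV_cons (t, h *: delta_mx ord0 j + y)) - f (rV_cons (t, y))) =
      h^-1 *: (f (h *: delta_mx ord0 (lift ord0 j) + rV_cons (t, y)) - f (rV_cons (t, y))).
    by rewrite -rV_cons_shift.
  have [df vf] := fg (rV_cons (t, y)); split.
    by move: df; rewrite /derivable /=; under [in X in _ -> X]eq_fun do rewrite E.
  by rewrite -vf /derive /=; under [in LHS]eq_fun do rewrite E.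
- by move=> y; rewrite addrC rV_cons_shift addrC pf.
Qed.

End box.

Section box_inner.
Context {R : realType} {d : nat} {L : 'I_d -> R}.
Implicit Types f g h : 'rV[R]_d -> R.

Lemma L2_boxD f g : L2 L f -> L2 L g -> L2 L (fun x => f x + g x).
Proof. exact: L2D. Qed.

Lemma L2_boxB f g : L2 L f -> L2 L g -> L2 L (fun x => f x - g x).
Proof. exact: L2B. Qed.

Lemma L2_boxZ a f : L2 L f -> L2 L (fun x => a * f x).
Proof. exact: L2Z. Qed.

Lemma L2_box_cst c : L2 L (cst c).
Proof. exact: L2_cst. Qed.

Lemma inner_sym f g : inner L f g = inner L g f.
Proof. exact: ip_sym. Qed.

Lemma innerDl f g h : L2 L f -> L2 L g -> L2 L h ->
  inner L (fun x => f x + g x) h = inner L f h + inner L g h.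
Proof. exact: ipDl. Qed.

Lemma innerBl f g h : L2 L f -> L2 L g -> L2 L h ->
  inner L (fun x => f x - g x) h = inner L f h - inner L g h.
Proof. exact: ipBl. Qed.

Lemma innerZl a f g : L2 L f -> L2 L g ->
  inner L (fun x => a * f x) g = a * inner L f g.
Proof. exact: ipZl. Qed.

Lemma innerDr f g h : L2 L f -> L2 L g -> L2 L h ->
  inner L f (fun x => g x + h x) = inner L f g + inner L f h.
Proof. exact: ipDr. Qed.

Lemma innerBr f g h : L2 L f -> L2 L g -> L2 L h ->
  inner L f (fun x => g x - h x) = inner L f g - inner L f h.
Proof. exact: ipBr. Qed.

Lemma innerZr a f g : L2 L f -> L2 L g ->
  inner L f (fun x => a * g x) = a * inner L f g.
Proof. exact: ipZr. Qed.

Lemma inner_ge0 f : 0 <= inner L f f.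
Proof. exact: ip_ge0. Qed.

Lemma inner_ael f f' g : L2 L f -> L2 L f' -> L2 L g ->
  f = f' %[ae box_measure L] -> inner L f g = inner L f' g.
Proof. exact: ip_ae. Qed.

Lemma norm2_sqr f : norm2 L f ^+ 2 = inner L f f.
Proof. by rewrite sqr_sqrtr// inner_ge0. Qed.

End box_inner.

(** * The Hartley basis *)

Lemma continuous_scale (R : realType) n (c : R) (f : 'rV[R]_n -> R) :
  continuous f -> continuous (fun x => c * f x).
Proof.
move=> cf x; apply: (@continuous_comp _ _ _ f ( *%R c)); first exact: cf.
exact: mulrl_continuous.
Qed.

Section hartley.
Context {R : realType} {d : nat}.
Variable L : 'I_d -> R.
Hypothesis L0 : forall i, 0 < L i.
Implicit Types (k l : 'rV[int]_d) (x : 'rV[R]_d).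

Definition wave_number k i : R := 2 * pi / L i * (k ord0 i)%:~R.

Definition phase k x : R := \sum_i wave_number k i * x ord0 i.

Definition hartley k x : R := cos (phase k x) + sin (phase k x).

Lemma wave_numberD k l i : wave_number (k + l) i = wave_number k i + wave_number l i.
Proof. by rewrite /wave_number mxE intrD mulrDr. Qed.

Lemma wave_numberN k i : wave_number (- k) i = - wave_number k i.
Proof. by rewrite /wave_number mxE mulrNz mulrN. Qed.

Lemma wave_number_eq0 k i : (wave_number k i == 0) = (k ord0 i == 0).
Proof.
rewrite /wave_number mulf_eq0 intr_eq0 orb_idl// => /eqP; apply: contra_eqT => _.
by rewrite gt_eqF// divr_gt0// mulr_gt0// pi_gt0.
Qed.

Lemma phaseD k l x : phase (k + l) x = phase k x + phase l x.
Proof.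
by rewrite /phase -big_split; apply: eq_bigr => i _; rewrite wave_numberD mulrDl.
Qed.

Lemma phaseN k x : phase (- k) x = - phase k x.
Proof.
by rewrite /phase -sumrN; apply: eq_bigr => i _; rewrite wave_numberN mulNr.
Qed.

Lemma phase0 x : phase 0 x = 0.
Proof.
by rewrite /phase big1// => i _; rewrite /wave_number mxE mulr0 mul0r.
Qed.

Lemma phase_shift k x i (h : R) :
  phase k (h *: delta_mx ord0 i + x) = h * wave_number k i + phase k x.
Proof.
rewrite /phase (bigD1 i)//= [in RHS](bigD1 i)//= !mxE !eqxx mulr1 addrA.
congr (_ + _); first by ring.
apply: eq_bigr => j ji; rewrite !mxE eqxx /=.
by rewrite (negbTE ji) mulr0 add0r.
Qed.

Lemma hartleyN k x : hartley (- k) x = cos (phase k x) - sin (phase k x).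
Proof. by rewrite /hartley phaseN cosN sinN. Qed.

Lemma hartley0 x : hartley 0 x = 1.
Proof. by rewrite /hartley phase0 cos0 sin0 addr0. Qed.

(** The product is [cos (theta_k - theta_l) + sin (theta_k + theta_l)]. It reduces orthogonality to
    integrals of single basis functions, and shows that trigonometric polynomials are closed under
    multiplication. *)
Lemma hartleyM k l x : hartley k x * hartley l x =
  2^-1 * (hartley (k - l) x + hartley (l - k) x + hartley (k + l) x - hartley (- (k + l)) x).
Proof.
rewrite hartleyN /hartley !phaseD !phaseN !cosB !sinB !cosD !sinD.
by field.
Qed.

Lemma hartley_norm k x : `|hartley k x| <= 2.
Proof.
by apply: le_trans (ler_normD _ _) _; rewrite -[leRHS]/(1 + 1) lerD ?cos_max ?sin_max.
Qed.

Lemma is_derive_hartley k i x :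
  is_derive x (delta_mx ord0 i) (hartley k) (wave_number k i * hartley (- k) x).
Proof.
set c := wave_number k i; set p := phase k x.
have dG : is_derive (0 : R) 1 (fun t : R => cos (t * c + p) + sin (t * c + p))
    (c * hartley (- k) x).
  have dl : is_derive (0 : R) 1 (fun t : R => t * c + p) c.
    by apply: is_derive_eq; rewrite !(mul0r, mulr1, mulr0, scaler0, add0r, addr0) scaler1.
  have e0 : (0 : R) * c + p = p by rewrite mul0r add0r.
  have dc : is_derive (0 * c + p) 1 (@cos R) (- sin p) by rewrite e0; exact: is_derive_cos.
  have ds : is_derive (0 * c + p) 1 (@sin R) (cos p) by rewrite e0; exact: is_derive_sin.
  have := is_deriveD (is_derive1_comp (f := cos) (g := fun t : R => t * c + p) dc dl)
    (is_derive1_comp (f := sin) (g := fun t : R => t * c + p) ds dl).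
  by move/is_derive_eq; apply; rewrite hartleyN -/p; ring.
have E (h : R) : h^-1 *: ((cos ((h *: 1 + 0) * c + p) + sin ((h *: 1 + 0) * c + p)) -
      (cos (0 * c + p) + sin (0 * c + p))) =
    h^-1 *: (hartley k (h *: delta_mx ord0 i + x) - hartley k x).
  by rewrite /hartley phase_shift addr0 [h *: 1]mulr1 mul0r add0r.
have [df vf] := dG; split.
  by move: df; rewrite /derivable /=; under [in X in X -> _]eq_fun do rewrite E.
by rewrite -vf /derive /=; under [in RHS]eq_fun do rewrite E.
Qed.

Lemma partial_hartley k i :
  partial i (hartley k) = (fun x => wave_number k i * hartley (- k) x).
Proof.
by apply/funext => x; have := is_derive_hartley k i x; rewrite /partial; case.
Qed.

Lemma continuous_phase k : continuous (phase k).
Proof.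
have c i : continuous (fun x : 'rV[R]_d => wave_number k i * x ord0 i).
  by apply: continuous_scale; exact: coord_continuous.
by rewrite /phase; apply: continuous_big => [|i _]; [exact: add_continuous|exact: c].
Qed.

Lemma continuous_hartley k : continuous (hartley k).
Proof.
have c (g : R -> R) : continuous g -> continuous (fun x => g (phase k x)).
  move=> cg x; apply: (@continuous_comp _ _ _ (phase k) g); last exact: cg.
  exact: continuous_phase.
move=> x; apply: (@continuousD _ _ _ (fun x => cos (phase k x)) (fun x => sin (phase k x))).
  exact: (c _ (@continuous_cos R)).
exact: (c _ (@continuous_sin R)).
Qed.

(** The basis is stable, up to factors, under differentiation, so the iterated derivatives in
    [smooth] are explicit. *)
Lemma foldr_partial_hartley k (s : seq 'I_d) :
  exists (c : R) l, foldr (@partial R d) (hartley k) s = (fun x => c * hartley l x).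
Proof.
elim: s => [|i s [c [l IH]]] /=.
  by exists 1, k; apply/funext => x; rewrite mul1r.
exists (c * wave_number l i), (- l); rewrite IH; apply/funext => x.
have [dl vl] := is_derive_hartley l i x.
by rewrite /partial (deriveMl c dl) vl mulrA.
Qed.

Lemma smooth_hartley k : smooth (hartley k).
Proof.
move=> s; have [c [l ->]] := foldr_partial_hartley k s; split.
  by apply: continuous_scale; exact: continuous_hartley.
move=> i x; have [dl _] := is_derive_hartley l i x.
exact: (derivableM (derivable_cst c x _) dl).
Qed.

Lemma cos_sin_int (t : R) (z : int) :
  cos (t + 2 * pi * z%:~R) = cos t /\ sin (t + 2 * pi * z%:~R) = sin t.
Proof.
have E (n : nat) (u : R) : cos (u + 2 * pi * n%:R) = cos u /\ sin (u + 2 * pi * n%:R) = sin u.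
  have := periodicn (@cosD2pi R) n u; have := periodicn (@sinD2pi R) n u.
  by rewrite (_ : pi *+ 2 *+ n = 2 * pi * n%:R) ?(mulr_natr, mulr_natl)// => -> ->.
case: z => n; first exact: E.
rewrite NegzE mulrNz mulrN; have [<- <-] := E n.+1 (t - 2 * pi * n.+1%:R).
by rewrite subrK.
Qed.

Lemma periodic_hartley k : Defs.periodic L (hartley k).
Proof.
move=> i x; rewrite /hartley [x + _]addrC phase_shift [_ + phase k x]addrC.
rewrite (_ : L i * _ = 2 * pi * (k ord0 i)%:~R).
  by have [-> ->] := cos_sin_int (phase k x) (k ord0 i).
by rewrite /wave_number; field; rewrite gt_eqF.
Qed.

Lemma L2_hartley k : L2 L (hartley k).
Proof. by apply: L2_continuous; exact: continuous_hartley. Qed.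

Definition volume : R := fine (box_measure L setT).

Lemma volume_gt0 : 0 < volume.
Proof.
by apply: fine_gt0; rewrite box_measure_gt0//= ltey_eq fin_num_measure.
Qed.

(** For [k != 0] some [kappa_i] is nonzero, and [hartley k] is then, up to that factor, a partial
    derivative of the periodic function [hartley (- k)]. *)
Lemma integral_hartley k : inner L (hartley k) (cst 1) = volume * (k == 0)%:R.
Proof.
rewrite /inner (@eq_Rintegral _ _ _ _ _ (hartley k)); last by move=> x _; rewrite mulr1.
have [->|/eqP k0] := eqVneq k 0.
  rewrite (@eq_Rintegral _ _ _ _ _ (cst 1)); last by move=> x _; rewrite hartley0.
  by rewrite Rintegral_cst// mul1r mulr1.
have [i ki] : exists i, k ord0 i != 0.
  apply: contrapT => nk; apply: k0; apply/rowP => i; rewrite mxE.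
  by apply: contrapT => /eqP ki; apply: nk; exists i.
have c0 : wave_number (- k) i != 0 by rewrite wave_numberN oppr_eq0 wave_number_eq0.
have := @integral_partial_periodic R d L i (hartley (- k))
  (fun x => wave_number (- k) i * hartley k x) L0.
rewrite mulr0 /Rintegral => I0.
have /(congr1 fine) : (\int[box_measure L]_x (wave_number (- k) i * hartley k x)%:E = 0)%E.
  apply: I0.
  - by apply: continuous_scale; exact: continuous_hartley.
  - by move=> x; have := is_derive_hartley (- k) i x; rewrite opprK.
  - by move=> x; exact: periodic_hartley.
rewrite -[fine _]/(Rintegral _ _ _) RintegralZl//; last exact/L2_integrable/L2_hartley.
by move/eqP; rewrite mulf_eq0 (negbTE c0) => /eqP.
Qed.

Lemma hartley_orthogonal k l :
  inner L (hartley k) (hartley l) = volume * (k == l)%:R.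
Proof.
pose e m := hartley m.
have Le m : L2 L (e m) := L2_hartley m.
have L1 := L2_box_cst (L := L) 1.
transitivity (inner L (fun x => 2^-1 * (e (k - l) x + e (l - k) x + e (k + l) x - e (- (k + l)) x)) (cst 1)).
  by apply: eq_Rintegral => x _; rewrite mulr1 hartleyM.
have LS : L2 L (fun x => e (k - l) x + e (l - k) x) by exact: L2_boxD.
have LS' : L2 L (fun x => e (k - l) x + e (l - k) x + e (k + l) x) by exact: L2_boxD.
rewrite innerZl//; last exact: L2_boxB.
rewrite innerBl// innerDl// innerDl// !integral_hartley.
rewrite oppr_eq0 !subr_eq0 [l == k]eq_sym.
have [->|kl] := eqVneq k l; last by field.
by field.
Qed.

(** Integration by parts: the derivative of the periodic product of [eta] and [hartley k] integrates
    to zero. *)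
Lemma inner_partial_hartley (eta : 'rV[R]_d -> R) i k : smooth eta -> Defs.periodic L eta ->
  inner L (partial i eta) (hartley k) = - wave_number k i * inner L eta (hartley (- k)).
Proof.
move=> seta peta; have [ceta deta] := seta [::]; have [cd _] := seta [:: i].
have Leta : L2 L eta by exact: L2_continuous.
have Ld : L2 L (partial i eta) by exact: L2_continuous.
have Lk := L2_hartley k; have LNk := L2_hartley (- k).
suff : inner L (partial i eta) (hartley k) + wave_number k i * inner L eta (hartley (- k)) = 0.
  by move/eqP; rewrite addr_eq0 mulNr => /eqP.
rewrite -innerZr// /inner -RintegralD//; [|exact: L2_integrableM|].
  rewrite /Rintegral; set I := integral _ _ _; suff -> : I = 0%E by [].
  apply: (@integral_partial_periodic R d L i (fun x => eta x * hartley k x)) => //.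
  - have c (g : 'rV[R]_d -> R) : continuous g -> forall h, continuous h -> continuous (g \* h).
      by move=> cg h ch x; apply: continuousM; [exact: cg|exact: ch].
    move=> x; apply: (@continuousD _ _ _ (partial i eta \* hartley k)
      (eta \* (fun x => wave_number k i * hartley (- k) x))).
      by apply: c => //; exact: continuous_hartley.
    by apply: c => //; apply: continuous_scale; exact: continuous_hartley.
  - move=> x; have h1 := is_derive_hartley k i x.
    have h2 : is_derive x (delta_mx ord0 i) eta (partial i eta x).
      by apply: DeriveDef => //; exact: deta.
    have := is_deriveM h2 h1; move/is_derive_eq; apply.
    by rewrite /GRing.scale /= addrC mulrC.
  - by move=> x; rewrite peta periodic_hartley.
by apply: L2_integrableM => //; exact: L2_boxZ.
Qed.

End hartley.

(** The cut-off from the Brosowski-Deutsch proof of the Stone-Weierstrass theorem. Bernoulli's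
    inequality gives [(1 - y^n)^(2^n) >= 1 - (2 y)^n], which settles [y < 1/2]. For [y > 1/2] it
    gives [(1 + y^n)^(2^n) >= (2 y)^n], while the product of the two powers is at most [1]. *)
Lemma power_cutoff (R : realType) (y : R) : 0 <= y <= 1 -> y != 2^-1 ->
  (1 - y ^+ n) ^+ (2 ^ n) @[n --> \oo] --> ((y < 2^-1)%R%:R : R).
Proof.
move=> /andP[y0 y1] yh; have yn0 n : 0 <= y ^+ n by exact: exprn_ge0.
have yn1 n : y ^+ n <= 1 by exact: exprn_ile1.
have E n : (2 ^ n)%N%:R * y ^+ n = (2 * y : R) ^+ n by rewrite natrX exprMn.
have bern m (t : R) : -1 <= t -> 1 + m%:R * t <= (1 + t) ^+ m.
  move=> t1; elim: m => [|m IH]; first by rewrite mul0r addr0.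
  rewrite exprSr (@le_trans _ _ ((1 + m%:R * t) * (1 + t)))//.
    rewrite -natr1 mulrDl mul1r; have := mulr_ge0 (ler0n R m) (sqr_ge0 t); nra.
  by rewrite ler_wpM2r//; lra.
case: ltP => [yl|yg].
  have : 1 - (2 * y) ^+ n @[n --> \oo] --> (1 - 0 : R).
    apply: cvgB; first exact: cvg_cst.
    by apply: cvg_expr; rewrite ger0_norm ?mulr_ge0//; lra.
  rewrite subr0 mulr1n => c0; apply: (squeeze_cvgr _ c0 (cvg_cst (1 : R))).
  apply: nearW => n; apply/andP; split.
    by rewrite -E -mulrN; apply: bern; rewrite lerN2.
  by apply: exprn_ile1; rewrite ?subr_ge0 ?gerBl.
have y2 : 1 < 2 * y by move: yh; rewrite neq_lt ltNge yg/=; lra.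
have c0 : (2 * y)^-1 ^+ n @[n --> \oo] --> (0 : R).
  by apply: cvg_expr; rewrite ger0_norm ?invr_ge0 ?invf_lt1//; lra.
rewrite mulr0n; apply: (squeeze_cvgr _ (cvg_cst (0 : R)) c0).
apply: nearW => n; apply/andP; split.
  by apply: exprn_ge0; rewrite subr_ge0.
have p0 : 0 < (2 * y) ^+ n by apply: exprn_gt0; lra.
rewrite exprVn -[leRHS]mul1r ler_pdivlMr//.
have b : (2 * y) ^+ n <= (1 + y ^+ n) ^+ (2 ^ n).
  by rewrite -E (le_trans _ (bern _ _ _)) ?lerDr//; have := yn0 n; lra.
have q0 : 0 <= (1 - y ^+ n) ^+ (2 ^ n) by apply: exprn_ge0; rewrite subr_ge0.
rewrite (le_trans (ler_wpM2l q0 b))// -exprMn exprn_ile1//.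
  by rewrite mulr_ge0// ?subr_ge0// addr_ge0.
by have := mulr_ge0 (yn0 n) (yn0 n); nra.
Qed.

(** On a circle of length [l], the arc from [0] to [a] consists of the points at distance less than
    [a / 2] from its midpoint, and the cosine of the angular distance decreases with the
    distance. *)
Lemma cos_arc (R : realType) (l a t : R) : 0 < l -> 0 < a <= l -> 0 < t < l -> t != a ->
  (cos (pi * a / l) < cos (2 * pi / l * (t - a / 2))) = (t < a) /\
  cos (2 * pi / l * (t - a / 2)) != cos (pi * a / l).
Proof.
move=> l0 /andP[a0 al] /andP[t0 tl] ta.
have pi0 := pi_gt0 R.
set w := pi * a / l; set u := 2 * pi / l * (t - a / 2).
have w0 : 0 < w by rewrite divr_gt0// mulr_gt0.
have wpi : w <= pi by rewrite ler_pdivrMr// ler_pM2l.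
have q0 : 0 < pi / l by rewrite divr_gt0.
have uE : u = 2 * (pi / l) * t - w by rewrite /u /w; field; rewrite gt_eqF.
have wE : w = pi / l * a by rewrite /w; ring.
have tpi : pi / l * t < pi by rewrite mulrAC ltr_pdivrMr// ltr_pM2l.
have t0' : 0 < pi / l * t by rewrite mulr_gt0.
have mono (x y : R) : 0 <= x -> x < y -> y <= pi -> cos y < cos x.
  by move=> x0 xy yp; rewrite ltr_cos// in_itv/=; lra.
have := ta; rewrite neq_lt => /orP[tla|alt].
  have h : pi / l * t < w by rewrite wE ltr_pM2l.
  have lt : cos w < cos u.
    by rewrite -(cos_norm u); apply: mono => //; rewrite ltr_norml uE; lra.
  by rewrite lt tla gt_eqF.
have h : w < pi / l * t by rewrite wE ltr_pM2l.
have lt : cos u < cos w.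
  have [up|pu] := leP u pi; first by apply: mono => //; rewrite ?uE; lra.
  (* Past the antipode, the angle is reflected into the interval from [w] to [pi], where the cosine
     is monotone. *)
  rewrite (_ : cos u = cos (2 * pi - u)); last first.
    by rewrite -(cosN (2 * pi - u)) opprB mulr_natl -[in RHS](cosD2pi (u - _)) subrK.
  by apply: mono => //; rewrite ?uE; lra.
by rewrite ltNge (ltW lt) ltNge (ltW alt) lt_eqF.
Qed.

(** * Completeness of the Hartley basis *)

Section completeness.
Context {R : realType}.

(** Serves to discard the hyperplanes on which the cut-off polynomial takes the critical value
    [1/2]. *)
Lemma box_hyperplane d (L : 'I_d -> R) i c : box_measure L [set x | x ord0 i = c] = 0%E.
Proof.
elim: d L i => [|d IH] L i; first by case: i.
have ms (e : R) : measurable [set e : measurableTypeR R] by exact: measurable_set1.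
case: (unliftP ord0 i) => [j|] ij; subst i.
  transitivity (box_measure L (@rV_uncons R d @^-1` (setT `*` [set y : 'rV[R]_d | y ord0 j = c]))).
    congr (box_measure L _).
    by apply/seteqP; split => x /=; rewrite mxE; [split|case].
  rewrite box_measure_uncons ?IH ?mule0//.
  by rewrite -[X in measurable X]setTI; exact: (measurable_coord j _ (ms c)).
transitivity (box_measure L (@rV_uncons R d @^-1` ([set c] `*` setT))).
  by congr (box_measure L _); apply/seteqP; split => x /=; [split|case].
rewrite box_measure_uncons// /itv_measure /mrestr.
rewrite (@subset_measure0 _ _ _ (@lebesgue_measure R) _ [set c]) ?mul0e//.
- exact: measurableI.
- exact: lebesgue_measure_set1.
Qed.

Context {d : nat}.
Variable L : 'I_d -> R.
Hypothesis L0 : forall i, 0 < L i.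

Let null (h : 'rV[R]_d -> R) : Prop :=
  L2 L h /\ forall k, inner L h (hartley L k) = 0.

Let nullM_hartley h l : null h -> null (fun x => h x * hartley L l x).
Proof.
move=> [Lh h0].
have Lhl : L2 L (fun x => h x * hartley L l x).
  apply: L2P.
    apply: measurable_funM; first exact: L2_measurable Lh.
    exact: L2_measurable (L2_hartley L l).
  have Lh4 : L2 L (fun x => 2 * h x) by exact: L2_boxZ.
  apply: (le_integrable measurableT _ _ (L2_integrableM Lh4 Lh4)).
    apply/measurable_EFinP/measurable_funX/measurable_funM; first exact: L2_measurable Lh.
    exact: L2_measurable (L2_hartley L l).
  move=> x _; rewrite /= lee_fin -expr2 !normrX lerXn2r// ?nnegrE//.
  by rewrite !normrM mulrC ler_wpM2r// (ger0_norm (ler0n R 2)) hartley_norm.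
split=> // k.
have -> : inner L (fun x => h x * hartley L l x) (hartley L k) =
    inner L h (fun x => 2^-1 * (hartley L (l - k) x + hartley L (k - l) x +
       hartley L (l + k) x - hartley L (- (l + k)) x)).
  by apply: eq_Rintegral => x _; rewrite -mulrA hartleyM.
have Le m := L2_hartley L m.
have LS : L2 L (fun x => hartley L (l - k) x + hartley L (k - l) x) by exact: L2_boxD.
have LS' : L2 L (fun x => hartley L (l - k) x + hartley L (k - l) x + hartley L (l + k) x).
  exact: L2_boxD.
rewrite innerZr//; last exact: L2_boxB.
by rewrite innerBr// innerDr// innerDr// !h0 !addr0 subr0 mulr0.
Qed.

Let nullD h h' : null h -> null h' -> null (fun x => h x + h' x).
Proof.
move=> [Lh h0] [Lh' h0']; split=> [|k]; first exact: L2_boxD.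
by rewrite innerDl// ?h0 ?h0' ?addr0//; exact: L2_hartley.
Qed.

Let nullZ a h : null h -> null (fun x => a * h x).
Proof.
move=> [Lh h0]; split=> [|k]; first exact: L2_boxZ.
by rewrite innerZl// ?h0 ?mulr0//; exact: L2_hartley.
Qed.

Let halfspace i (a : R) : set 'rV[R]_d := [set x | x ord0 i < a].

Let measurable_halfspace i a : measurable (halfspace i a).
Proof.
rewrite (_ : halfspace i a = (fun x : 'rV[R]_d => x ord0 i) @^-1` `]-oo, a[%classic).
  by rewrite -[X in measurable X]setTI; exact: measurable_coord.
by apply/seteqP; split => x; rewrite /halfspace /= in_itv.
Qed.

Let ae_coord i c : {ae box_measure L, forall x : 'rV[R]_d, x ord0 i != c}.
Proof.
exists [set x : 'rV[R]_d | x ord0 i = c]; split.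
- rewrite -[X in measurable X]setTI.
  exact: (measurable_coord i _ (measurable_set1 c)).
- exact: box_hyperplane.
- by move=> x /= /negP; rewrite negbK => /eqP.
Qed.

Let L2_restrict h (E : set 'rV[R]_d) : measurable E -> L2 L h -> L2 L (h \_ E).
Proof.
move=> mE Lh; have mhE : measurable_fun setT (h \_ E).
  by apply/(measurable_restrictT h mE); apply: measurable_funTS; exact: L2_measurable Lh.
apply: L2P => //; apply: (le_integrable measurableT _ _ (L2_integrableM Lh Lh)).
  by apply/measurable_EFinP; exact: measurable_funX.
move=> x _; rewrite /= lee_fin patchE; case: ifPn => _; first by rewrite -expr2.
by rewrite expr0n/= normr0.
Qed.

(* The trigonometric polynomial [y] takes values in [0, 1] and is [< 1/2] exactly
   where [0 < x_i < a], so that [(1 - y^n)^(2^n)] tends to the indicator of this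
   slab almost everywhere on the box. *)
Let null_halfspace_in h i a : 0 < a <= L i -> null h ->
  null (h \_ (halfspace i a)).
Proof.
move=> aL nh; have [Lh h0] := nh.
pose k : 'rV[int]_d := delta_mx ord0 i.
pose c := 2 * pi / L i * (a / 2); pose s0 : R := cos (pi * a / L i).
pose s (x : 'rV[R]_d) := cos (2 * pi / L i * (x ord0 i - a / 2)).
pose y x := 2^-1 + (s0 - s x) / 4.
have phk x : phase L k x = 2 * pi / L i * x ord0 i.
  rewrite /phase (bigD1 i)//= big1 ?addr0.
    by rewrite /wave_number mxE !eqxx mulr1.
  by move=> j ji; rewrite /wave_number mxE (negbTE ji) mulr0 mul0r.
(* The addition formula for the cosine expands [y] over the constants and the frequencies [k] and
   [- k], so multiplication by [y] preserves [null]. *)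
have yE x : y x = (2^-1 + s0 / 4) + - ((cos c + sin c) / 8) * hartley L k x
    + - ((cos c - sin c) / 8) * hartley L (- k) x.
  rewrite /y hartleyN /hartley phk /s mulrBr -/c cosB; by field.
have y01 x : 0 <= y x <= 1.
  have := cos_le1 (pi * a / L i); have := cos_geN1 (pi * a / L i).
  have := cos_le1 (2 * pi / L i * (x ord0 i - a / 2)).
  have := cos_geN1 (2 * pi / L i * (x ord0 i - a / 2)).
  by rewrite -/(s x) -/s0 /y; lra.
have nully g : null g -> null (fun x => y x * g x).
  move=> ng; rewrite (_ : (fun x => _) = fun x => (2^-1 + s0 / 4) * g x +
    - ((cos c + sin c) / 8) * (g x * hartley L k x) +
    - ((cos c - sin c) / 8) * (g x * hartley L (- k) x)).
    by apply: nullD; [apply: nullD|]; apply: nullZ => //; exact: nullM_hartley.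
  by apply/funext => x; rewrite yE; ring.
have nullyn n g : null g -> null (fun x => (1 - y x ^+ n) * g x).
  move=> ng.
  have H : null (fun x => y x ^+ n * g x).
    elim: n => [|n IH]; first by under eq_fun do rewrite mul1r.
    by under eq_fun do rewrite exprS -mulrA; exact: nully.
  rewrite (_ : (fun x => _) = fun x => g x + -1 * (y x ^+ n * g x)).
    by apply: nullD => //; exact: nullZ.
  by apply/funext => x; ring.
pose q n x := (1 - y x ^+ n) ^+ (2 ^ n).
have nullq n : null (fun x => q n x * h x).
  rewrite /q; elim: (2 ^ n)%N => [|m IH]; first by under eq_fun do rewrite mul1r.
  by under eq_fun do rewrite exprS -mulrA; exact: nullyn.
have mH := measurable_halfspace i a.
have LhH := L2_restrict mH Lh.
split=> // l; have Ll := L2_hartley L l.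
(* Inside the box and off the hyperplanes where [x_i] is [0], [a] or [L i], [cos_arc] keeps [y] away
   from [1/2]. *)
have cvae : {ae box_measure L, forall x, setT x ->
    (fun n => (q n x * h x * hartley L l x)%:E) @ \oo -->
    ((h \_ (halfspace i a)) x * hartley L l x)%:E}.
  have bx : {ae box_measure L, forall x, box L x} by exact: mrestr_ae.
  apply: filterS3 (filterI bx (ae_coord i 0)) (ae_coord i (L i)) (ae_coord i a).
  move=> x [bx' x0] xL xa _; apply: cvg_EFin; first exact: nearW.
  have xi : 0 < x ord0 i < L i by rewrite !lt_def x0 eq_sym xL; exact: bx'.
  have [arc arc'] := cos_arc (L0 i) aL xi xa.
  have := power_cutoff (y01 x); rewrite (_ : y x < 2^-1 = (x ord0 i < a)); last first.
    by rewrite -arc /y gtrDl pmulr_llt0 ?invr_gt0// subr_lt0.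
  rewrite (_ : (y x != 2^-1) = true); last first.
    apply: contra arc' => /eqP; rewrite /y => /eqP.
    by rewrite -subr_eq0 addrAC subrr add0r mulf_eq0 invr_eq0 pnatr_eq0 orbF subr_eq0 eq_sym.
  move=> /(_ isT) cq.
  rewrite (_ : fine \o _ = fun n => q n x * (h x * hartley L l x)); last first.
    by apply/funext => n /=; rewrite mulrA.
  rewrite (_ : (h \_ (halfspace i a)) x * _ = (x ord0 i < a)%R%:R * (h x * hartley L l x)); last first.
    rewrite patchE; case: ifPn => [/set_mem|/negP]; rewrite /halfspace /=.
      by move=> ->; rewrite mul1r.
    by rewrite inE /= => /negP/negbTE ->; rewrite !mul0r.
  by apply: cvgMr_tmp; exact: cq.
have bound : {ae box_measure L, forall x n, setT x ->
    (`|(q n x * h x * hartley L l x)%:E| <= (`|h x * hartley L l x|)%:E)%E}.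
  apply: aeW => x n _; rewrite /= lee_fin -mulrA normrM ler_piMl//.
  have /andP[y0 y1] := y01 x.
  have yn : 0 <= 1 - y x ^+ n <= 1 by rewrite subr_ge0 exprn_ile1//= gerBl exprn_ge0.
  by case/andP: yn => yn0 yn1; rewrite ger0_norm ?exprn_ge0// exprn_ile1.
have [_ _ cv] := dominated_convergence measurableT
  (fun n => measurable_int _ (L2_integrableM (nullq n).1 Ll))
  (measurable_int _ (L2_integrableM LhH Ll))
  cvae (integrable_norm (L2_integrableM Lh Ll)) bound.
rewrite /inner /Rintegral.
suff -> : (\int[box_measure L]_x ((h \_ (halfspace i a)) x * hartley L l x)%:E = 0)%E by [].
rewrite -(cvg_lim _ cv)//; apply: cvg_lim => //.
rewrite (_ : (fun _ => _) = cst 0%E); first exact: cvg_cst.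
apply/funext => n; rewrite -[LHS](EFin_ip (nullq n).1 Ll).
by have [_ /(_ l)] := nullq n; rewrite /inner => ->.
Qed.

(** In the remaining cases the half-space contains the box or is disjoint from it, and the
    restriction is [h] or [0] there. *)
Let null_halfspace h i a : null h -> null (h \_ (halfspace i a)).
Proof.
move=> nh; have [Lh h0] := nh.
have bx : {ae box_measure L, forall x, box L x} by exact: mrestr_ae.
have LhH := L2_restrict (measurable_halfspace i a) Lh.
have [aL|La] := leP a (L i); last first.
  split=> // k; rewrite -(h0 k); apply: inner_ael => //; first exact: L2_hartley.
  apply: filterS bx => x bx _; rewrite patchE mem_set// /halfspace /=.
  by have /andP[_ xL] := bx i; exact: le_lt_trans xL La.
have [a0|a0] := leP a 0; last by apply: null_halfspace_in => //; rewrite a0.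
have L00 : L2 L (fun x => 0 * h x) by exact: L2_boxZ.
split=> // k; rewrite -[RHS](mul0r (inner L h (hartley L k))) -innerZl//; last exact: L2_hartley.
apply: inner_ael => //; first exact: L2_hartley.
apply: filterS bx => x bx _; rewrite patchE memNset ?mul0r// /halfspace /=.
by apply/negP; rewrite -leNgt; have /andP[x0 _] := bx i; exact: le_trans a0 x0.
Qed.

(** Lists of constraints make this a pi-system at once: intersection is concatenation. *)
Let boxes : set (set 'rV[R]_d) :=
  [set E | exists s : seq ('I_d * R), E = [set x : 'rV[R]_d | all (fun p : 'I_d * R => x ord0 p.1 < p.2) s]].

Let null_boxes h E : boxes E -> null h -> null (h \_ E).
Proof.
move=> [s ->] nh; elim: s => [|p s IH].
  rewrite (_ : h \_ _ = h)//; apply/funext => x; rewrite patchE mem_set//.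
rewrite (_ : h \_ _ = (h \_ [set x : 'rV[R]_d | all (fun p : 'I_d * R => x ord0 p.1 < p.2) s]) \_ (halfspace p.1 p.2)).
  exact: null_halfspace.
apply/funext => x; have mE (P : pred 'rV[R]_d) : (x \in [set x | P x]) = P x.
  by apply/idP/idP; rewrite inE.
rewrite !patchE /halfspace !mE /=.
by case: (_ < _).
Qed.

Let measurable_boxesE : @measurable _ 'rV[R]_d = <<s boxes >>.
Proof.
apply/seteqP; split; last first.
  apply: smallest_sub; first exact: sigma_algebra_measurable.
  move=> _ [s ->]; elim: s => [|p s IH].
    by rewrite (_ : [set x | _] = setT)//; apply/seteqP; split.
  rewrite (_ : [set x | _] = halfspace p.1 p.2 `&` [set x : 'rV[R]_d | all (fun p : 'I_d * R => x ord0 p.1 < p.2) s]).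
    by apply: measurableI => //; exact: measurable_halfspace.
  by apply/seteqP; split => x /=; [move/andP|move=> ?; exact/andP].
apply: smallest_sub; first exact: smallest_sigma_algebra.
rewrite -bigcup_seq/= => A [i _ [B mB <-]].
have : measurable_fun setT
    ((fun x => x ord0 i) : g_sigma_algebraType boxes -> measurableTypeR R).
  apply: (measurability _ (RGenInftyO.measurableE R)) => _ [_ [c ->] <-].
  rewrite setTI; apply: sub_sigma_algebra; exists [:: (i, c)].
  by apply/seteqP; split => x /=; rewrite in_itv/= andbT.
by move/(_ measurableT B mB).
Qed.

(** The integral of [h] over a member of [boxes] is the coefficient at [k = 0] of the restricted
    function, hence zero. Dynkin's theorem extends this to all measurable sets, which forces [h] to
    vanish almost everywhere. *)
Lemma hartley_complete h : L2 L h -> (forall k, inner L h (hartley L k) = 0) ->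
  h = (fun=> 0) %[ae box_measure L].
Proof.
move=> Lh h0.
have nh : null h by split.
pose P (E : set 'rV[R]_d) := (\int[box_measure L]_(x in E) (h x)%:E = 0)%E.
have ih := L2_integrable Lh.
have PT : P setT.
  rewrite /P -(@fineK _ (\int[box_measure L]_x (h x)%:E)%E); last exact: integrable_fin_num.
  congr EFin; rewrite -[RHS](h0 0); apply: eq_Rintegral => x _.
  by rewrite hartley0 mulr1.
have PE : forall E, measurable E -> P E.
  rewrite measurable_boxesE; apply: (dynkin_induction measurable_boxesE).
  - move=> _ _ [s ->] [t ->]; exists (s ++ t).
    by apply/seteqP; split => x /=; rewrite all_cat => /andP.
  - exact: PT.
  - move=> E bE; have [LhE hE] := null_boxes bE nh.
    have mE : measurable E by rewrite measurable_boxesE; exact: sub_sigma_algebra.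
    rewrite /P -(@fineK _ (\int[box_measure L]_(x in E) (h x)%:E)%E); last first.
      by apply: integrable_fin_num => //; exact: integrableS ih.
    congr EFin; rewrite -[LHS]/(Rintegral _ E h) Rintegral_mkcond -[RHS](hE 0).
    by apply: eq_Rintegral => x _; rewrite hartley0 mulr1.
  - move=> E mE; rewrite /P => E0.
    have := @integral_setU_EFin _ _ _ (box_measure L) E (~` E) h mE (measurableC mE).
    rewrite setUv => /(_ (L2_measurable Lh)); rewrite PT E0 add0e => <- //.
    by apply/disj_setPS; rewrite setICr.
  - move=> F mF tF F0; rewrite /P integral_bigcup//.
      by apply: eseries0 => n _ _; exact: F0.
    by apply: integrableS ih => //; exact: bigcup_measurable.
have /= E := integral_ae_eq measurableT (g := cst 0%E) ih (measurable_cst _).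
have {}E := E (fun A _ mA => etrans (PE A mA) (esym (integral0 _ _))).
by apply: filterS E => x /[apply] -[].
Qed.

End completeness.

(** * Weak derivatives as multipliers *)

Section fourier.
Context {R : realType} {d : nat}.
Variable L : 'I_d -> R.
Hypothesis L0 : forall i, 0 < L i.
Implicit Types (f g h p v : 'rV[R]_d -> R) (k : 'rV[int]_d) (c : 'rV[int]_d -> R).

Definition coef f k : R := inner L f (hartley L k).

Lemma coefD f g k : L2 L f -> L2 L g -> coef (fun x => f x + g x) k = coef f k + coef g k.
Proof. by move=> Lf Lg; rewrite /coef innerDl//; exact: L2_hartley. Qed.

Lemma coefB f g k : L2 L f -> L2 L g -> coef (fun x => f x - g x) k = coef f k - coef g k.
Proof. by move=> Lf Lg; rewrite /coef innerBl//; exact: L2_hartley. Qed.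

Lemma coefZ a f k : L2 L f -> coef (fun x => a * f x) k = a * coef f k.
Proof. by move=> Lf; rewrite /coef innerZl//; exact: L2_hartley. Qed.

Lemma coef_ae f g k : L2 L f -> L2 L g -> f = g %[ae box_measure L] ->
  coef f k = coef g k.
Proof. by move=> Lf Lg fg; apply: inner_ael => //; exact: L2_hartley. Qed.

Lemma coef_eq f g : L2 L f -> L2 L g -> (forall k, coef f k = coef g k) ->
  f = g %[ae box_measure L].
Proof.
exact: (coef_inj (L2_hartley L) (hartley_complete L0)).
Qed.

Lemma ex_coef c : square_summable c -> exists2 f, L2 L f & forall k, coef f k = c k.
Proof. exact: (riesz_fischer_coef (volume_gt0 L0) (L2_hartley L) (hartley_orthogonal L0)). Qed.

Lemma square_summable_coefs f : L2 L f -> square_summable (coef f).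
Proof.
exact: (square_summable_coef (volume_gt0 L0) (L2_hartley L) (hartley_orthogonal L0)).
Qed.

Lemma inner_coef_eq f g f' g' : L2 L f -> L2 L g -> L2 L f' -> L2 L g' ->
  (forall k, coef f k * coef g k = coef f' k * coef g' k) -> inner L f g = inner L f' g'.
Proof.
exact: (parseval_eq (volume_gt0 L0) (L2_hartley L) (hartley_orthogonal L0)
  (hartley_complete L0)).
Qed.

Lemma inner_coef_opp f g f' g' : L2 L f -> L2 L g -> L2 L f' -> L2 L g' ->
  (forall k, coef f k * coef g k = coef f' (- k) * coef g' (- k)) ->
  inner L f g = inner L f' g'.
Proof.
exact: (parseval_involutive (volume_gt0 L0) (L2_hartley L) (hartley_orthogonal L0)
  (hartley_complete L0) (@opprK _)).
Qed.

Lemma square_summable_opp c : square_summable c -> square_summable (fun k => c (- k)).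
Proof.
move=> [C Cc]; exists C => s; rewrite (le_trans _ (Cc [fset - k | k in s]%fset))//.
rewrite big_imfset//=; by move=> i j _ _; exact: oppr_inj.
Qed.

Lemma zero_meanE f : zero_mean L f <-> coef f 0 = 0.
Proof.
rewrite /zero_mean /coef (_ : hartley L 0 = cst 1)//.
by apply/funext => x; rewrite hartley0.
Qed.

(** Testing with [hartley L k] gives the coefficients of [g]. Conversely, Parseval along [k] to
    [- k] recovers the pairing with any test function, the coefficients of whose derivative are
    known by classical integration by parts. *)
Lemma weak_partialP i f g : L2 L f -> L2 L g ->
  weak_partial L i f g <-> forall k, coef g k = - wave_number L k i * coef f (- k).
Proof.
move=> Lf Lg; split=> [[_ fg] k|gE].
  have := fg _ (smooth_hartley L k) (periodic_hartley L0 k).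
  rewrite partial_hartley innerZr//; last exact: L2_hartley.
  by rewrite /coef mulNr => ->; rewrite opprK.
split=> // eta seta peta.
have [ceta _] := seta [::]; have [cd _] := seta [:: i].
have Leta : L2 L eta := L2_continuous L ceta.
have Ld : L2 L (partial i eta) := L2_continuous L cd.
rewrite -mulN1r -innerZl//.
apply: inner_coef_opp => //; first exact: L2_boxZ.
move=> k; rewrite coefZ// gE opprK wave_numberN.
by rewrite [X in _ * X = _](inner_partial_hartley L0)// /coef; ring.
Qed.

Definition wave_sqr k : R := \sum_i wave_number L k i ^+ 2.

Lemma wave_sqr_ge0 k : 0 <= wave_sqr k.
Proof. by apply: sumr_ge0 => i _; exact: sqr_ge0. Qed.

Lemma wave_sqrN k : wave_sqr (- k) = wave_sqr k.
Proof. by apply: eq_bigr => i _; rewrite wave_numberN sqrrN. Qed.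

Lemma wave_sqr0 : wave_sqr 0 = 0.
Proof. by apply: big1 => i _; rewrite /wave_number mxE mulr0 expr0n. Qed.

Lemma wave_number_le k i : wave_number L k i ^+ 2 <= wave_sqr k.
Proof. by rewrite /wave_sqr (bigD1 i)//= lerDl; apply: sumr_ge0 => j _; exact: sqr_ge0. Qed.

(** The spectral gap of the Laplacian: [L_i / (2 pi) * kappa_i] is the integer [k_i], of absolute
    value at least [1] for some [i]. *)
Lemma wave_sqr_lower : exists2 C : R, 0 <= C & forall k, k != 0 -> 1 <= C * wave_sqr k.
Proof.
exists (\sum_i (L i / (2 * pi)) ^+ 2); first by apply: sumr_ge0 => i _; exact: sqr_ge0.
move=> k k0; have [i ki] : exists i, k ord0 i != 0.
  apply: contrapT => nk; move/eqP: k0; apply; apply/rowP => i; rewrite mxE.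
  by apply: contrapT => /eqP ki; apply: nk; exists i.
have pi0 : (pi : R) != 0 by rewrite gt_eqF// pi_gt0.
apply: (@le_trans _ _ ((L i / (2 * pi)) ^+ 2 * wave_number L k i ^+ 2)).
  rewrite -exprMn /wave_number (_ : _ * _ = (k ord0 i)%:~R); last first.
    by move: (pi : R) pi0 => q q0; field; rewrite q0 lt0r_neq0.
  rewrite -rmorphXn/= -[1]/(1%:~R) ler_int -gtz0_ge1.
  by rewrite lt_neqAle sqr_ge0 andbT eq_sym sqrf_eq0.
rewrite ler_pM ?sqr_ge0//; last exact: wave_number_le.
by rewrite (bigD1 i)//= lerDl; apply: sumr_ge0 => j _; exact: sqr_ge0.
Qed.

Lemma wave_sqr_gt0 k : k != 0 -> 0 < wave_sqr k.
Proof.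
have [C C0 CP] := wave_sqr_lower; move=> /CP; rewrite lt_def wave_sqr_ge0 andbT.
by apply: contraTneq => ->; rewrite mulr0 ler10.
Qed.

Lemma L2_wpartial i f : L2 L (wpartial L i f).
Proof.
rewrite /wpartial; case: xgetP => [g _ [Lg _]|_]//; exact: L2_box_cst.
Qed.

Lemma weak_partial_wpartial i f g : weak_partial L i f g -> weak_partial L i f (wpartial L i f).
Proof. by move=> fg; apply: xgetPex; exists g. Qed.

Lemma H2per_wpartial i f : H2per L f -> weak_partial L i f (wpartial L i f).
Proof. by move=> [_ /(_ i)[g fg _]]; exact: weak_partial_wpartial fg. Qed.

Lemma coef_wpartial i f k : H2per L f ->
  coef (wpartial L i f) k = - wave_number L k i * coef f (- k).
Proof.
move=> Hf; have [Lf _] := Hf.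
by have /weak_partialP := H2per_wpartial i Hf; apply=> //; exact: L2_wpartial.
Qed.

(** The second derivative [h] in [H2per] belongs to the witness [g], not to the representative
    chosen by [wpartial]; these two have the same coefficients, so [h] serves for both. *)
Lemma coef_wpartial2 i f k : H2per L f ->
  coef (wpartial L i (wpartial L i f)) k = - wave_number L k i ^+ 2 * coef f k.
Proof.
move=> Hf; have [Lf /(_ i)[g fg /(_ i)[h gh]]] := Hf.
have [Lg _] := fg; have [Lh _] := gh.
have Lw := L2_wpartial i f; have Lww := L2_wpartial i (wpartial L i f).
have fgE := (weak_partialP i Lf Lg).1 fg.
have wh : weak_partial L i (wpartial L i f) h.
  apply/weak_partialP => // l; rewrite coef_wpartial// ((weak_partialP i Lg Lh).1 gh).
  by rewrite fgE.
rewrite ((weak_partialP i Lw Lww).1 (weak_partial_wpartial wh)) coef_wpartial//.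
by rewrite opprK wave_numberN; ring.
Qed.

Lemma L2_laplacian f : L2 L (laplacian L f).
Proof. by apply: L2_sum => i; exact: L2_wpartial. Qed.

Lemma coef_laplacian f k : H2per L f -> coef (laplacian L f) k = - wave_sqr k * coef f k.
Proof.
move=> Hf; rewrite /coef /inner (ip_suml _ (F := fun i => wpartial L i (wpartial L i f))).
- rewrite /wave_sqr -sumrN mulr_suml; apply: eq_bigr => i _.
  by rewrite -[LHS]/(coef (wpartial L i (wpartial L i f)) k) coef_wpartial2.
- by move=> i; exact: L2_wpartial.
- exact: L2_hartley.
Qed.

Lemma L2_laplacian1 f : L2 L f -> L2 L (laplacian1 L f).
Proof. by move=> Lf; apply: L2_boxD => //; exact: L2_laplacian. Qed.

Lemma coef_laplacian1 f k : H2per L f ->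
  coef (laplacian1 L f) k = (1 - wave_sqr k) * coef f k.
Proof.
move=> Hf; have [Lf _] := Hf.
by rewrite coefD ?coef_laplacian//; [ring|exact: L2_laplacian].
Qed.

(** The Laplacian controls all the derivatives that [H2per] asks for, mixed ones included, since
    [|kappa_i| <= 1 + |kappa|^2] and [|kappa_i kappa_j| <= |kappa|^2]. *)
Lemma H2perP f : L2 L f ->
  H2per L f <-> square_summable (fun k => wave_sqr k * coef f k).
Proof.
move=> Lf; split=> [Hf|sf].
  apply: square_summable_le (square_summable_coefs (L2_laplacian f)) => k.
  by rewrite coef_laplacian// mulNr normrN.
have sf' := square_summable_opp sf; have sf0 := square_summable_coefs Lf.
have sf0' := square_summable_opp sf0.
have norm_sqr k i : `|wave_number L k i| <= 1 + wave_sqr k.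
  have := wave_number_le k i; rewrite -real_normK ?num_real//.
  by have := sqr_ge0 (`|wave_number L k i| - 1); rewrite sqrrB; nra.
split=> // i.
have [g Lg gE] : exists2 g, L2 L g & forall k, coef g k = - wave_number L k i * coef f (- k).
  apply: ex_coef; apply: (square_summable_le (c' := fun k =>
    `|coef f (- k)| + `|wave_sqr (- k) * coef f (- k)|)); last first.
    by apply: square_summableD; [move: sf0'|move: sf']; apply: square_summable_le => k;
      rewrite normr_id.
  move=> k; rewrite [leRHS]ger0_norm ?addr_ge0// !normrM normrN wave_sqrN.
  rewrite (ger0_norm (wave_sqr_ge0 k)) -[X in X + _]mul1r -mulrDl ler_wpM2r//.
exists g; first exact/weak_partialP.
move=> j.
have [h Lh hE] : exists2 h, L2 L h & forall k, coef h k = - wave_number L k j * coef g (- k).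
  apply: ex_coef; apply: square_summable_le sf => k.
  rewrite gE opprK wave_numberN mulrA normrM [leRHS]normrM ler_wpM2r//.
  rewrite opprK mulNr normrN normrM (ger0_norm (wave_sqr_ge0 k)).
  have := wave_number_le k i; have := wave_number_le k j.
  rewrite -(real_normK (num_real (wave_number L k i))).
  rewrite -(real_normK (num_real (wave_number L k j))).
  by have := sqr_ge0 (`|wave_number L k i| - `|wave_number L k j|); rewrite sqrrB; nra.
by exists h; apply/weak_partialP.
Qed.

Lemma H2perD f g : H2per L f -> H2per L g -> H2per L (fun x => f x + g x).
Proof.
move=> Hf Hg; have [Lf _] := Hf; have [Lg _] := Hg.
apply/H2perP; first exact: L2_boxD.
have := square_summableD ((H2perP Lf).1 Hf) ((H2perP Lg).1 Hg).
by apply: square_summable_le => k; rewrite coefD// mulrDr.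
Qed.

Lemma H2perZ a f : H2per L f -> H2per L (fun x => a * f x).
Proof.
move=> Hf; have [Lf _] := Hf.
apply/H2perP; first exact: L2_boxZ.
have := square_summableZ a ((H2perP Lf).1 Hf).
by apply: square_summable_le => k; rewrite coefZ// mulrCA.
Qed.

Lemma H2perB f g : H2per L f -> H2per L g -> H2per L (fun x => f x - g x).
Proof.
move=> Hf Hg; rewrite (_ : (fun x => _) = fun x => f x + -1 * g x).
  by apply: H2perD => //; exact: H2perZ.
by apply/funext => x; rewrite mulN1r.
Qed.

Lemma ex_multiplier (m : 'rV[int]_d -> R) (C : R) f : L2 L f ->
  (forall k, `|m k| <= C) -> exists2 g, L2 L g & forall k, coef g k = m k * coef f k.
Proof.
move=> Lf mC; apply: ex_coef.
apply: square_summable_le (square_summableZ C (square_summable_coefs Lf)) => k.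
rewrite !normrM ler_wpM2r//; apply: le_trans (mC k) (ler_norm _).
Qed.

Lemma inv_neg_laplacianP v : L2 L v -> zero_mean L v ->
  let p := inv_neg_laplacian L v in
  [/\ H2per L p, zero_mean L p & (fun x => - laplacian L p x) = v %[ae box_measure L]].
Proof.
move=> Lv /zero_meanE v0 /=; rewrite /inv_neg_laplacian.
set Q := [set p | _]; suff : exists p, Q p by exact: xgetPex.
have [C C0 CP] := wave_sqr_lower.
(* The multiplier is bounded by the spectral gap for [k != 0], and at [k = 0] because the inverse of
   [0] is [0]. *)
have [p Lp pE] : exists2 p, L2 L p & forall k, coef p k = (wave_sqr k)^-1 * coef v k.
  apply: (ex_multiplier (C := C)) => // k.
  have [->|k0] := eqVneq k 0; first by rewrite wave_sqr0 invr0 normr0.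
  have w0 := wave_sqr_gt0 k0.
  by rewrite ger0_norm ?invr_ge0 ?(ltW w0)// -[leLHS]mul1r ler_pdivrMr// CP.
have wE k : wave_sqr k * coef p k = coef v k.
  have [->|k0] := eqVneq k 0; first by rewrite wave_sqr0 mul0r v0.
  by rewrite pE mulVKf// gt_eqF// wave_sqr_gt0.
have Hp : H2per L p.
  apply/H2perP => //; apply: square_summable_le (square_summable_coefs Lv) => k.
  by rewrite wE.
exists p; split => //; first by apply/zero_meanE; rewrite pE v0 mulr0.
have Ll := L2_laplacian p.
have LN : L2 L (fun x => - laplacian L p x) := L2N Ll.
apply: coef_eq => // k.
rewrite -wE -[LHS](coef_ae k (f := fun x => -1 * laplacian L p x)) ?coefZ//.
- by rewrite coef_laplacian//; ring.
- exact: L2_boxZ.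
- by apply: aeW => x _; rewrite mulN1r.
Qed.

Lemma coef_inv_neg_laplacian v k : L2 L v -> zero_mean L v ->
  wave_sqr k * coef (inv_neg_laplacian L v) k = coef v k.
Proof.
move=> Lv v0; have [Hp _ pv] := inv_neg_laplacianP Lv v0.
have Ll := L2_laplacian (inv_neg_laplacian L v).
have LN : L2 L (fun x => - laplacian L (inv_neg_laplacian L v) x) := L2N Ll.
rewrite -(coef_ae k LN Lv pv) -[RHS](coef_ae k (f := fun x => -1 * laplacian L (inv_neg_laplacian L v) x)) ?coefZ//.
- by rewrite coef_laplacian//; ring.
- exact: L2_boxZ.
- by apply: aeW => x _; rewrite mulN1r.
Qed.

(** Integration by parts, one coordinate at a time; the gradient at [- k] is matched with the second
    derivative at [k]. *)
Lemma norm_m1_sqr v : L2 L v -> zero_mean L v ->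
  norm_m1 L v ^+ 2 = inner L (inv_neg_laplacian L v) v.
Proof.
move=> Lv v0; have [Hp _ _] := inv_neg_laplacianP Lv v0.
set p := inv_neg_laplacian L v in Hp *; have [Lp _] := Hp.
rewrite sqr_sqrtr; last by apply: sumr_ge0 => i _; exact: sqr_ge0.
have Lw i := L2_wpartial i p; have Lww i := L2_wpartial i (wpartial L i p).
transitivity (inner L p (fun x => -1 * laplacian L p x)).
  rewrite innerZr//; last exact: L2_laplacian.
  rewrite [X in _ * X]/inner (ip_sumr _ (F := fun i => wpartial L i (wpartial L i p)))//.
  rewrite mulN1r -sumrN; apply: eq_bigr => i _.
  rewrite norm2_sqr -[X in _ = - X]/(inner L p (wpartial L i (wpartial L i p))).
  rewrite inner_sym -mulN1r -innerZl//.
  apply: inner_coef_opp => //; first exact: L2_boxZ.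
  move=> k; rewrite coefZ// coef_wpartial2// coef_wpartial//.
  by rewrite wave_numberN; ring.
have Lm : L2 L (fun x => -1 * laplacian L p x) by apply: L2_boxZ; exact: L2_laplacian.
apply: inner_coef_eq => // k; rewrite coefZ; last exact: L2_laplacian.
by rewrite coef_laplacian// -(coef_inv_neg_laplacian k Lv v0) -/p; ring.
Qed.

End fourier.

(** * The embedding of H^2 into bounded functions *)

Section lattice_sum.
Context {R : realType}.

Definition cube_root (a : R) : R := a `^ 3^-1.

Lemma cube_rootK a : 0 <= a -> cube_root a ^+ 3 = a.
Proof.
by move=> a0; rewrite -powR_mulrn ?powR_ge0// -powRrM mulVf// powRr1.
Qed.

Lemma cube_root_ge1 a : 1 <= a -> 1 <= cube_root a.
Proof.
move=> a1; rewrite leNgt; apply/negP => c1.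
have : cube_root a ^+ 3 < 1 by rewrite exprn_ilt1// powR_ge0.
by rewrite cube_rootK ?(le_trans ler01)// ltNge a1.
Qed.

(** This is [(n + 1)^(-4/3)], written with a cube root so that estimates become polynomial in that
    root. *)
Definition lattice_weight (n : nat) : R := (cube_root n.+1%:R ^+ 4)^-1.

Lemma lattice_weight_ge0 n : 0 <= lattice_weight n.
Proof. by rewrite invr_ge0 exprn_ge0// powR_ge0. Qed.

(* With [r^3 = n], [s^3 = n + 1]: [1/r - 1/s = 1/(r s (r^2 + r s + s^2)) >= 1/(3 s^4)]. *)
Lemma sum_lattice_weight N : \sum_(n < N) lattice_weight n <= 4.
Proof.
suff H n : \sum_(i < n.+1) lattice_weight i <= 4 - 3 / cube_root n.+1%:R.
  case: N => [|n]; first by rewrite big_ord0.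
  by apply: le_trans (H n) _; rewrite gerBl divr_ge0// powR_ge0.
have c1 m : 1 <= cube_root m.+1%:R by apply: cube_root_ge1; rewrite ler1n.
elim: n => [|n IH].
  by rewrite big_ord1 /lattice_weight /cube_root powR1 expr1n; lra.
rewrite big_ord_recr /=; apply: le_trans (lerD IH (lexx _)) _.
rewrite /lattice_weight.
have rK := cube_rootK (ler0n R n.+1); have sK := cube_rootK (ler0n R n.+2).
have rs : cube_root n.+2%:R ^+ 3 = cube_root n.+1%:R ^+ 3 + 1.
  by rewrite rK sK natr1.
move: (cube_root n.+1%:R) (cube_root n.+2%:R) (c1 n) (c1 n.+1) rs => r s r1 s1 rs.
have rls : r <= s.
  rewrite leNgt; apply/negP => sr.
  have : s ^+ 3 < r ^+ 3 by rewrite ltrXn2r ?nnegrE//; lra.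
  by rewrite rs; lra.
rewrite -subr_ge0 (_ : _ - _ = (3 * s ^+ 3 * (s - r) - r) / (r * s ^+ 4)); last first.
  by field; rewrite !gt_eqF//; lra.
apply: divr_ge0; last by rewrite mulr_ge0// ?exprn_ge0//; lra.
have E : (s - r) * (s ^+ 2 + s * r + r ^+ 2) = 1.
  by rewrite (_ : _ * _ = s ^+ 3 - r ^+ 3); [rewrite rs; ring|ring].
have sr0 : 0 <= s - r by lra.
have h1 : 1 <= 3 * s ^+ 2 * (s - r).
  rewrite -E [leRHS]mulrC ler_wpM2l//.
  have : s * r <= s * s by rewrite ler_wpM2l//; lra.
  have : r * r <= s * s by rewrite ler_pM//; lra.
  by rewrite !expr2; nra.
have h2 : s <= s * (3 * s ^+ 2 * (s - r)) by rewrite ler_peMr//; lra.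
by rewrite (_ : 3 * s ^+ 3 * (s - r) = s * (3 * s ^+ 2 * (s - r))); [lra|ring].
Qed.

(** The sum over a cube is a product of one-dimensional sums; each absolute value is counted for two
    signs, so every coordinate contributes at most [2 * 4 = 8]. *)
Lemma sum_prod_lattice_weight d (s : {fset 'rV[int]_d}) :
  \sum_(k <- s) \prod_i lattice_weight `|k ord0 i|%N <= 8 ^+ d.
Proof.
have [N sN] : exists N : nat, forall k i, k \in s -> (`|k ord0 i| <= N)%N.
  exists (\max_(k <- s) \max_i `|k ord0 i|)%N => k i ks.
  apply: (@leq_trans (\max_i `|k ord0 i|)%N); last first.
    exact: (@leq_bigmax_seq _ _ xpredT (fun k : 'rV[int]_d => \max_i `|k ord0 i|)%N k ks).
  exact: (leq_bigmax (F := fun i => `|k ord0 i|%N)).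
pose h (k : 'rV[int]_d) : {ffun 'I_d -> bool * 'I_N.+1} :=
  [ffun i => (k ord0 i < 0, inord `|k ord0 i|%N)].
pose F (g : {ffun 'I_d -> bool * 'I_N.+1}) : R := \prod_i lattice_weight (g i).2.
have F0 g : 0 <= F g by apply: prodr_ge0 => i _; exact: lattice_weight_ge0.
have hi : {in s &, injective h}.
  move=> k l ks ls /ffunP kl; apply/rowP => i.
  have := kl i; rewrite !ffunE => -[sg /(congr1 (@nat_of_ord _))].
  rewrite !inordK ?ltnS ?sN// => ab.
  have absE (z : int) : z = if z < 0 then - `|z|%N%:Z else `|z|%N%:Z.
    by case: ltP => z0; rewrite abszE; [rewrite ltr0_norm ?opprK|rewrite ger0_norm].
  by rewrite (absE (k ord0 i)) (absE (l ord0 i)) sg ab.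
have -> : \sum_(k <- s) \prod_i lattice_weight `|k ord0 i|%N = \sum_(g <- map h s) F g.
  rewrite big_map big_seq [RHS]big_seq; apply: eq_bigr => k ks; apply: eq_bigr => i _.
  by rewrite ffunE /= inordK// ltnS sN.
have us : uniq (map h s) by rewrite map_inj_in_uniq// fset_uniq.
rewrite big_uniq//= (@le_trans _ _ (\sum_g F g))//.
  by rewrite [leRHS](bigID (mem (map h s)))/= lerDl sumr_ge0.
rewrite /F -(bigA_distr_bigA (fun i (p : bool * 'I_N.+1) => lattice_weight p.2)) /=.
rewrite -[X in _ ^+ X]card_ord -prodr_const; apply: ler_prod => i _.
apply/andP; split; first by apply: sumr_ge0 => p _; exact: lattice_weight_ge0.
rewrite -(pair_bigA _ (fun (b : bool) (n : 'I_N.+1) => lattice_weight n))/=.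
rewrite big_bool /=; have := sum_lattice_weight N.+1; lra.
Qed.

End lattice_sum.

(** * Absolutely summable coefficients and boundedness *)

Section sobolev.
Context {R : realType} {d : nat}.
Variable L : 'I_d -> R.
Hypothesis L0 : forall i, 0 < L i.
Hypothesis d3 : (d <= 3)%N.

(** Each [(|k_i| + 1)^2] is at most [Q], a multiple of [1 + |kappa|^2]. Hence [r_i^4 <= rho^2] with
    [rho^3 = Q], and the product is at most [rho^(2 d)], which [rho >= 1] and [d <= 3] bound by
    [rho^6 = Q^2]. *)
Lemma lattice_weight_lower : exists2 A : R, 0 < A & forall k : 'rV[int]_d,
  ((1 + wave_sqr L k) ^+ 2)^-1 <= A * \prod_i lattice_weight `|k ord0 i|%N.
Proof.
pose B : R := \sum_i (L i / (2 * pi)) ^+ 2.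
have B0 : 0 <= B by apply: sumr_ge0 => i _; exact: sqr_ge0.
pose A : R := 2 * (1 + B); have A0 : 0 < A by rewrite /A; lra.
exists (A ^+ 2); first exact: exprn_gt0.
move=> k; have w0 := wave_sqr_ge0 L k.
pose Q := A * (1 + wave_sqr L k).
have Q1 : 1 <= Q by rewrite /Q /A; have := mulr_ge0 B0 w0; lra.
have kQ i : (`|k ord0 i|.+1)%:R ^+ 2 <= Q.
  have pi0 : (pi : R) != 0 by rewrite gt_eqF// pi_gt0.
  have kE : (`|k ord0 i|%N%:R : R) ^+ 2 = (L i / (2 * pi)) ^+ 2 * wave_number L k i ^+ 2.
    rewrite -exprMn /wave_number (_ : _ * (_ * _) = (k ord0 i)%:~R); last first.
      by move: (pi : R) pi0 => q q0; field; rewrite q0 lt0r_neq0.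
    by rewrite -[_%:R]/((Posz _)%:~R) abszE intr_norm real_normK ?num_real.
  have kB : (`|k ord0 i|%N%:R : R) ^+ 2 <= B * wave_sqr L k.
    rewrite kE ler_pM ?sqr_ge0 ?wave_number_le//.
    by rewrite /B (bigD1 i)//= lerDl; apply: sumr_ge0 => j _; exact: sqr_ge0.
  rewrite -natr1; move: kB; set t : R := _%:R => kB.
  by have := sqr_ge0 (t - 1); rewrite /Q /A sqrrB sqrrD; have := mulr_ge0 B0 w0; lra.
pose rho := cube_root Q.
have rho1 : 1 <= rho := cube_root_ge1 Q1.
have rhoK : rho ^+ 3 = Q by rewrite cube_rootK//; lra.
pose r i : R := cube_root (`|k ord0 i|.+1)%:R.
have r1 i : 1 <= r i by apply: cube_root_ge1; rewrite ler1n.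
have r2 i : r i ^+ 2 <= rho.
  rewrite -(ler_pXn2r (ltn0Sn 2)) ?nnegrE ?exprn_ge0//; try lra; last by have := r1 i; lra.
  by rewrite rhoK exprAC cube_rootK.
have P0 : 0 < \prod_i r i ^+ 4.
  by apply: prodr_gt0 => i _; apply: exprn_gt0; have := r1 i; lra.
have PQ : \prod_i r i ^+ 4 <= Q ^+ 2.
  apply: (@le_trans _ _ (\prod_(i < d) rho ^+ 2)).
    apply: ler_prod => i _; rewrite exprn_ge0/=; last by have := r1 i; lra.
    rewrite (_ : r i ^+ 4 = (r i ^+ 2) ^+ 2); last by rewrite -exprM.
    by have := r1 i; rewrite lerXn2r// nnegrE ?sqr_ge0//; lra.
  rewrite prodr_const card_ord -rhoK -!exprM.
  by apply: ler_weXn2l => //; rewrite (mulnC 3) leq_mul2l.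
rewrite [X in _ * X](_ : _ = (\prod_i r i ^+ 4)^-1); last by rewrite -prodfV.
rewrite ler_pdivlMr// mulrC ler_pdivrMr; last by apply: exprn_gt0; lra.
by rewrite -exprMn.
Qed.

(** With [q = 1 + |kappa|^2], the inequality [|c_k| = (q |c_k|) q^(-1) <= q^2 c_k^2 + q^(-2)] makes
    the coefficients absolutely summable, so the partial sums are uniformly bounded. *)
Lemma H2per_bounded f : H2per L f ->
  exists C, {ae box_measure L, forall x : 'rV[R]_d, `|f x| <= C}.
Proof.
move=> Hf; have [Lf _] := Hf.
have V0 := volume_gt0 L0.
pose c k := coef L f k.
have [C1 C1P] := square_summableD (square_summable_coefs L0 Lf) ((H2perP L0 Lf).1 Hf).
have [A A0 AP] := lattice_weight_lower.
pose C := C1 + A * 8 ^+ d.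
have sc (s : {fset 'rV[int]_d}) : \sum_(k <- s) `|c k| <= C.
  apply: (@le_trans _ _ (\sum_(k <- s) ((coef L f k + wave_sqr L k * coef L f k) ^+ 2 +
      A * \prod_i lattice_weight `|k ord0 i|%N))); last first.
    rewrite big_split/= -mulr_sumr lerD// ler_wpM2l ?(ltW A0)//.
    exact: sum_prod_lattice_weight.
  apply: ler_sum => k _; apply: le_trans _ (lerD (lexx _) (AP k)).
  have w0 := wave_sqr_ge0 L k.
  rewrite (_ : _ + _ * _ = (1 + wave_sqr L k) * c k); last by rewrite /c; ring.
  have q0 : 0 < 1 + wave_sqr L k by lra.
  move: (1 + wave_sqr L k) q0 => q q0.
  rewrite -exprVn exprMn -(real_normK (num_real (c k))).
  have : `|c k| = (q * `|c k|) * q^-1 by rewrite mulrAC mulfV ?mul1r// gt_eqF.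
  have := sqr_ge0 (q * `|c k| - q^-1); have : 0 <= (q * `|c k|) * q^-1.
    by rewrite mulr_ge0 ?mulr_ge0 ?invr_ge0// ltW.
  by rewrite -exprMn sqrrB; lra.
have V0' : 0 <= (volume L)^-1 by rewrite invr_ge0 ltW.
pose b := C * ((volume L)^-1 * 2).
have psb s x : `|partial_sum (hartley L) (fun k => (volume L)^-1 * c k) s x| <= b.
  apply: le_trans (ler_norm_sum _ _ _) _.
  apply: (@le_trans _ _ (\sum_(k <- s) `|c k| * ((volume L)^-1 * 2))).
    apply: ler_sum => k _; rewrite !normrM (ger0_norm V0') mulrC mulrCA mulrC -mulrA.
    by rewrite [leLHS]mulrCA ler_wpM2l// mulrC ler_wpM2l// hartley_norm.
  by rewrite -mulr_suml ler_wpM2r// mulr_ge0.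
exists b.
(* Since partial sums are bounded by [b], the excess of [|f|] over [b] is at most the distance from
   [f] to any of them, so its norm is zero. No pointwise convergence is involved. *)
pose h x := Num.max (`|f x| - b) 0.
have mf : measurable_fun setT f := L2_measurable Lf.
have mh : measurable_fun setT h.
  apply: measurable_maxr => //; apply: measurable_funB => //.
  exact: measurableT_comp.
have b0 : 0 <= b := le_trans (normr_ge0 _) (psb fset0 0).
have Lh : L2 L h.
  apply: L2P => //; apply: (le_integrable measurableT _ _ (L2_integrableM Lf Lf)).
    by apply/measurable_EFinP; exact: measurable_funX.
  move=> x _; rewrite /= lee_fin -expr2 !normrX lerXn2r ?nnegrE//.
  rewrite /h ger0_norm ?le_max ?lexx ?orbT// ge_max normr_ge0 andbT; lra.
suff h0 : inner L h h = 0.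
  have := ip_eq0 Lh h0; apply: filterS => x /(_ I) hx.
  by rewrite -subr_le0 -hx /h le_max lexx.
apply/eqP; rewrite eq_le inner_ge0 andbT; apply/ler_addgt0Pl => eta eta0; rewrite addr0.
have se0 : 0 < Num.sqrt eta by rewrite sqrtr_gt0.
have [s0 /(_ s0 (fsubset_refl _))] := partial_sum_approx V0 (L2_hartley L)
  (hartley_orthogonal L0) (hartley_complete L0) Lf se0.
rewrite sqr_sqrtr ?(ltW eta0)//= => /(le_trans _); apply.
set S := partial_sum _ _ _.
have LS : L2 L S by exact: (L2_partial_sum (L2_hartley L)).
have LB : L2 L (fun x => f x - S x) by exact: L2_boxB.
apply: le_Rintegral => //; [exact: L2_integrableM|exact: (L2_integrableM LB LB)|].
move=> x _; rewrite -!expr2 -[leRHS]real_normK ?num_real// lerXn2r ?nnegrE//.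
  by rewrite /h le_max lexx orbT.
rewrite /h ge_max normr_ge0 andbT.
by have := ler_dist_dist (f x) (S x); have := psb s0 x; have := ler_norm (`|f x| - `|S x|); rewrite -/S /c; lra.
Qed.

End sobolev.

(** * The scheme *)

Section scheme_coefficients.
Context {R : realType} {d : nat}.
Variable L : 'I_d -> R.
Hypotheses (L0 : forall i, 0 < L i) (d3 : (d <= 3)%N).
Context (M alpha beta eps hvac S dt b : R).
Hypotheses (M0 : 0 < M) (alpha0 : 0 <= alpha) (beta0 : 0 <= beta) (dt0 : 0 < dt).
Implicit Types (s : sav_state R d) (k : 'rV[int]_d).

Lemma L2_sav_H (f : 'rV[R]_d -> R) : H2per L f -> L2 L (sav_H L eps hvac b f).
Proof.
move=> Hf; have [Lf _] := Hf; have mf : measurable_fun setT f := L2_measurable Lf.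
have [C fC] := H2per_bounded L0 d3 Hf.
have mpoly : measurable_fun setT (sav_H L eps hvac b f).
  apply: measurable_funM => //; apply: measurable_funD.
    apply: measurable_funB; first exact: measurable_funX.
    exact: measurable_funM.
  apply: measurable_funM => //; apply: measurable_funM => //; apply: measurable_funB => //.
  exact: measurableT_comp.
apply: (L2_bounded (C := (C ^+ 3 + `|eps| * C + `|hvac| * (C + C) * C) *
   `|(Num.sqrt (radicand L eps hvac b f))^-1|)) => //.
apply: filterS fC => x fC; rewrite /sav_H normrM ler_wpM2r//.
have C0 : 0 <= C := le_trans (normr_ge0 _) fC.
apply: le_trans (ler_normD _ _) _; apply: lerD.
  apply: le_trans (ler_normB _ _) _; apply: lerD.
    by rewrite normrX lerXn2r// nnegrE.
  by rewrite normrM ler_wpM2l.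
rewrite /pot_fvac !normrM ler_pM// ?mulr_ge0// ler_wpM2l//.
by apply: le_trans (ler_normB _ _) _; rewrite normr_id lerD.
Qed.

Definition cn_dagger s0 s1 : 'rV[R]_d -> R :=
  fun x => 3 / 2 * phi s1 x - 2^-1 * phi s0 x.

Lemma H2per_cn_dagger s0 s1 : H2per L (phi s0) -> H2per L (phi s1) ->
  H2per L (cn_dagger s0 s1).
Proof. by move=> H0 H1; apply: (H2perB L0); exact: H2perZ. Qed.

Definition cn_H s0 s1 : 'rV[R]_d -> R := sav_H L eps hvac b (cn_dagger s0 s1).

Definition cn_half (f g : 'rV[R]_d -> R) : 'rV[R]_d -> R := fun x => (g x + f x) / 2.

(** The chemical potential, kept convertible with the local [mu] of [cn_step]. *)
Definition cn_potential s0 s1 s2 : 'rV[R]_d -> R := fun x =>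
  laplacian1 L (laplacian1 L (cn_half (phi s1) (phi s2))) x
  + cn_H s0 s1 x * ((sav s2 + sav s1) / 2)
  + S * (phi s2 x - (2 * phi s1 x - phi s0 x)).

Lemma coef_half f g k : L2 L f -> L2 L g ->
  coef L (cn_half f g) k = (coef L g k + coef L f k) / 2.
Proof.
move=> Lf Lg; rewrite (_ : cn_half f g = fun x => 2^-1 * (g x + f x)).
  by rewrite coefZ ?coefD//; [ring|exact: L2_boxD].
by apply/funext => x; rewrite mulrC.
Qed.

Lemma H2per_half f g : H2per L f -> H2per L g -> H2per L (cn_half f g).
Proof.
move=> Hf Hg; rewrite (_ : cn_half f g = fun x => 2^-1 * (g x + f x)).
  by apply: (H2perZ L0); exact: (H2perD L0).
by apply/funext => x; rewrite mulrC.
Qed.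

Lemma L2_half f g : L2 L f -> L2 L g -> L2 L (cn_half f g).
Proof.
move=> Lf Lg; rewrite (_ : cn_half f g = fun x => 2^-1 * (g x + f x)).
  by apply: L2_boxZ; exact: L2_boxD.
by apply/funext => x; rewrite mulrC.
Qed.

Lemma L2_cn_potential s0 s1 s2 : H2per L (phi s0) -> H2per L (phi s1) ->
  L2 L (phi s2) -> L2 L (cn_potential s0 s1 s2).
Proof.
move=> H0 H1 Lf2; have [Lf0 _] := H0; have [Lf1 _] := H1.
have LH : L2 L (cn_H s0 s1) by apply: L2_sav_H; exact: H2per_cn_dagger.
apply: L2_boxD; [apply: L2_boxD|].
- by apply: L2_laplacian1; apply: L2_laplacian1; exact: L2_half.
- rewrite (_ : (fun x => _) = fun x => (sav s2 + sav s1) / 2 * cn_H s0 s1 x).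
    exact: L2_boxZ.
  by apply/funext => x; rewrite mulrC.
- by apply: L2_boxZ; apply: L2_boxB => //; apply: L2_boxB => //; exact: L2_boxZ.
Qed.

Lemma coef_cn_potential s0 s1 s2 k : H2per L (phi s0) -> H2per L (phi s1) ->
  H2per L (phi s2) -> H2per L (laplacian1 L (cn_half (phi s1) (phi s2))) ->
  coef L (cn_potential s0 s1 s2) k =
    (1 - wave_sqr L k) ^+ 2 * ((coef L (phi s2) k + coef L (phi s1) k) / 2)
    + coef L (cn_H s0 s1) k * ((sav s2 + sav s1) / 2)
    + S * (coef L (phi s2) k - (2 * coef L (phi s1) k - coef L (phi s0) k)).
Proof.
move=> H0 H1 H2 Hw; have [Lf0 _] := H0; have [Lf1 _] := H1; have [Lf2 _] := H2.
have LH : L2 L (cn_H s0 s1) by apply: L2_sav_H; exact: H2per_cn_dagger.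
have Hh := H2per_half H1 H2; have [Lw _] := Hw.
have Lww := L2_laplacian1 Lw.
pose u := (sav s2 + sav s1) / 2.
rewrite (_ : cn_potential s0 s1 s2 = fun x =>
  laplacian1 L (laplacian1 L (cn_half (phi s1) (phi s2))) x + u * cn_H s0 s1 x
  + S * (phi s2 x - (2 * phi s1 x - phi s0 x))); last first.
  by apply/funext => x; rewrite /cn_potential [u * _]mulrC.
have LuH : L2 L (fun x => u * cn_H s0 s1 x) by exact: L2_boxZ.
have L2f1 : L2 L (fun x => 2 * phi s1 x) by exact: L2_boxZ.
have Lst : L2 L (fun x => 2 * phi s1 x - phi s0 x) by exact: L2_boxB.
have Ld : L2 L (fun x => phi s2 x - (2 * phi s1 x - phi s0 x)) by exact: L2_boxB.
rewrite coefD//; [|exact: L2_boxD|exact: L2_boxZ].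
rewrite coefD// !coefZ// coefB// coefB// coefZ//.
by rewrite !coef_laplacian1// coef_half// /u; ring.
Qed.

(** * The equations on coefficients, and conservation of mass *)

Section step.
Variables s0 s1 s2 : sav_state R d.
Hypotheses (adm0 : admissible L s0) (adm1 : admissible L s1).
Hypothesis step : cn_step L M alpha beta eps hvac S dt b s0 s1 s2.

Lemma cn_step_coef_psi k :
  (coef L (psi s2) k + coef L (psi s1) k) / 2 =
  (coef L (phi s2) k - coef L (phi s1) k) / dt.
Proof.
have [[Lf1 _] Lg1 _] := adm1; have [[[Lf2 _] Lg2 _ _] [_ _ e _]] := step.
rewrite -coef_half//.
have Ld : L2 L (fun x => dt^-1 * (phi s2 x - phi s1 x)).
  by apply: L2_boxZ; exact: L2_boxB.
rewrite (coef_ae k (L2_half Lg1 Lg2) Ld); last first.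
  by apply: filterS e => x /[apply] ex; rewrite /cn_half ex mulrC.
by rewrite coefZ ?coefB//; [rewrite mulrC|exact: L2_boxB].
Qed.

Lemma cn_step_coef_mu k :
  alpha * ((coef L (psi s2) k - coef L (psi s1) k) / dt)
    + beta * ((coef L (psi s2) k + coef L (psi s1) k) / 2) =
  - M * wave_sqr L k * coef L (cn_potential s0 s1 s2) k.
Proof.
have [[Lf1 _] Lg1 _] := adm1; have [[[Lf2 _] Lg2 _ Hmu] [_ e _ _]] := step.
have Ll : L2 L (fun x => M * laplacian L (cn_potential s0 s1 s2) x).
  by apply: L2_boxZ; exact: L2_laplacian.
have Lb : L2 L (fun x => psi s2 x - psi s1 x) by exact: L2_boxB.
have Lh := L2_half Lg1 Lg2.
have L1 : L2 L (fun x => alpha / dt * (psi s2 x - psi s1 x)) by exact: L2_boxZ.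
have L3 : L2 L (fun x => beta * cn_half (psi s1) (psi s2) x) by exact: L2_boxZ.
have L4 : L2 L (fun x => alpha / dt * (psi s2 x - psi s1 x)
  + beta * cn_half (psi s1) (psi s2) x) by exact: L2_boxD.
have E : coef L (fun x => alpha / dt * (psi s2 x - psi s1 x)
    + beta * cn_half (psi s1) (psi s2) x) k =
    coef L (fun x => M * laplacian L (cn_potential s0 s1 s2) x) k.
  apply: coef_ae => //; apply: filterS e => x /[apply] <-.
  by rewrite /cn_half; congr (_ + _); ring.
move: E; rewrite coefD// !coefZ// ?coefB// ?coef_half//; last exact: L2_laplacian.
rewrite coef_laplacian// => E.
transitivity (M * (- wave_sqr L k * coef L (cn_potential s0 s1 s2) k)); last by ring.
by rewrite -E; ring.
Qed.

(** At [k = 0] the first equation reads [(alpha / dt + beta / 2) * psi_0 = 0]. The factor vanishes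
    only if [alpha] and [beta] do, and then [mass_condition] applies. *)
Lemma cn_step_zero_mean : zero_mean L (psi s2).
Proof.
have [[Lf1 _] Lg1 /(zero_meanE L) z1] := adm1; have [[[Lf2 _] Lg2 _ Hmu] [mass _ _ _]] := step.
have := cn_step_coef_mu 0; rewrite wave_sqr0 mulr0 mul0r z1 subr0 addr0 => E.
apply/zero_meanE.
have [/eqP|q0] := eqVneq (alpha / dt + beta / 2) 0.
  rewrite paddr_eq0 ?divr_ge0 ?(ltW dt0)// !mulf_eq0 !invr_eq0 (gt_eqF dt0) pnatr_eq0 !orbF.
  by move=> /andP[/eqP a0 /eqP be0]; apply/zero_meanE; exact: mass.
have : (alpha / dt + beta / 2) * coef L (psi s2) 0 = 0 by rewrite -E; ring.
by move/eqP; rewrite mulf_eq0 (negbTE q0) => /eqP.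
Qed.

Lemma cn_step_admissible : admissible L s2.
Proof. by have [[? ? _ _] _] := step; split => //; exact: cn_step_zero_mean. Qed.

End step.

Lemma first_step_zero_mean s0 s1 : admissible L s0 ->
  first_step L M alpha beta eps hvac S dt b s0 s1 -> zero_mean L (psi s1).
Proof.
move=> [[Lf0 _] Lg0 /(zero_meanE L) z0] [[[Lf1 _] Lg1 _ Hmu] [mass e _ _]].
set mu := (fun x => _ + _ + _) in Hmu e.
have Ll := L2_laplacian L mu.
have L1 : L2 L (fun x => alpha / dt * (psi s1 x - psi s0 x) + beta * psi s1 x).
  by apply: L2_boxD; apply: L2_boxZ => //; exact: L2_boxB.
have : coef L (fun x => alpha / dt * (psi s1 x - psi s0 x) + beta * psi s1 x) 0 =
    coef L (fun x => M * laplacian L mu x) 0.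
  apply: coef_ae => //; first exact: L2_boxZ.
  by apply: filterS e => x /[apply] <-; congr (_ + _); ring.
rewrite coefD; [|by apply: L2_boxZ; exact: L2_boxB|exact: L2_boxZ].
rewrite !coefZ//; last exact: L2_boxB.
rewrite coefB// z0 subr0 coef_laplacian// wave_sqr0 oppr0 mul0r mulr0 -mulrDl => E.
apply/zero_meanE; have [/eqP|q0] := eqVneq (alpha / dt + beta) 0.
  rewrite paddr_eq0 ?divr_ge0 ?(ltW dt0)// mulf_eq0 invr_eq0 (gt_eqF dt0) orbF.
  by move=> /andP[/eqP a0 /eqP be0]; apply/zero_meanE; exact: mass.
by move/eqP: E; rewrite mulf_eq0 (negbTE q0) => /eqP.
Qed.

Lemma scn_admissible (s : nat -> sav_state R d) n :
  scn_solution L M alpha beta eps hvac S dt b s -> admissible L (s n).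
Proof.
move=> [[H0 g0] _ st1 st].
have a0 : admissible L (s 0).
  split=> //; rewrite g0; first exact: L2_box_cst.
  by rewrite /zero_mean /inner /Rintegral integral0_eq// => x _; rewrite mul0r.
have a1 : admissible L (s 1).
  have [[? ? _ _] _] := st1; split=> //; exact: first_step_zero_mean st1.
suff : admissible L (s n) /\ admissible L (s n.+1) by case.
elim: n => [|n [an an1]]; first by [].
split=> //; exact: (cn_step_admissible an1 (st n.+1 isT)).
Qed.

Lemma inner_sqrB f g : L2 L f -> L2 L g ->
  inner L (fun x => f x + g x) (fun x => f x - g x) = inner L f f - inner L g g.
Proof.
move=> Lf Lg; rewrite innerDl ?innerBr//; last exact: L2_boxB.
by rewrite (inner_sym g f); ring.
Qed.

Lemma inner_laplacian_inv mu v : H2per L mu -> L2 L v -> zero_mean L v ->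
  inner L (laplacian L mu) (inv_neg_laplacian L v) = - inner L mu v.
Proof.
move=> Hmu Lv v0; have [Lmu _] := Hmu; have [[Lp _] _ _] := inv_neg_laplacianP L0 Lv v0.
have Ll := L2_laplacian L mu.
rewrite -mulN1r -innerZl//; apply: (inner_coef_eq L0) => //; first exact: L2_boxZ.
move=> k; rewrite coefZ// coef_laplacian// -(coef_inv_neg_laplacian L0 k Lv v0); ring.
Qed.

(** A difference of squares, by linearity and symmetry of the inverse Laplacian. Both are checked on
    coefficients, because [inv_neg_laplacian] is only a chosen representative. *)
Lemma inner_inv_neg_laplacian_half v w : L2 L v -> zero_mean L v -> L2 L w -> zero_mean L w ->
  inner L (fun x => w x - v x) (inv_neg_laplacian L (cn_half v w)) =
  2^-1 * (norm_m1 L w ^+ 2 - norm_m1 L v ^+ 2).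
Proof.
move=> Lv v0 Lw w0.
have v0' := (zero_meanE L v).1 v0; have w0' := (zero_meanE L w).1 w0.
have Lh := L2_half Lv Lw.
have h0 : zero_mean L (cn_half v w).
  by apply/zero_meanE; rewrite coef_half// v0' w0' addr0 mul0r.
have [[Lp _] _ _] := inv_neg_laplacianP L0 Lh h0.
have [[Lpv _] _ _] := inv_neg_laplacianP L0 Lv v0.
have [[Lpw _] _ _] := inv_neg_laplacianP L0 Lw w0.
have LB : L2 L (fun x => w x - v x) by exact: L2_boxB.
have LD : L2 L (fun x => inv_neg_laplacian L w x + inv_neg_laplacian L v x).
  exact: L2_boxD.
transitivity (2^-1 * (inner L (inv_neg_laplacian L w) w - inner L (inv_neg_laplacian L v) v));
  last by congr (_ * (_ - _)); apply/esym/norm_m1_sqr.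
transitivity (inner L (fun x => w x - v x)
    (fun x => 2^-1 * (inv_neg_laplacian L w x + inv_neg_laplacian L v x))).
  apply: (inner_coef_eq L0) => //; first exact: L2_boxZ.
  move=> k; rewrite coefB// coefZ// coefD//.
  have [->|k0] := eqVneq k 0; first by rewrite v0' w0' subrr !mul0r.
  congr (_ * _); apply: (mulfI (lt0r_neq0 (wave_sqr_gt0 L0 k0))).
  rewrite coef_inv_neg_laplacian// coef_half// mulrCA mulrDr.
  by rewrite !coef_inv_neg_laplacian// mulrC.
rewrite innerZr// innerBl// !innerDr//.
have -> : inner L v (inv_neg_laplacian L w) = inner L w (inv_neg_laplacian L v).
  apply: (inner_coef_eq L0) => // k.
  by rewrite -(coef_inv_neg_laplacian L0 k Lv v0) -(coef_inv_neg_laplacian L0 k Lw w0); ring.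
by rewrite (inner_sym (inv_neg_laplacian L w)) (inner_sym (inv_neg_laplacian L v) v); ring.
Qed.

(** * The energy law *)

Section energy_law.
Variables s0 s1 s2 : sav_state R d.
Hypotheses (adm0 : admissible L s0) (adm1 : admissible L s1).
Hypothesis step : cn_step L M alpha beta eps hvac S dt b s0 s1 s2.

(* Pairing the first equation with [(-Delta)^-1 psi_half] *)
Lemma cn_step_dissipation :
  alpha / (2 * dt) * (norm_m1 L (psi s2) ^+ 2 - norm_m1 L (psi s1) ^+ 2)
    + beta * norm_m1 L (cn_half (psi s1) (psi s2)) ^+ 2 =
  - (M / dt) * inner L (cn_potential s0 s1 s2) (fun x => phi s2 x - phi s1 x).
Proof.
have [[Lf1 _] Lg1 z1] := adm1.
have [[Lf2 _] Lg2 z2] := cn_step_admissible adm1 step.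
have [[_ _ _ mu2] [_ e1 e2 _]] := step.
have Hmu : H2per L (cn_potential s0 s1 s2) := mu2; have [Lmu _] := Hmu.
have Lh := L2_half Lg1 Lg2.
have h0 : zero_mean L (cn_half (psi s1) (psi s2)).
  by apply/zero_meanE; rewrite coef_half// ((zero_meanE L _).1 z1) ((zero_meanE L _).1 z2) addr0 mul0r.
have [[Lp _] _ _] := inv_neg_laplacianP L0 Lh h0.
have Ld : L2 L (fun x => phi s2 x - phi s1 x) by exact: L2_boxB.
have Ldt : L2 L (fun x => dt^-1 * (phi s2 x - phi s1 x)) by exact: L2_boxZ.
have Ll := L2_laplacian L (cn_potential s0 s1 s2).
have LB : L2 L (fun x => psi s2 x - psi s1 x) by exact: L2_boxB.
have L1 : L2 L (fun x => alpha / dt * (psi s2 x - psi s1 x)) by exact: L2_boxZ.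
have L3 : L2 L (fun x => beta * cn_half (psi s1) (psi s2) x) by exact: L2_boxZ.
have E : inner L (fun x => alpha / dt * (psi s2 x - psi s1 x)
    + beta * cn_half (psi s1) (psi s2) x) (inv_neg_laplacian L (cn_half (psi s1) (psi s2))) =
    inner L (fun x => M * laplacian L (cn_potential s0 s1 s2) x)
      (inv_neg_laplacian L (cn_half (psi s1) (psi s2))).
  apply: inner_ael => //; [exact: L2_boxD|exact: L2_boxZ|].
  by apply: filterS e1 => x /[apply] <-; rewrite /cn_half; congr (_ + _); ring.
move: E; rewrite innerDl// !innerZl// inner_laplacian_inv//.
rewrite inner_inv_neg_laplacian_half// (inner_sym (cn_half _ _)) -(norm_m1_sqr L0 Lh h0).
rewrite (inner_sym (cn_potential _ _ _)).
rewrite (inner_ael Lh Ldt Lmu); last first.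
  by apply: filterS e2 => x /[apply] ex; rewrite /cn_half ex mulrC.
rewrite innerZl// (inner_sym (fun x => phi s2 x - phi s1 x)).
generalize (norm_m1 L (psi s2)), (norm_m1 L (psi s1)),
  (norm_m1 L (cn_half (psi s1) (psi s2))),
  (inner L (cn_potential s0 s1 s2) (fun x => phi s2 x - phi s1 x)) => n2 n1 nh I E.
rewrite invfM; transitivity (alpha / dt * (2^-1 * (n2 ^+ 2 - n1 ^+ 2)) + beta * nh ^+ 2).
  by ring.
by rewrite E; ring.
Qed.

(** Each term of the potential telescopes: the first by symmetry of [Delta + 1], the second by the
    scalar equation, and the stabilization by [2 (a - c) a = a^2 - c^2 + (a - c)^2] for consecutive
    increments [a] and [c] of [phi]. *)
Lemma cn_step_potential :
  inner L (cn_potential s0 s1 s2) (fun x => phi s2 x - phi s1 x) =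
  2^-1 * (norm2 L (laplacian1 L (phi s2)) ^+ 2 - norm2 L (laplacian1 L (phi s1)) ^+ 2)
  + (sav s2 ^+ 2 - sav s1 ^+ 2)
  + S / 2 * (norm2 L (fun x => phi s2 x - phi s1 x) ^+ 2
      - norm2 L (fun x => phi s1 x - phi s0 x) ^+ 2
      + norm2 L (fun x => (phi s2 x - phi s1 x) - (phi s1 x - phi s0 x)) ^+ 2).
Proof.
have [H0 _ _] := adm0; have [Lf0 _] := H0.
have [H1 _ _] := adm1; have [Lf1 _] := H1.
have [[H2 _ Hw _] [_ _ _ e]] := step; have [Lf2 _] := H2.
set w := laplacian1 L _ in Hw.
have Hh := H2per_half H1 H2.
have [Lw _] := Hw; have Lww := L2_laplacian1 Lw.
have LH : L2 L (cn_H s0 s1) by apply: L2_sav_H; exact: H2per_cn_dagger.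
have Ld : L2 L (fun x => phi s2 x - phi s1 x) by exact: L2_boxB.
have Ld' : L2 L (fun x => phi s1 x - phi s0 x) by exact: L2_boxB.
have Ldd : L2 L (fun x => (phi s2 x - phi s1 x) - (phi s1 x - phi s0 x)) by exact: L2_boxB.
rewrite !norm2_sqr.
pose u := (sav s2 + sav s1) / 2.
rewrite (_ : cn_potential s0 s1 s2 = fun x =>
  laplacian1 L w x + u * cn_H s0 s1 x
  + S * ((phi s2 x - phi s1 x) - (phi s1 x - phi s0 x))); last first.
  by apply/funext => x; rewrite /cn_potential [u * _]mulrC; congr (_ + _); ring.
have LuH : L2 L (fun x => u * cn_H s0 s1 x) by exact: L2_boxZ.
have LS : L2 L (fun x => S * ((phi s2 x - phi s1 x) - (phi s1 x - phi s0 x))) by exact: L2_boxZ.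
rewrite innerDl//; last exact: L2_boxD.
rewrite innerDl// !innerZl//.
have -> : inner L (laplacian1 L w) (fun x => phi s2 x - phi s1 x) =
    2^-1 * (inner L (laplacian1 L (phi s2)) (laplacian1 L (phi s2)) -
            inner L (laplacian1 L (phi s1)) (laplacian1 L (phi s1))).
  have L1 := L2_laplacian1 Lf1; have L2' := L2_laplacian1 Lf2.
  have LD : L2 L (fun x => laplacian1 L (phi s2) x + laplacian1 L (phi s1) x) by exact: L2_boxD.
  have LB : L2 L (fun x => laplacian1 L (phi s2) x - laplacian1 L (phi s1) x) by exact: L2_boxB.
  rewrite -inner_sqrB// -innerZl//.
  apply: (inner_coef_eq L0) => //; first exact: L2_boxZ.
  move=> k; rewrite (coefB k Lf2 Lf1) (coefB k L2' L1) (coefZ _ k LD) (coefD k L2' L1).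
  by rewrite !coef_laplacian1// coef_half//; ring.
have -> : u * inner L (cn_H s0 s1) (fun x => phi s2 x - phi s1 x) = sav s2 ^+ 2 - sav s1 ^+ 2.
  have {e} : sav s2 - sav s1 = 2^-1 * inner L (cn_H s0 s1) (fun x => phi s2 x - phi s1 x) := e.
  move=> e; transitivity ((sav s2 + sav s1) * (2^-1 * inner L (cn_H s0 s1) (fun x => phi s2 x - phi s1 x))).
    by rewrite /u; ring.
  by rewrite -e; ring.
congr (_ + _); rewrite !innerBl// !innerBr//; try exact: L2_boxB.
rewrite (inner_sym (phi s1) (phi s2)) (inner_sym (phi s0) (phi s2)) (inner_sym (phi s0) (phi s1)).
by field.
Qed.

(** The dissipation identity is multiplied by [dt / M]; the only term dropped is [S / 2] times the
    squared norm of the second difference. *)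
Lemma energy_dissipation : 0 <= S ->
  energy L M alpha S s1 s2 <= energy L M alpha S s0 s1
    - dt * (beta / M) * norm_m1 L (fun x => (psi s2 x + psi s1 x) / 2) ^+ 2.
Proof.
move=> S0.
have := cn_step_dissipation; rewrite cn_step_potential.
rewrite -[cn_half _ _]/(fun x => (psi s2 x + psi s1 x) / 2).
set m := norm_m1 L (fun x => (psi s2 x + psi s1 x) / 2).
set n1 := norm_m1 L (psi s1); set n2 := norm_m1 L (psi s2).
have := sqr_ge0 (norm2 L (fun x => (phi s2 x - phi s1 x) - (phi s1 x - phi s0 x))).
set dd := _ ^+ 2.
rewrite /energy -/n1 -/n2.
set a2 := norm2 L (laplacian1 L (phi s2)) ^+ 2.
set a1 := norm2 L (laplacian1 L (phi s1)) ^+ 2.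
set d2 := norm2 L (fun x => phi s2 x - phi s1 x) ^+ 2.
set d1 := norm2 L (fun x => phi s1 x - phi s0 x) ^+ 2.
clearbody m n1 n2 a1 a2 d1 d2 dd => dd0 E.
have Sdd : 0 <= S / 2 * dd by rewrite mulr_ge0// divr_ge0.
have {}E : alpha / (2 * M) * (n2 ^+ 2 - n1 ^+ 2) + dt * (beta / M) * m ^+ 2 =
    - (2^-1 * (a2 - a1) + (sav s2 ^+ 2 - sav s1 ^+ 2) + S / 2 * (d2 - d1 + dd)).
  transitivity (dt / M * (alpha / (2 * dt) * (n2 ^+ 2 - n1 ^+ 2) + beta * m ^+ 2)).
    by field; rewrite !gt_eqF.
  by rewrite E; field; rewrite !gt_eqF.
lra.
Qed.

End energy_law.

(** * Unique solvability *)

Section solvability.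
Hypothesis S0 : 0 < S.

(** Eliminating the new [psi] turns the left side of the first equation into
    [2 A (p - phi^n) - (2 alpha / dt) psi^n]. *)
Let A : R := 2 * alpha / dt ^+ 2 + beta / dt.

Let A0 : 0 <= A.
Proof. by rewrite addr_ge0// ?divr_ge0 ?mulr_ge0 ?exprn_ge0// ltW. Qed.

Definition cn_symbol k : R :=
  (1 - wave_sqr L k) ^+ 2 + 2 * S + 2 * A / (M * wave_sqr L k).

(* Inverse of the linear part of the scheme on zero-mean functions. *)
Definition cn_solver k : R := if k == 0 then 0 else (cn_symbol k)^-1.

Lemma cn_symbol_ge k : (1 - wave_sqr L k) ^+ 2 + 2 * S <= cn_symbol k.
Proof.
rewrite lerDl divr_ge0// ?mulr_ge0// ?(ltW M0)//; exact: wave_sqr_ge0.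
Qed.

Lemma cn_symbol_gt0 k : 0 < cn_symbol k.
Proof.
by apply: lt_le_trans (cn_symbol_ge k); rewrite ltr_wpDl ?sqr_ge0// mulr_gt0.
Qed.

Lemma cn_solver_ge0 k : 0 <= cn_solver k.
Proof. by rewrite /cn_solver; case: ifP => // _; rewrite invr_ge0 ltW// cn_symbol_gt0. Qed.

(** These multipliers put [p] in [L^2] and [H^2], and [(Delta + 1) p] in [H^2]. With
    [q = |kappa|^2], each numerator [1], [q], [q (1 - q)] is at most [3/2 (1 - q)^2 + 3/2] in
    absolute value, and [C] is chosen so that [2 S C >= 3/2] and [C >= 3/2]. *)
Lemma cn_solver_bound : exists C : R, forall k,
  [/\ `|cn_solver k| <= C, `|wave_sqr L k * cn_solver k| <= C &
      `|wave_sqr L k * (1 - wave_sqr L k) * cn_solver k| <= C].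
Proof.
pose C := 3 / 2 + 3 / (4 * S).
have C0 : 0 <= C by rewrite addr_ge0// divr_ge0// mulr_ge0// ltW.
exists C => k; rewrite /cn_solver; case: eqP => _; first by rewrite !mulr0 normr0.
have D0 := cn_symbol_gt0 k; have w0 := wave_sqr_ge0 L k.
suff H (m : R) : `|m| <= 3 / 2 * (1 - wave_sqr L k) ^+ 2 + 3 / 2 -> `|m / cn_symbol k| <= C.
  move: w0 H; move: (wave_sqr L k) => q q0 H.
  have q1 := sqr_ge0 (`|1 - q| - 1); have q2 := real_normK (num_real (1 - q)).
  have q3 : q <= 1 + `|1 - q| by have := ler_norm (q - 1); rewrite distrC; lra.
  have q4 : 0 <= `|1 - q| by []; have q5 := sqr_ge0 (1 - q).
  split.
  - by rewrite -[X in `|X|]mul1r; apply: H; rewrite normr1; have := sqr_ge0 (1 - q); lra.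
  - apply: H; rewrite (ger0_norm q0); move: q1; rewrite sqrrB; lra.
  - apply: H; rewrite normrM (ger0_norm q0); move: q1; rewrite sqrrB.
    by have := ler_wpM2r q4 q3; rewrite mulrDl mul1r -expr2; lra.
move=> mb; rewrite normrM [X in _ * X]ger0_norm ?invr_ge0 ?(ltW D0)// ler_pdivrMr//.
apply: le_trans mb _; apply: (@le_trans _ _ (C * ((1 - wave_sqr L k) ^+ 2 + 2 * S))).
  rewrite mulrDr (_ : C * (2 * S) = 3 * S + 3 / 2); last by rewrite /C; field; rewrite gt_eqF.
  apply: lerD; last by rewrite lerDr mulr_ge0// ltW.
  by rewrite ler_wpM2r ?sqr_ge0// /C lerDl divr_ge0// mulr_ge0// ltW.
by rewrite ler_wpM2l// cn_symbol_ge.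
Qed.

Variables s0 s1 : sav_state R d.
Hypotheses (adm0 : admissible L s0) (adm1 : admissible L s1).

Let H0 : H2per L (phi s0). Proof. by case: adm0. Qed.
Let H1 : H2per L (phi s1). Proof. by case: adm1. Qed.
Let Lf0 : L2 L (phi s0). Proof. by case: H0. Qed.
Let Lf1 : L2 L (phi s1). Proof. by case: H1. Qed.
Let Lg1 : L2 L (psi s1). Proof. by case: adm1. Qed.
Let z1 : coef L (psi s1) 0 = 0. Proof. by apply/zero_meanE; case: adm1. Qed.
Let LH : L2 L (cn_H s0 s1).
Proof. by apply: L2_sav_H; exact: H2per_cn_dagger. Qed.

(** The known data. Substituting [phi^(n+1) = 2 p - phi^n] splits the stabilization into [2 S p] and
    [- S (3 phi^n - phi^(n-1))]. *)
Let G k : R := S * (3 * coef L (phi s1) k - coef L (phi s0) k) +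
  (2 * A * coef L (phi s1) k + 2 * alpha / dt * coef L (psi s1) k) / (M * wave_sqr L k).

Let half_coef (u : R) k : R := (if k == 0 then coef L (phi s1) 0 else 0) +
  cn_solver k * (G k - u * coef L (cn_H s0 s1) k).

(** Holds for every solution, so uniqueness is reduced to that of the scalar. *)
Lemma cn_step_half_coef s2 k : cn_step L M alpha beta eps hvac S dt b s0 s1 s2 ->
  coef L (cn_half (phi s1) (phi s2)) k = half_coef ((sav s2 + sav s1) / 2) k.
Proof.
move=> st; have [[H2 Lg2 Hw _] _] := st; have [Lf2 _] := H2.
have z2 := (zero_meanE L _).1 (cn_step_zero_mean adm1 st).
have e2 := cn_step_coef_psi adm1 st k; have e1 := cn_step_coef_mu adm1 st k.
rewrite coef_half// /half_coef /cn_solver.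
have [k0|k0] := eqVneq k 0.
  move: e2; rewrite k0 mul0r addr0 z1 z2 addr0 mul0r => /esym/eqP.
  rewrite mulf_eq0 invr_eq0 (gt_eqF dt0) orbF subr_eq0 => /eqP ->.
  by field.
rewrite add0r coef_cn_potential// in e1 *.
have q0 := wave_sqr_gt0 L0 k0; have D0 := cn_symbol_gt0 k.
apply: (mulfI (lt0r_neq0 D0)); rewrite mulVKf ?lt0r_neq0//.
rewrite /cn_symbol /G /A.
move: (wave_sqr L k) q0 (coef L (phi s0) k) (coef L (phi s1) k) (coef L (phi s2) k)
  (coef L (psi s1) k) (coef L (psi s2) k) (coef L (cn_H s0 s1) k) e1 e2 => q q0 f0 f1 f2 g1 g2 h e1 e2.
have {}e2 : g2 = 2 * ((f2 - f1) / dt) - g1 by rewrite -e2; field.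
set X := (1 - q) ^+ 2 * _ + _ + _ in e1.
have {}e1 : X = - (alpha * ((g2 - g1) / dt) + beta * ((g2 + g1) / 2)) / (M * q).
  by rewrite e1; field; rewrite !gt_eqF.
have : X - (- (alpha * ((g2 - g1) / dt) + beta * ((g2 + g1) / 2)) / (M * q)) = 0.
  by rewrite -e1 subrr.
rewrite /X e2 => {X e1 e2}E.
(* As rational expressions, the difference of the two sides is the residual in [E]. *)
apply/eqP; rewrite -subr_eq0 -E; apply/eqP.
by field; rewrite !gt_eqF.
Qed.

Lemma ex_cn_solver g : L2 L g -> exists2 f, L2 L f &
  forall k, coef L f k = cn_solver k * coef L g k.
Proof.
move=> Lg; have [C CP] := cn_solver_bound.
by apply: (ex_multiplier L0 (C := C)) => // k; case: (CP k).
Qed.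

(** The candidates [p v = mg - v * th] form an affine family in the scalar [v]; the scalar equation
    selects one member, from which the state is rebuilt. *)
Lemma cn_unique_solution : exists2 s2 : sav_state R d,
  cn_step L M alpha beta eps hvac S dt b s0 s1 s2 &
  forall s2' : sav_state R d, cn_step L M alpha beta eps hvac S dt b s0 s1 s2' ->
    state_ae_eq L s2 s2'.
Proof.
have [C0 C00 C0P] := wave_sqr_lower L0.
pose g2 x := 2 * A * phi s1 x + 2 * alpha / dt * psi s1 x.
have La : L2 L (fun x => 2 * A * phi s1 x) by exact: L2_boxZ.
have Lb : L2 L (fun x => 2 * alpha / dt * psi s1 x) by exact: L2_boxZ.
have Lg2 : L2 L g2 by exact: L2_boxD.
have [g2' Lg2' g2E] : exists2 g, L2 L g & forall k, coef L g k = (M * wave_sqr L k)^-1 * coef L g2 k.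
  apply: (ex_multiplier L0 (C := C0 / M)) => // k.
  have [->|k0] := eqVneq k 0.
    by rewrite wave_sqr0 mulr0 invr0 normr0 divr_ge0// ltW.
  have q0 := wave_sqr_gt0 L0 k0.
  rewrite ger0_norm ?invr_ge0 ?mulr_ge0 ?(ltW M0) ?(ltW q0)// invfM mulrC.
  rewrite ler_wpM2r ?invr_ge0 ?(ltW M0)//.
  by rewrite -[leLHS]mul1r ler_pdivrMr// C0P.
pose g x := S * (3 * phi s1 x - phi s0 x) + g2' x.
have L3f : L2 L (fun x => 3 * phi s1 x) by exact: L2_boxZ.
have L3 : L2 L (fun x => 3 * phi s1 x - phi s0 x) by exact: L2_boxB.
have LS3 : L2 L (fun x => S * (3 * phi s1 x - phi s0 x)) by exact: L2_boxZ.
have Lg : L2 L g by exact: L2_boxD.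
have gE k : coef L g k = G k.
  rewrite (coefD k LS3 Lg2') (coefZ S k L3) (coefB k L3f Lf0) (coefZ 3 k Lf1) g2E.
  by rewrite (coefD k La Lb) (coefZ _ k Lf1) (coefZ _ k Lg1) /G; congr (_ + _); rewrite mulrC.
have [tg Ltg tgE] := ex_cn_solver Lg; have [th Lth thE] := ex_cn_solver LH.
have V0 := volume_gt0 L0.
(* The conserved mean, which the solver omits at [k = 0]. *)
pose m : R := coef L (phi s1) 0 / volume L.
have Lm : L2 L (cst m) by exact: L2_box_cst.
have mE k : coef L (cst m) k = if k == 0 then coef L (phi s1) 0 else 0.
  rewrite /coef inner_sym -[inner L _ _]/(inner L (hartley L k) (fun x => cst m x)).
  rewrite (_ : (fun x => cst m x) = fun x => m * (cst 1 : 'rV[R]_d -> R) x); last first.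
    by apply/funext => x; rewrite /= mulr1.
  rewrite innerZr; [|exact: L2_hartley|exact: L2_box_cst].
  rewrite integral_hartley//; case: eqP => _; last by rewrite !mulr0.
  by rewrite mulr1 /m divfK// gt_eqF.
pose mg x := cst m x + tg x.
have Lmg : L2 L mg by exact: L2_boxD.
pose H := cn_H s0 s1.
(* The solver is a nonnegative multiplier, so this is the squared norm of its square root applied to
   [H]. *)
have Hth0 : 0 <= inner L H th.
  have [C CP] := cn_solver_bound.
  have [r Lr rE] : exists2 r, L2 L r & forall k, coef L r k = Num.sqrt (cn_solver k) * coef L H k.
    apply: (ex_multiplier L0 (C := 1 + C)) => // k.
    have [+ _ _] := CP k; have n0 := cn_solver_ge0 k.
    rewrite ger0_norm// => nC; rewrite ger0_norm ?sqrtr_ge0//.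
    have := sqr_ge0 (Num.sqrt (cn_solver k) - 1); rewrite sqrrB sqr_sqrtr//.
    by have := sqrtr_ge0 (cn_solver k); lra.
  have -> : inner L H th = inner L r r; last exact: inner_ge0.
  apply: (inner_coef_eq L0) => // k; rewrite rE thE.
  by rewrite -[in LHS](sqr_sqrtr (cn_solver_ge0 k)); ring.
(* The scalar equation in terms of midpoints: both its increments are twice the distance from the
   midpoint to the old value. *)
pose u := (sav s1 + 2^-1 * (inner L H mg - inner L H (phi s1))) / (1 + 2^-1 * inner L H th).
have den0 : 0 < 1 + 2^-1 * inner L H th by rewrite ltr_pwDl// mulr_ge0.
have uP v : v - sav s1 = 2^-1 * (inner L H mg - v * inner L H th - inner L H (phi s1)) -> v = u.
  move=> E; apply: (mulIf (lt0r_neq0 den0)); rewrite /u divfK ?gt_eqF//.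
  rewrite mulrDr mulr1; lra.
have uE : u - sav s1 = 2^-1 * (inner L H mg - u * inner L H th - inner L H (phi s1)).
  have : u * (1 + 2^-1 * inner L H th) = sav s1 + 2^-1 * (inner L H mg - inner L H (phi s1)).
    by rewrite /u divfK// gt_eqF.
  rewrite mulrDr mulr1; lra.
have Luth v : L2 L (fun x => v * th x) by exact: L2_boxZ.
pose p v x := mg x - v * th x.
have Lp v : L2 L (p v) by exact: L2_boxB.
have pE v k : coef L (p v) k = half_coef v k.
  rewrite (coefB k Lmg (Luth v)) (coefD k Lm Ltg) (coefZ v k Lth) mE tgE thE gE.
  by rewrite /half_coef; ring.
have inner_p v : inner L H (fun x => 2 * (p v x - phi s1 x)) =
    2 * (inner L H mg - v * inner L H th - inner L H (phi s1)).
  have LB : L2 L (fun x => p v x - phi s1 x) by exact: L2_boxB.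
  by rewrite innerZr// innerBr// (innerBr LH Lmg (Luth v)) innerZr.
have [C CP] := cn_solver_bound.
pose g' x := g x - u * H x.
have LuH : L2 L (fun x => u * H x) by exact: L2_boxZ.
have Lg' : L2 L g' by exact: L2_boxB.
have pE' k : coef L (p u) k =
    (if k == 0 then coef L (phi s1) 0 else 0) + cn_solver k * coef L g' k.
  by rewrite pE /half_coef (coefB k Lg LuH) (coefZ u k LH) gE.
have sg' := square_summable_coefs L0 Lg'.
have wpE k : wave_sqr L k * coef L (p u) k = wave_sqr L k * cn_solver k * coef L g' k.
  rewrite pE' mulrDr; case: eqP => [->|_]; first by rewrite wave_sqr0 !mul0r addr0.
  by rewrite mulr0 add0r mulrA.
have C0' : 0 <= C by have [+ _ _] := CP 0; exact: le_trans.
have Hp : H2per L (p u).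
  apply/(H2perP L0) => //; apply: square_summable_le (square_summableZ C sg') => k.
  rewrite wpE normrM [leRHS]normrM ler_wpM2r// (ger0_norm C0').
  by have [] := CP k.
pose w := laplacian1 L (p u).
have Lw : L2 L w by exact: L2_laplacian1.
have Hw : H2per L w.
  apply/(H2perP L0) => //; apply: square_summable_le (square_summableZ C sg') => k.
  rewrite coef_laplacian1// mulrCA wpE mulrA normrM [leRHS]normrM ler_wpM2r//.
  rewrite (ger0_norm C0'); have [_ _] := CP k; congr (`|_| <= _); ring.
(* The new values are reflections of the old ones in the midpoints. *)
pose s2 := SavState (fun x => 2 * p u x - phi s1 x)
  (fun x => 2 * (2 * (p u x - phi s1 x) / dt) - psi s1 x) (2 * u - sav s1).
have phalf : cn_half (phi s1) (phi s2) = p u by apply/funext => x; rewrite /cn_half /=; field.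
have dphi : (fun x => phi s2 x - phi s1 x) = fun x => 2 * (p u x - phi s1 x).
  by apply/funext => x /=; ring.
have psihalf : cn_half (psi s1) (psi s2) = fun x => (phi s2 x - phi s1 x) / dt.
  by apply/funext => x; rewrite /cn_half /=; field; rewrite gt_eqF.
have H2 : H2per L (phi s2) by apply: (H2perB L0) => //; exact: (H2perZ L0).
have [Lf2 _] := H2.
have LB : L2 L (fun x => p u x - phi s1 x) by exact: L2_boxB.
have L4 : L2 L (fun x => 4 / dt * (p u x - phi s1 x)) by exact: L2_boxZ.
have psi2E : psi s2 = fun x => 4 / dt * (p u x - phi s1 x) - psi s1 x.
  by apply/funext => x /=; field; rewrite gt_eqF.
have Lpsi2 : L2 L (psi s2) by rewrite psi2E; exact: L2_boxB.
have coef_psi2 k : coef L (psi s2) k = 4 / dt * (half_coef u k - coef L (phi s1) k) - coef L (psi s1) k.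
  by rewrite psi2E (coefB k L4 Lg1) (coefZ _ k LB) (coefB k (Lp u) Lf1) pE.
have half0 : half_coef u 0 = coef L (phi s1) 0.
  by rewrite /half_coef /cn_solver eqxx mul0r addr0.
pose mu := cn_potential s0 s1 s2.
have Lmu : L2 L mu by exact: L2_cn_potential.
have uh : (sav s2 + sav s1) / 2 = u by rewrite /=; field.
(* The first equation reads [M |kappa|^2 mu_k = r_k]; as [r] is square integrable, this puts [mu] in
   [H^2]. *)
pose r x := (2 * A * phi s1 x + 2 * alpha / dt * psi s1 x) - 2 * A * p u x.
have LAp : L2 L (fun x => 2 * A * p u x) by exact: L2_boxZ.
have Lr : L2 L r by exact: L2_boxB.
have rE k : coef L r k = 2 * A * coef L (phi s1) k + 2 * alpha / dt * coef L (psi s1) k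
    - 2 * A * half_coef u k.
  rewrite (coefB k Lg2 LAp) (coefD k La Lb) (coefZ _ k Lf1) (coefZ _ k Lg1).
  by rewrite (coefZ _ k (Lp u)) pE.
have muE k : M * wave_sqr L k * coef L mu k = coef L r k.
  rewrite rE; have [->|k0] := eqVneq k 0.
    by rewrite wave_sqr0 half0 z1; ring.
  have q0 := wave_sqr_gt0 L0 k0.
  rewrite /mu coef_cn_potential//; last by rewrite phalf.
  rewrite uh.
  have -> : coef L (phi s2) k = 2 * half_coef u k - coef L (phi s1) k.
    rewrite -pE -(coefZ 2 k (Lp u)) -(coefB k (L2_boxZ 2 (Lp u)) Lf1)//.
  have D0 := cn_symbol_gt0 k.
  have : cn_symbol k * half_coef u k = G k - u * coef L (cn_H s0 s1) k.
    by rewrite /half_coef /cn_solver (negbTE k0) add0r mulVKf// gt_eqF.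
  rewrite /cn_symbol /G.
  move: (half_coef u k) (wave_sqr L k) q0 (coef L (phi s0) k) (coef L (phi s1) k)
    (coef L (psi s1) k) (coef L (cn_H s0 s1) k) => h q q0 f0 f1 g1 cH E.
  have {}E : cH * u = S * (3 * f1 - f0) + (2 * A * f1 + 2 * alpha / dt * g1) / (M * q)
      - ((1 - q) ^+ 2 + 2 * S + 2 * A / (M * q)) * h by rewrite mulrC; lra.
  by rewrite E; clear E; move: A => A'; field; rewrite !gt_eqF.
have Hmu : H2per L mu.
  apply/(H2perP L0) => //.
  apply: square_summable_le (square_summableZ M^-1 (square_summable_coefs L0 Lr)) => k.
  by rewrite -muE -[M * _ * _]mulrA mulKf// gt_eqF.
have st2 : cn_step L M alpha beta eps hvac S dt b s0 s1 s2.
  split; first by split => //; rewrite -[laplacian1 L _]/(laplacian1 L (cn_half (phi s1) (phi s2))) phalf.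
  split.
  - move=> _ _; apply/zero_meanE; rewrite coef_psi2 half0 z1; ring.
  - have Lh := L2_half Lg1 Lpsi2.
    have LBp : L2 L (fun x => psi s2 x - psi s1 x) by exact: L2_boxB.
    have L5 : L2 L (fun x => alpha / dt * (psi s2 x - psi s1 x)) by exact: L2_boxZ.
    have L6 : L2 L (fun x => beta * cn_half (psi s1) (psi s2) x) by exact: L2_boxZ.
    have L7 : L2 L (fun x => alpha / dt * (psi s2 x - psi s1 x)
      + beta * cn_half (psi s1) (psi s2) x) by exact: L2_boxD.
    have Ll := L2_laplacian L mu.
    have L8 : L2 L (fun x => M * laplacian L mu x) by exact: L2_boxZ.
    have E : (fun x => alpha / dt * (psi s2 x - psi s1 x)
      + beta * cn_half (psi s1) (psi s2) x) = (fun x => M * laplacian L mu x) %[ae box_measure L].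
      apply: (coef_eq L0) => // k.
      rewrite (coefD k L5 L6) (coefZ _ k LBp) (coefB k Lpsi2 Lg1) (coefZ _ k Lh).
      rewrite coef_half// (coefZ _ k Ll) coef_laplacian//.
      have -> : M * (- wave_sqr L k * coef L mu k) = - coef L r k by rewrite -muE; ring.
      rewrite rE coef_psi2 /A.
      by field; rewrite gt_eqF.
    apply: filterS E => x /[apply] <-; rewrite /cn_half; ring.
  - by apply: aeW => x _; exact: (congr1 (fun f => f x) psihalf).
  - rewrite -[sav_H _ _ _ _ _]/H dphi inner_p mulrCA -uE /=; ring.
exists s2 => // s2' st.
have [[H2' Lpsi2' _ _] [_ _ e2 e3]] := st; have [Lf2' _] := H2'.
pose v := (sav s2' + sav s1) / 2.
have Lh' := L2_half Lf1 Lf2'.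
have pv : cn_half (phi s1) (phi s2') = p v %[ae box_measure L].
  by apply: (coef_eq L0) => // k; rewrite (cn_step_half_coef k st) pE.
(* The midpoint of any other solution is [p v], so its scalar solves the same linear equation. *)
have vu : v = u.
  apply: uP.
  have LBv : L2 L (fun x => 2 * (p v x - phi s1 x)) by apply: L2_boxZ; exact: L2_boxB.
  have LB' : L2 L (fun x => phi s2' x - phi s1 x) by exact: L2_boxB.
  have : sav s2' - sav s1 = 2^-1 * inner L (fun x => phi s2' x - phi s1 x) H.
    by rewrite inner_sym; exact: e3.
  rewrite (inner_ael LB' LBv LH); last first.
    by apply: filterS pv => x /[apply] <-; rewrite /cn_half; field.
  rewrite inner_sym inner_p /v; lra.
split.
- by apply: filterS pv => x /[apply]; rewrite vu /cn_half /= => <-; field.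
- apply: filterS2 pv e2 => x pvx e2x I; rewrite psi2E /=.
  have {}pvx := pvx I; have {}e2x := e2x I.
  have -> : psi s2' x = 2 * ((phi s2' x - phi s1 x) / dt) - psi s1 x by rewrite -e2x; field.
  by rewrite -vu -pvx /cn_half; field; rewrite gt_eqF.
- by rewrite /= -vu /v; field.
Qed.

End solvability.
End scheme_coefficients.

Theorem theorem3p2 (R : realType) (d : nat) (L : 'I_d -> R)
    (M alpha beta eps hvac S dt b : R)
    (hd : (1 <= d <= 3)%N) (hL : forall i, 0 < L i)
    (hM : 0 < M) (halpha : 0 <= alpha) (hbeta : 0 <= beta)
    (heps : 0 < eps < 1) (hhvac : 0 <= hvac) (hS : 0 < S) (hdt : 0 < dt)
    (hb : forall v : 'rV[R]_d -> R, H2per L v -> 0 < radicand L eps hvac b v) :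
  (forall s0 s1 : sav_state R d, admissible L s0 -> admissible L s1 ->
     exists2 s2 : sav_state R d,
       cn_step L M alpha beta eps hvac S dt b s0 s1 s2 &
       forall s2' : sav_state R d,
         cn_step L M alpha beta eps hvac S dt b s0 s1 s2' ->
         state_ae_eq L s2 s2')
  /\
  (forall s : nat -> sav_state R d,
     scn_solution L M alpha beta eps hvac S dt b s ->
     forall n : nat, (1 <= n)%N ->
       energy L M alpha S (s n) (s n.+1)
       <= energy L M alpha S (s n.-1) (s n)
          - dt * (beta / M)
            * norm_m1 L (fun x => (psi (s n.+1) x + psi (s n) x) / 2) ^+ 2).
Proof.
have /andP[_ d3] := hd.
split=> [s0 s1 a0 a1|s sol n n1].
  exact: (cn_unique_solution hL d3 eps hvac b hM halpha hbeta hdt hS a0 a1).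
have adm m := scn_admissible hL halpha hbeta hdt m sol.
have [_ _ _ step] := sol.
exact: (energy_dissipation hL d3 hM halpha hbeta hdt (adm _) (adm _) (step n n1) (ltW hS)).
Qed.
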